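(* Let $\Sigma$ (a $d\times d_1$ matrix function) and $b$ be Borel measurable on $\mathbb{R}^d$, $A=\Sigma\Sigma^t$. Let $\mu$ and $\nu$ be probability solutions to $L^*\mu=0$ and $L^*\nu=0$ such that $$\int_{\mathbb{R}^d}\Bigl(\frac{\|\Sigma(x)\|^2}{1+|x|^2}+\frac{|b(x)|}{1+|x|}\Bigr)(\mu+\nu)(dx)<\infty.$$ Then there exists a Borel probability measure $\pi$ on $\mathbb{R}^d\times\mathbb{R}^d$ which is a probability solution to $\mathbb{L}^*\pi=0$ and whose projection (marginal) on the first factor is $\mu$ and on the second factor is $\nu$.
   Context: For a symmetric nonnegative definite matrix $A(x)=(a^{ij}(x))$ and a vector field $b(x)=(b^i(x))$ with Borel measurable entries, $Lf(x)=\mathrm{trace}(A(x)D^2f(x))+\langle b(x),\nabla f(x)\rangle$. A probability solution to $L^*\mu=0$ is a Borel probability measure $\mu$ on $\mathbb{R}^d$ such that all $a^{ij}$ and $b^i$ are $\mu$-integrable on every compact set and $\int_{\mathbb{R}^d}Lf\,d\mu=0$ for every $f\in C_0^\infty(\mathbb{R}^d)$. Here $A(x)=\Sigma(x)\Sigma(x)^t$. The doubled operator on $\mathbb{R}^d\times\mathbb{R}^d$ is $$\mathbb{L}\psi(x,y)=\mathrm{trace}\bigl(\mathbb{A}(x,y)D^2\psi(x,y)\bigr)+\langle\mathbb{B}(x,y),\nabla\psi(x,y)\rangle,$$ $$\mathbb{A}(x,y)=\begin{pmatrix}A(x)&\Sigma(x)\Sigma(y)^t\\ \Sigma(y)\Sigma(x)^t&A(y)\end{pmatrix},\qquad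 \mathbb{B}(x,y)=\begin{pmatrix}b(x)\\ b(y)\end{pmatrix},$$ and a probability solution to $\mathbb{L}^*\pi=0$ is defined analogously on $\mathbb{R}^{2d}$ (entries of $\mathbb{A},\mathbb{B}$ locally $\pi$-integrable and $\int\mathbb{L}\psi\,d\pi=0$ for all $\psi\in C_0^\infty(\mathbb{R}^{2d})$). *)

(* Defs.v *)
From HB Require Import structures.
From mathcomp Require Import all_boot all_order all_algebra.
From mathcomp Require Import all_classical all_reals all_analysis.
Set Implicit Arguments. Unset Strict Implicit. Unset Printing Implicit Defensive.
Import Order.TTheory GRing.Theory Num.Theory.
Import numFieldNormedType.Exports.
Local Open Scope classical_set_scope.
Local Open Scope ring_scope.

(* R^n is represented by row vectors 'rV[R]_n (with their normed topology).
   [Rd R n] is the same carrier equipped with the Borel sigma-algebra,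
   i.e. the sigma-algebra generated by the open sets of 'rV[R]_n. *)
Definition Rd (R : realType) (n : nat) :=
  g_sigma_algebraType (@open 'rV[R]_n).

Section ops.
Variables (R : realType) (n : nat).

Definition ebasis (i : 'I_n) : 'rV[R]_n := delta_mx 0 i.

Definition partial (i : 'I_n) (f : 'rV[R]_n -> R) : 'rV[R]_n -> R :=
  fun x => 'D_(ebasis i) f x.

Definition iter_partial (s : seq 'I_n) (f : 'rV[R]_n -> R) : 'rV[R]_n -> R :=
  foldr partial f s.

(* f in C_0^infty(R^n): all iterated partial derivatives exist and are
   differentiable everywhere (hence f is C^infty), and f has compact support *)
Definition smooth_compact (f : 'rV[R]_n -> R) : Prop :=
  (forall (s : seq 'I_n) (x : 'rV[R]_n), differentiable (iter_partial s f) x)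
  /\ compact (closure [set x | f x != 0]).

Definition gradient (f : 'rV[R]_n -> R) (x : 'rV[R]_n) : 'rV[R]_n :=
  \row_i partial i f x.

Definition hessian (f : 'rV[R]_n -> R) (x : 'rV[R]_n) : 'M[R]_n :=
  \matrix_(i, j) partial i (partial j f) x.

Definition Lop (A : 'rV[R]_n -> 'M[R]_n) (b : 'rV[R]_n -> 'rV[R]_n)
  (f : 'rV[R]_n -> R) (x : 'rV[R]_n) : R :=
  \tr (A x *m hessian f x) + \sum_i b x 0 i * gradient f x 0 i.

Definition prob_solution (A : 'rV[R]_n -> 'M[R]_n) (b : 'rV[R]_n -> 'rV[R]_n)
  (mu : probability (Rd R n) R) : Prop :=
  [/\ (forall (K : set 'rV[R]_n), compact K ->
        (forall i j, mu.-integrable (K : set (Rd R n)) (fun x => (A x i j)%:E)) /\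
        (forall i, mu.-integrable (K : set (Rd R n)) (fun x => (b x 0 i)%:E)))
    & (forall f : 'rV[R]_n -> R, smooth_compact f ->
        (\int[mu]_(x in setT) (Lop A b f x)%:E = 0)%E)].

Definition euclid (x : 'rV[R]_n) : R := Num.sqrt (\sum_i x 0 i ^+ 2).
Definition hsnorm (m : nat) (M : 'M[R]_(n, m)) : R :=
  Num.sqrt (\sum_i \sum_j M i j ^+ 2).

End ops.

Section doubled.
Variables (R : realType) (d d1 : nat).
Variables (Sigma : 'rV[R]_d -> 'M[R]_(d, d1)) (b : 'rV[R]_d -> 'rV[R]_d).

Definition Amat (x : 'rV[R]_d) : 'M[R]_d := Sigma x *m (Sigma x)^T.

Definition AA (z : 'rV[R]_(d + d)) : 'M[R]_(d + d) :=
  let x := lsubmx z in let y := rsubmx z in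
  block_mx (Amat x) (Sigma x *m (Sigma y)^T)
           (Sigma y *m (Sigma x)^T) (Amat y).

Definition BB (z : 'rV[R]_(d + d)) : 'rV[R]_(d + d) :=
  row_mx (b (lsubmx z)) (b (rsubmx z)).

End doubled.

(* Main.v *)
Require Import Defs.
From HB Require Import structures.
From mathcomp Require Import all_boot all_order all_algebra.
From mathcomp Require Import all_classical all_reals all_analysis.
From mathcomp Require Import measurable_realfun.
From mathcomp Require Import ring lra.
Import Order.TTheory GRing.Theory Num.Theory.
Import numFieldNormedType.Exports.
Local Open Scope classical_set_scope.
Local Open Scope ring_scope.
Set Implicit Arguments. Unset Strict Implicit. Unset Printing Implicit Defensive.

(* For finitely many test functions phi_i, quantizing the drift and the
   dispersion of (phi_i) and mollifying its values on a fine lattice replaces each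
   of the two diffusions by a finite Markov chain with jumps
   +- eps * Sigma^t grad phi_i and eps^2 * L phi_i, whose law is invariant up to
   o(eps^2) in total variation. The two chains are driven by the same random jump;
   after correction of the marginals and Cesaro averaging this gives an almost
   stationary coupling of the two finite laws, which spreads out to a density w
   with respect to mu x nu such that w (mu x nu) is a coupling of mu and nu that
   almost annihilates the doubled operator on all phi_i (x) phi_j.
   By Tychonoff's theorem these couplings, as functions on rectangles, have a
   cluster point; regularity of the marginals makes it sigma-additive, and the
   integrals pass to the limit because a product f(x) g(y) is a combination of
   rectangles up to an error a(x) + c(y) seen by the marginals only. Finally
   combinations of products of one-variable functions are dense in C^2 among the
   test functions on R^(2d), with common compact support. *)

(** * Couplings as cluster points on rectangles *)

(** Nothing but the integral identity is known about [mu] and [nu]: no process or semigroup is at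
    hand to be coupled. Invariance is used only through functions [F] of finitely many observables,
    where the chain rule turns it into a statement on [R^n]. The coefficients are not functions of
    the observables; averaging them over the mollified cell of a lattice state is what produces a
    finite chain. The width [1 / H] of the mollifiers stays fixed while the lattice is refined with
    the step [1 / E]: their derivatives carry a factor [M^-n] that pays for the order of [M^n]
    states, so that the defect of invariance, summed over all states, is [E^-2] times a small
    quantity. A defect of order [E^-2] would be useless, since one step changes the product of two
    positions by just this order. The cross term arises because both chains make the same jump: to
    leading order the summed products of increments are twice the products of cell means, and given
    the two cells the points are independent under [w], so these products are integrals of the
    quantized off-diagonal part. *)

Section regularity.
Variables (R : realType) (n : nat) (mu : probability (Rd R n) R).

Lemma open_measurable_Rd (U : set 'rV[R]_n) : open U -> measurable (U : set (Rd R n)).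
Proof. by move=> oU; apply: sub_sigma_algebra. Qed.

Lemma closed_measurable_Rd (F : set 'rV[R]_n) : closed F -> measurable (F : set (Rd R n)).
Proof.
by move=> cF; rewrite -(setCK F); apply: measurableC; apply: open_measurable_Rd;
  exact: closed_openC.
Qed.

Definition approximable (A : set (Rd R n)) := measurable A /\
  forall e : R, 0 < e -> exists F U : set 'rV[R]_n,
    [/\ closed F, open U, F `<=` A, A `<=` U & (mu (U `\` F) < e%:E)%E].

Lemma approximable_open (U : set 'rV[R]_n) : open U -> approximable U.
Proof.
move=> oU; split; first exact: open_measurable_Rd.
(* The points at distance at least [1 / (k + 1)] from the complement of [U]: a closed set,
   increasing to [U] because [U] is open. Continuity of [mu] from above on [U] minus [F k]
   concludes. *)
pose F k := ~` (\bigcup_(y in ~` U) ball y (k.+1%:R^-1 : R)).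
have cF k : closed (F k).
  by apply: open_closedC; apply: bigcup_open => y _; exact: ball_open.
pose G k : set (Rd R n) := U `\` F k.
have mG k : measurable (G k).
  by apply: measurableD; [exact: open_measurable_Rd|exact: closed_measurable_Rd].
have FU k : F k `<=` U.
  move=> x Fx; apply: contrapT => Ux; apply: Fx; exists x => //.
  by apply: ballxx; rewrite invr_gt0.
have G0 : \bigcap_k G k = set0.
  rewrite -subset0 => x Gx.
  have /nbhs_ballP[e /= e0 eU] : nbhs x U.
    by apply: open_nbhs_nbhs; split => //; have [] := Gx 0%N I.
  have [k ke] : exists k, k.+1%:R^-1 < e :> R.
    by have [k _ /(_ k (leqnn _)) h] := near_infty_natSinv_lt (PosNum e0); exists k.
  have [_ ] := Gx k I; apply.
  move=> -[y Uy yx]; apply: Uy; apply: eU; apply: le_ball (ltW ke) _ _.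
  exact: ball_sym.
have := @nonincreasing_cvg_mu _ _ _ mu G.
rewrite G0 measure0 => /(_ _ mG measurable0) cv.
have {}cv : mu (G k) @[k --> \oo] --> 0%E.
  apply: cv.
  - by apply: le_lt_trans (probability_le1 _ (mG 0%N)) _; rewrite ltry.
  - move=> i j ij; apply/subsetPset => x [Ux Fx]; split => //.
    apply: contra_not Fx => Fx [y Uy yx]; apply: Fx; exists y => //.
    apply: le_ball yx.
    by rewrite lef_pV2 ?posrE// ler_nat.
move=> e e0.
have /cv[k _ /(_ k)] : nbhs (0%E : \bar R) [set x | (x < e%:E)%E].
  by apply: open_nbhs_nbhs; split; [exact: open_ereal_lt_ereal|rewrite /= lte_fin].
move=> /(_ (leqnn _)) /= Gk.
by exists (F k), U; split.
Qed.

Lemma approximable_setC A : approximable A -> approximable (~` A).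
Proof.
move=> [mA hA]; split; first exact: measurableC.
move=> e /hA[F [U [cF oU FA AU FUe]]].
exists (~` U), (~` F); split.
- exact: open_closedC.
- exact: closed_openC.
- exact: subsetC.
- exact: subsetC.
- by rewrite setDE setCK setIC -setDE.
Qed.

(** Outer sets may be united countably, with errors [e / 2 / 2^(k+1)]. A countable union of closed
    sets need not be closed, so the inner union is cut at an [N] beyond which it gains less than
    [e / 2]. *)
Lemma approximable_bigcup (A : (set (Rd R n))^nat) :
  (forall k, approximable (A k)) -> approximable (\bigcup_k A k).
Proof.
move=> hA; have mA k : measurable (A k) by case: (hA k).
split; first exact: bigcup_measurable.
move=> e e0.
have /choice[F /choice[U FU]] : forall k, exists F U : set 'rV[R]_n,
    [/\ closed F, open U, F `<=` A k, A k `<=` U &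
     (mu (U `\` F) < (e / 2 / (2 ^ k.+1)%:R)%:E)%E].
  move=> k; apply: (hA k).2.
  by rewrite !divr_gt0// ltr0n expn_gt0.
have mF k : measurable (F k : set (Rd R n)).
  by apply: closed_measurable_Rd; case: (FU k).
have mU k : measurable (U k : set (Rd R n)).
  by apply: open_measurable_Rd; case: (FU k).
pose FN N : set (Rd R n) := \big[setU/set0]_(k < N) F k.
have mFN N : measurable (FN N) by apply: bigsetU_measurable.
have mFU : measurable (\bigcup_k F k : set (Rd R n)) by apply: bigcup_measurable.
pose G N : set (Rd R n) := (\bigcup_k F k) `\` FN N.
have mG N : measurable (G N) by apply: measurableD.
have G0 : \bigcap_N G N = set0.
  rewrite -subset0 => x Gx; have [[k _ Fkx] _] := Gx 0%N I.
  have [_ ] := Gx k.+1 I; apply; rewrite /FN -bigcup_mkord.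
  by exists k => //=.
have cv : mu (G k) @[k --> \oo] --> 0%E.
  rewrite -(measure0 mu) -G0; apply: nonincreasing_cvg_mu => //.
  - by apply: le_lt_trans (probability_le1 _ (mG 0%N)) _; rewrite ltry.
  - by rewrite G0.
  - move=> i j ij; apply/subsetPset => x [Ux Fx]; split => //.
    apply: contra_not Fx; rewrite /FN -!bigcup_mkord => -[k /= ki Fk].
    by exists k => //=; exact: leq_trans ki ij.
have /cv[N _ /(_ N)] : nbhs (0%E : \bar R) [set x | (x < (e/2)%:E)%E].
  by apply: open_nbhs_nbhs; split; [exact: open_ereal_lt_ereal|rewrite /= lte_fin divr_gt0].
move=> /(_ (leqnn _)) /= GN.
exists (FN N), (\bigcup_k U k); split.
- by rewrite /FN -bigcup_mkord; apply: closed_bigcup => // k _; case: (FU k).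
- by apply: bigcup_open => k _; case: (FU k).
- rewrite /FN -bigcup_mkord => x [k _ Fx]; exists k => //.
  by case: (FU k) => _ _ + _ _; apply.
- by move=> x [k _ Ax]; exists k => //; case: (FU k) => _ _ _ + _; apply.
have sub : (\bigcup_k U k) `\` FN N `<=` (\bigcup_k (U k `\` F k)) `|` G N.
  move=> x [[k _ Ux] Fx]; have [[j _ Fj]|nF] := pselect ((\bigcup_k F k) x).
    by right; split => //; exists j.
  by left; exists k => //; split => // Fk; apply: nF; exists k.
have mUF : measurable (\bigcup_k (U k `\` F k) : set (Rd R n)).
  by apply: bigcup_measurable => k _; apply: measurableD.
have h1 : (mu (\bigcup_k (U k `\` F k)) <= (e/2)%:E)%E.
  apply: (@le_trans _ _ (\sum_(0 <= k <oo) (0 + (e / 2 / (2 ^ k.+1)%:R)%:E))%E).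
    apply: (le_trans (measure_sigma_subadditive (F := fun k => U k `\` F k) mu _ mUF _)) => //.
      by move=> k; apply: measurableD.
    apply: lee_nneseries => k _ //; rewrite add0e.
    by apply: ltW; case: (FU k).
  apply: le_trans (epsilon_trick _ _ _) _ => //; first by rewrite ltW// divr_gt0.
  by rewrite eseries0// add0e.
apply: le_lt_trans (_ : (mu ((\bigcup_k (U k `\` F k)) `|` G N) < _)%E).
  apply: le_measure; rewrite ?inE//.
  - by apply: measurableD => //; apply: bigcup_measurable.
  - by apply: measurableU.
apply: le_lt_trans (measureU2 _ _ _) _ => //.
by rewrite (splitr e) EFinD; apply: lee_ltD => //; apply: fin_num_measure.
Qed.

(** The approximable sets form a sigma-algebra that contains the open sets. *)
Lemma approximableT A : measurable A -> approximable A.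
Proof.
move: A; apply: smallest_sub => [|U oU]; last exact: approximable_open.
split.
- by have := approximable_open open0.
- by move=> A hA; rewrite setTD; exact: approximable_setC.
- exact: approximable_bigcup.
Qed.

(** Closed sets become compact after intersection with a large ball, whose complement has small mass
    since the complements decrease to the empty set. *)
Lemma inner_compact_outer_open (A : set (Rd R n)) (e : R) : measurable A -> 0 < e ->
  exists K U : set 'rV[R]_n,
    [/\ compact K, open U, K `<=` A, A `<=` U & (mu (U `\` K) < e%:E)%E].
Proof.
move=> mA e0; have e20 : 0 < e/2 by rewrite divr_gt0.
have [F [U [cF oU FA AU FUe]]] := (approximableT mA).2 _ e20.
pose B k : set 'rV[R]_n := [set x | k%:R < `|x|].
have oB k : open (B k).
  rewrite (_ : B k = Num.norm @^-1` [set y | k%:R < y])//.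
  apply: open_comp; first by move=> x _; exact: norm_continuous.
  exact: (@open_gt R k%:R).
have mB k : measurable (B k : set (Rd R n)) by exact: open_measurable_Rd.
have B0 : \bigcap_k (B k) = set0.
  rewrite -subset0 => x /(_ (Num.bound `|x|) I) /=.
  by rewrite /B/= ltNge => /negP; apply; rewrite ltW// archi_boundP.
have cv : mu (B k) @[k --> \oo] --> 0%E.
  rewrite -(measure0 mu) -[in X in _ --> X]B0; apply: nonincreasing_cvg_mu => //.
  - by apply: le_lt_trans (probability_le1 _ (mB 0%N)) _; rewrite ltry.
  - by rewrite B0.
  - by move=> i j ij; apply/subsetPset => x; apply: le_lt_trans; rewrite ler_nat.
have /cv[N _ /(_ N)] : nbhs (0%E : \bar R) [set x | (x < (e/2)%:E)%E].
  by apply: open_nbhs_nbhs; split; [exact: open_ereal_lt_ereal|rewrite /= lte_fin].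
move=> /(_ (leqnn _)) /= BN.
exists (F `\` B N), U; split => //.
- apply: bounded_closed_compact.
    exists N%:R; split; first exact: num_real.
    move=> M NM x [_]; rewrite /B/= => /negP; rewrite -leNgt => xN.
    by apply: le_trans xN (ltW NM).
  by apply: closedI => //; exact: open_closedC.
- by move=> x [Fx _]; exact: FA.
have mU := open_measurable_Rd oU; have mF := closed_measurable_Rd cF.
have sub : U `\` (F `\` B N) `<=` (U `\` F) `|` B N.
  move=> x [Ux nF]; have [Bx|Bx] := pselect (B N x); first by right.
  by left; split => // Fx; apply: nF.
apply: le_lt_trans (_ : (mu ((U `\` F) `|` B N) < _)%E).
  apply: le_measure; rewrite ?inE//.
  - by apply: measurableD => //; apply: measurableD.
  - by apply: measurableU => //; apply: measurableD.
apply: le_lt_trans (measureU2 _ _ _) _ => //; first exact: measurableD.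
by rewrite (splitr e) EFinD; apply: lteD.
Qed.

End regularity.

(** A copy of the product type: it carries the semiring of rectangles, while the product type itself
    keeps its sigma-algebra. *)
Definition rectangle_type d1 d2 (T1 : measurableType d1) (T2 : measurableType d2) : Type :=
  (T1 * T2)%type.

Section rectangles.
Context d1 d2 (T1 : measurableType d1) (T2 : measurableType d2).
Local Notation T12 := (rectangle_type T1 T2).

Definition rectangle : set (set T12) :=
  [set A `*` B | A in @measurable _ T1 & B in @measurable _ T2].

Lemma rectangle0 : rectangle set0.
Proof. by exists set0 => //; exists set0 => //; rewrite setX0. Qed.

Lemma rectangleI : setI_closed rectangle.
Proof.
move=> _ _ [A mA [B mB <-]] [A' mA' [B' mB' <-]].
exists (A `&` A'); first exact: measurableI.
by exists (B `&` B'); [exact: measurableI|rewrite setXI].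
Qed.

Lemma rectangleD : semi_setD_closed rectangle.
Proof.
move=> _ _ [A mA [B mB <-]] [A' mA' [B' mB' <-]].
pose P := (A `\` A') `*` B; pose Q := (A `&` A') `*` (B `\` B').
exists [set P; Q]; split.
- exact: finite_set2.
- move=> _ [->|->].
    by exists (A `\` A'); [exact: measurableD|exists B].
  by exists (A `&` A'); [exact: measurableI|exists (B `\` B') => //; exact: measurableD].
- rewrite bigcup_setU !bigcup_set1; apply/seteqP; split => -[x y]/=.
    move=> [[Ax By] nA]; have [A'x|A'x] := pselect (A' x); last by left.
    by right; split => //=; split => // B'y; apply: nA.
  by move=> [[[Ax A'x] By]|[[Ax A'x] [By B'y]]]; split => //= -[].
- move=> _ _ [->|->] [->|->] // -[[x y]] [] [] /=.
    by move=> [? ?] ? [] [].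
  by move=> [? ?] ? [] [].
Qed.

Definition rectangle_display : measure_display.
Proof. exact: (measure_prod_display (d1, d2)). Qed.

HB.instance Definition _ := Pointed.on T12.
HB.instance Definition _ := @isSemiRingOfSets.Build rectangle_display T12
  rectangle rectangle0 rectangleI rectangleD.

End rectangles.

Section finitely_additive.
Context d (T : measurableType d) (R : realType) (c : set T -> R).
Hypothesis c_ge0 : forall E, 0 <= c E.
Hypothesis cD : forall E F, measurable E -> measurable F -> E `&` F = set0 ->
  c (E `|` F) = c E + c F.

Lemma fin_additive0 : c set0 = 0.
Proof.
have := cD measurable0 measurable0 (setI0 _).
by rewrite setU0 => h; lra.
Qed.

Lemma fin_additive_le E F : measurable E -> measurable F -> E `<=` F -> c E <= c F.
Proof.
move=> mE mF EF; have -> : F = E `|` (F `\` E) by rewrite setDUK.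
rewrite cD//; [by rewrite lerDl|exact: measurableD|by rewrite setDIK].
Qed.

Lemma fin_additive_leD E F G : measurable E -> measurable F -> measurable G ->
  G `<=` E `|` F -> c G <= c E + c F.
Proof.
move=> mE mF mG GEF; apply: (@le_trans _ _ (c (E `|` F))).
  by apply: fin_additive_le => //; exact: measurableU.
have -> : E `|` F = E `|` (F `\` E) by rewrite setDE setUIr setUCr setIT.
rewrite cD//; [|exact: measurableD|by rewrite setDIK].
by rewrite lerD2l; apply: fin_additive_le => //; exact: measurableD.
Qed.

Lemma fin_additive_bigsetU (F : (set T)^nat) n : (forall k, measurable (F k)) ->
  trivIset setT F -> c (\big[setU/set0]_(k < n) F k) = \sum_(k < n) c (F k).
Proof.
move=> mF tF; elim: n => [|n IH]; first by rewrite !big_ord0 fin_additive0.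
rewrite !big_ord_recr/= cD ?IH//; first exact: bigsetU_measurable.
rewrite -bigcup_mkord -subset0 => x [[k /= kn Fk] Fn].
have kn' : k = n := tF k n I I (ex_intro _ x (conj Fk Fn)).
by move: kn; rewrite kn' ltnn.
Qed.

Lemma fin_additive_subadd (F : (set T)^nat) n : (forall k, measurable (F k)) ->
  c (\big[setU/set0]_(k < n) F k) <= \sum_(k < n) c (F k).
Proof.
move=> mF; elim: n => [|n IH]; first by rewrite !big_ord0 fin_additive0.
rewrite !big_ord_recr/=.
apply: (le_trans (fin_additive_leD (E := \big[setU/set0]_(k < n) F k) (F := F n) _ _ _ _)) => //.
- exact: bigsetU_measurable.
- by apply: measurableU => //; exact: bigsetU_measurable.
- by rewrite lerD2r.
Qed.

End finitely_additive.

(** * Caratheodory extension from rectangles *)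

Section rectangle_extension.
Context d1 d2 (T1 : measurableType d1) (T2 : measurableType d2) (R : realType).
Variable c : set (T1 * T2) -> R.
Hypothesis c_ge0 : forall E, 0 <= c E.
Hypothesis cD : forall E F, measurable E -> measurable F -> E `&` F = set0 ->
  c (E `|` F) = c E + c F.
Hypothesis cT : c setT = 1.
Hypothesis c_sub : forall (X : set T1) (Y : set T2) (A : (set T1)^nat) (B : (set T2)^nat),
  measurable X -> measurable Y -> (forall k, measurable (A k)) ->
  (forall k, measurable (B k)) -> X `*` Y `<=` \bigcup_k (A k `*` B k) ->
  ((c (X `*` Y))%:E <= \sum_(0 <= k <oo) (c (A k `*` B k))%:E)%E.

Local Notation T12 := (rectangle_type T1 T2).

(** Only the values of [c] on rectangles enter. Finite additivity makes this a content, [c_sub]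
    makes it a premeasure, and the extension agrees with [c] on rectangles; on other sets the two
    may differ. *)
Definition rectangle_content (E : set T12) : \bar R := (c E)%:E.

Lemma rectangle_measurable (E : set T12) : measurable E ->
  measurable (E : set (T1 * T2)).
Proof. by move=> [A mA [B mB <-]]; exact: measurableX. Qed.

Lemma rectangle_content_ge0 E : (0 <= rectangle_content E)%E.
Proof. by rewrite lee_fin. Qed.

Lemma rectangle_content_semi_additive : measure_function.semi_additive rectangle_content.
Proof.
move=> F k mF tF mUF; rewrite /rectangle_content sumEFin; congr EFin.
by apply: (fin_additive_bigsetU cD) => // j; exact: rectangle_measurable.
Qed.

HB.instance Definition _ := isContent.Build _ _ _ rectangle_content
  rectangle_content_ge0 rectangle_content_semi_additive.

Lemma rectangle_content_sigma_subadditive :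
  measurable_subset_sigma_subadditive rectangle_content.
Proof.
move=> _ F mF [X mX [Y mY <-]] sub.
have {}mF k : exists AB : set T1 * set T2,
    [/\ measurable AB.1, measurable AB.2 & F k = AB.1 `*` AB.2].
  by have [A mA [B mB <-]] := mF k; exists (A, B).
have [AB hAB] := choice mF.
rewrite (@eq_eseriesr _ _ (fun k => (c ((AB k).1 `*` (AB k).2))%:E)); last first.
  by move=> k _; rewrite /rectangle_content; have [_ _ ->] := hAB k.
apply: c_sub => //; [by move=> k; have [] := hAB k|by move=> k; have [] := hAB k|].
by move=> z /sub[k _ Fk]; exists k => //; have [_ _ <-] := hAB k.
Qed.

HB.instance Definition _ := Content_SigmaSubAdditive_isMeasure.Build _ _ _
  rectangle_content rectangle_content_sigma_subadditive.

Definition rectangle_extension (E : set (T1 * T2)) : \bar R :=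
  measure_extension rectangle_content E.

Lemma rectangle_extension_measurable (E : set (T1 * T2)) : measurable E ->
  measurable (E : set (g_sigma_algebraType (@measurable _ T12))).
Proof. by rewrite [X in X _]measurable_prod_measurableType. Qed.

Lemma rectangle_extensionX (A : set T1) (B : set T2) :
  measurable A -> measurable B -> rectangle_extension (A `*` B) = (c (A `*` B))%:E.
Proof.
by move=> mA mB; rewrite /rectangle_extension/measure_extension measurable_mu_extE//;
  exists A => //; exists B.
Qed.

Lemma rectangle_extension0 : rectangle_extension set0 = 0%E.
Proof. exact: measure0. Qed.

Lemma rectangle_extension_ge0 E : (0 <= rectangle_extension E)%E.
Proof. exact: measure_ge0. Qed.

Lemma rectangle_extension_sigma_additive : semi_sigma_additive rectangle_extension.
Proof.
move=> F mF tF mUF.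
apply: (@measure_semi_sigma_additive _ _ _ (measure_extension rectangle_content)) => //.
- by move=> k; exact: rectangle_extension_measurable.
- exact: rectangle_extension_measurable.
Qed.

HB.instance Definition _ := isMeasure.Build _ _ _ rectangle_extension
  rectangle_extension0 rectangle_extension_ge0 rectangle_extension_sigma_additive.

Lemma rectangle_extension_setT : rectangle_extension setT = 1%E.
Proof. by rewrite -setXTT rectangle_extensionX// setXTT cT. Qed.

HB.instance Definition _ := Measure_isProbability.Build _ _ _ rectangle_extension
  rectangle_extension_setT.

Lemma rectangle_extensionP : exists p : probability (T1 * T2)%type R,
  forall A B, measurable A -> measurable B -> p (A `*` B) = (c (A `*` B))%:E.
Proof. by exists rectangle_extension => A B; exact: rectangle_extensionX. Qed.

End rectangle_extension.

HB.instance Definition _ (T1 T2 : ptopologicalType) := Pointed.on (T1 * T2)%type.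

Section coupling_subadditivity.
Variables (R : realType) (n m : nat).
Variables (mu : probability (Rd R n) R) (nu : probability (Rd R m) R).
Variable c : set (Rd R n * Rd R m) -> R.
Hypothesis c_ge0 : forall E, 0 <= c E.
Hypothesis cD : forall E F, measurable E -> measurable F -> E `&` F = set0 ->
  c (E `|` F) = c E + c F.
Hypothesis c1 : forall A, measurable A -> (c (A `*` setT))%:E = mu A.
Hypothesis c2 : forall B, measurable B -> (c (setT `*` B))%:E = nu B.

Lemma open_setX (U : set 'rV[R]_n) (V : set 'rV[R]_m) : open U -> open V ->
  open (U `*` V).
Proof.
move=> oU oV.
rewrite (_ : U `*` V = (fst @^-1` U) `&` (snd @^-1` V)); last by [].
apply: openI; apply: open_comp => // -[x y] _.
- exact: cvg_fst.
- exact: cvg_snd.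
Qed.

(** The part of [X x Y] outside [X' x Y'] lies in two strips whose contents are values of the
    marginals, so the error is the same for every coupling. *)
Lemma coupling_leX (X X' : set (Rd R n)) (Y Y' : set (Rd R m)) (e1 e2 : R) :
  measurable X -> measurable X' -> measurable Y -> measurable Y' ->
  (mu (X `\` X') < e1%:E)%E -> (nu (Y `\` Y') < e2%:E)%E ->
  c (X `*` Y) <= c (X' `*` Y') + (e1 + e2).
Proof.
move=> mX mX' mY mY' h1 h2.
have m1 : measurable ((X `\` X') `*` [set: Rd R m]).
  by apply: measurableX => //; exact: measurableD.
have m2 : measurable ([set: Rd R n] `*` (Y `\` Y')).
  by apply: measurableX => //; exact: measurableD.
apply: (le_trans (fin_additive_leD c_ge0 cD (E := X' `*` Y')
  (F := ((X `\` X') `*` setT) `|` (setT `*` (Y `\` Y'))) _ _ _ _)).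
- exact: measurableX.
- exact: measurableU.
- exact: measurableX.
- move=> [x y] [/= Xx Yy]; have [X'x|X'x] := pselect (X' x); last by right; left.
  by have [Y'y|Y'y] := pselect (Y' y); [left|right; right].
rewrite lerD2l.
apply: (le_trans (fin_additive_leD c_ge0 cD m1 m2 _ (@subset_refl _ _))).
  exact: measurableU.
apply: lerD; rewrite -lee_fin ?c1 ?c2; try exact: ltW; exact: measurableD.
Qed.

(* Inner approximation of the rectangle by a compact one and outer
   approximation of the covering rectangles by open ones reduces countable
   subadditivity to a finite subcover. *)
Lemma coupling_sigma_subadditive (X : set (Rd R n)) (Y : set (Rd R m))
    (A : (set (Rd R n))^nat) (B : (set (Rd R m))^nat) :
  measurable X -> measurable Y -> (forall k, measurable (A k)) ->
  (forall k, measurable (B k)) -> X `*` Y `<=` \bigcup_k (A k `*` B k) ->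
  ((c (X `*` Y))%:E <= \sum_(0 <= k <oo) (c (A k `*` B k))%:E)%E.
Proof.
move=> mX mY mA mB sub.
apply/lee_addgt0Pr => e e0.
have e40 : 0 < e / 4 by rewrite divr_gt0.
have [K1 [Z1 [cK1 oZ1 K1X XZ1 K1e]]] := inner_compact_outer_open mu mX e40.
have [K2 [Z2 [cK2 oZ2 K2Y YZ2 K2e]]] := inner_compact_outer_open nu mY e40.
have e4k k : 0 < e / 4 / (2 ^ k.+1)%:R by rewrite !divr_gt0// ltr0n expn_gt0.
have /choice[LU hLU] : forall k, exists LU : set 'rV[R]_n * set 'rV[R]_n,
    [/\ closed LU.1, open LU.2, LU.1 `<=` A k, A k `<=` LU.2 &
      (mu (LU.2 `\` LU.1) < (e / 4 / (2 ^ k.+1)%:R)%:E)%E].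
  by move=> k; have [F [U FU]] := (approximableT mu (mA k)).2 _ (e4k k); exists (F, U).
have /choice[LV hLV] : forall k, exists LV : set 'rV[R]_m * set 'rV[R]_m,
    [/\ closed LV.1, open LV.2, LV.1 `<=` B k, B k `<=` LV.2 &
      (nu (LV.2 `\` LV.1) < (e / 4 / (2 ^ k.+1)%:R)%:E)%E].
  by move=> k; have [F [U FU]] := (approximableT nu (mB k)).2 _ (e4k k); exists (F, U).
pose U k : set (Rd R n) := (LU k).2; pose V k : set (Rd R m) := (LV k).2.
have mU k : measurable (U k) by apply: open_measurable_Rd; have [] := hLU k.
have mV k : measurable (V k) by apply: open_measurable_Rd; have [] := hLV k.
have mK1 : measurable (K1 : set (Rd R n)).
  by apply: closed_measurable_Rd; apply: compact_closed => //; exact: norm_hausdorff.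
have mK2 : measurable (K2 : set (Rd R m)).
  by apply: closed_measurable_Rd; apply: compact_closed => //; exact: norm_hausdorff.
have KX : measurable (X `\` K1 : set (Rd R n)) by exact: measurableD.
have [D _ KD] : finite_subset_cover setT (fun k : nat => (U k `*` V k : set ('rV[R]_n * 'rV[R]_m)))
    (K1 `*` K2 : set ('rV[R]_n * 'rV[R]_m)).
  have cc : @cover_compact ('rV[R]_n * 'rV[R]_m)%type (K1 `*` K2).
    by rewrite -(@compact_cover ('rV[R]_n * 'rV[R]_m)%type); exact: compact_setX.
  apply: cc.
    by move=> k _; apply: open_setX; [have [] := hLU k|have [] := hLV k].
  move=> [x y] [/= K1x K2y]; have [] := sub (x, y).
    by split; [exact: K1X|exact: K2Y].
  move=> k _ [/= Ax By]; exists k => //; split => /=.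
    by have [_ _ _ + _] := hLU k; apply.
  by have [_ _ _ + _] := hLV k; apply.
pose N := (\max_(k <- finmap.enum_fset D) k).+1.
have KN : (K1 : set (Rd R n)) `*` (K2 : set (Rd R m)) `<=`
    \big[setU/set0]_(k < N) (U k `*` V k).
  rewrite -(bigcup_mkord N (fun k => U k `*` V k)) => z /KD[k /= kD Uk]; exists k => //=.
  by rewrite ltnS; apply: leq_bigmax_seq.
have mUV k : measurable (U k `*` V k) by exact: measurableX.
have h1 : c (X `*` Y) <= c (K1 `*` K2) + (e/4 + e/4).
  apply: coupling_leX => //.
    apply: le_lt_trans K1e; apply: le_measure; rewrite ?inE//.
    - by apply: measurableD => //; apply: open_measurable_Rd.
    - by move=> x [Xx nK]; split => //; exact: XZ1.
  apply: le_lt_trans K2e; apply: le_measure; rewrite ?inE//.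
  - exact: measurableD.
  - by apply: measurableD => //; apply: open_measurable_Rd.
  - by move=> x [Xx nK]; split => //; exact: YZ2.
have h2 : c (K1 `*` K2) <= \sum_(k < N) c (U k `*` V k).
  apply: le_trans (fin_additive_subadd c_ge0 cD N mUV).
  apply: (fin_additive_le c_ge0 cD) => //; first exact: measurableX.
  exact: bigsetU_measurable.
have h3 k : c (U k `*` V k) <= c (A k `*` B k) + (e/2) / (2 ^ k.+1)%:R.
  have -> : e/2 / (2 ^ k.+1)%:R = e/4 / (2 ^ k.+1)%:R + e/4 / (2 ^ k.+1)%:R.
    by rewrite -mulrDl; congr (_ / _); lra.
  apply: coupling_leX => //.
    have [cl op lA Au] := hLU k; apply: le_lt_trans.
    apply: le_measure; rewrite ?inE//; first exact: measurableD.
    - by apply: measurableD; [exact: mU|exact: closed_measurable_Rd].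
    - by move=> x [Ux nA]; split => // /lA.
  have [cl op lA Au] := hLV k; apply: le_lt_trans.
  apply: le_measure; rewrite ?inE//; first exact: measurableD.
  - by apply: measurableD; [exact: mV|exact: closed_measurable_Rd].
  - by move=> x [Ux nA]; split => // /lA.
have e2k k : 0 <= e / 2 / (2 ^ k.+1)%:R by rewrite !divr_ge0// ltW.
have h4 : ((\sum_(k < N) (c (A k `*` B k) + (e/2) / (2 ^ k.+1)%:R))%:E <=
    \sum_(0 <= k <oo) (c (A k `*` B k))%:E + (e/2)%:E)%E.
  apply: le_trans (epsilon_trick _ _ _); last 2 first.
  - by move=> k; rewrite lee_fin.
  - by rewrite ltW// divr_gt0.
  rewrite -sumEFin -(big_mkord xpredT (fun k => (c (A k `*` B k) + (e/2) / (2 ^ k.+1)%:R)%:E)).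
  apply: le_trans (nneseries_lim_ge N _) => //.
  by move=> k _ _; rewrite -EFinD lee_fin addr_ge0.
apply: (@le_trans _ _ ((\sum_(k < N) (c (A k `*` B k) + (e/2) / (2 ^ k.+1)%:R))%:E + (e/2)%:E)%E).
  rewrite -EFinD lee_fin; apply: (le_trans h1).
  have -> : e/4 + e/4 = e/2 by lra.
  by rewrite lerD2r; apply: (le_trans h2); apply: ler_sum => k _; exact: h3.
apply: (le_trans (leeD2r _ h4)).
by rewrite -addeA -EFinD -splitr.
Qed.

Lemma coupling_measureP : exists p : probability (Rd R n * Rd R m)%type R,
  forall A B, measurable A -> measurable B -> p (A `*` B) = (c (A `*` B))%:E.
Proof.
apply: rectangle_extensionP => //.
- by apply/EFin_inj; rewrite -setXTT c1// probability_setT.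
- exact: coupling_sigma_subadditive.
Qed.

End coupling_subadditivity.

(** * Compactness of the set of couplings *)

Section tychonoff_coupling.
Variables (R : realType) (n m : nat).
Variables (mu : probability (Rd R n) R) (nu : probability (Rd R m) R).
Local Notation T12 := (Rd R n * Rd R m)%type.

(** The bound by 0 and 1 is asked of every set, measurable or not: it places all couplings in one
    cube indexed by sets, which is compact for pointwise convergence. *)
Record coupling_content (c : set T12 -> R) : Prop := CouplingContent {
  coupling_content_01 : forall E, c E \in `[0, 1];
  coupling_contentD : forall E F, measurable E -> measurable F ->
    E `&` F = set0 -> c (E `|` F) = c E + c F;
  coupling_content1 : forall A, measurable A -> (c (A `*` setT))%:E = mu A;
  coupling_content2 : forall B, measurable B -> (c (setT `*` B))%:E = nu B }.

Variables (J : Type) (P : J -> set (set T12 -> R)).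
Hypothesis P_coupling : forall i c, P i c -> coupling_content c.
Hypothesis P_ex : forall i, P i !=set0.
Hypothesis P_directed : forall i j, exists k, P k `<=` P i `&` P j.
Variable i0 : J.

(** Directedness makes the sets [P i] a filter base in a compact cube. A basic neighbourhood of the
    cluster point constrains finitely many coordinates, which is why the conclusion speaks of a
    finite list [l]. *)
Lemma coupling_cluster : exists c : set T12 -> R,
  (forall i (l : seq (set T12)) e, 0 < e ->
    exists2 c', P i c' & forall E, E \in l -> `|c' E - c E| < e).
Proof.
pose X := prod_topology (fun _ : set T12 => (R : topologicalType)).
pose F : set_system X := filter_from [set: J] P.
have FF : ProperFilter F.
  apply: filter_from_proper => [|i _]; last exact: P_ex.
  apply: filter_from_filter; first by exists i0.
  by move=> i j _ _; have [k hk] := P_directed i j; exists k.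
have K : compact [set f : X | forall E, `[0, 1]%classic (f E : R)].
  have h := @tychonoff (set T12) (fun _ => (R : topologicalType)) (fun _ => `[0, 1]%classic).
  exact: h (fun _ => @segment_compact R 0 1).
have FK : F [set f | forall E, `[0, 1]%classic (f E)].
  exists i0 => // c /P_coupling [+ _ _ _] E.
  by move=> /(_ E).
have [c [_ cl]] := K F FF FK.
exists c => i l e e0.
have nb : nbhs (c : X) [set f : X | forall E, E \in l -> `|f E - c E| < e].
  elim: l => [|E l IH]; first by apply: filterS filterT => f _ E.
  have h1 : nbhs (c : X) [set f : X | `|f E - c E| < e].
    have : nbhs (c E) [set y | `|y - c E| < e].
      by apply/nbhs_ballP; exists e => //= y; rewrite /ball/= distrC.
    exact: (@proj_continuous _ (fun _ : set T12 => (R : topologicalType)) E c).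
  near=> f => E'; rewrite inE => /orP[/eqP ->|].
    by near: f; exact: h1.
  by move: E'; near: f; exact: IH.
have [c' [Pc' hc']] := cl _ _ (ex_intro2 _ _ i (I : [set: J] i) (@subset_refl _ (P i))) nb.
by exists c'.
Unshelve. all: by end_near. Qed.

(** Additivity and the marginal conditions involve finitely many values of [c] each, hence pass to
    the cluster point. The last conclusion is confined to rectangles because [p] is known to agree
    with the cluster point only there. *)
Lemma coupling_limitP : exists p : probability T12 R,
  [/\ forall A, measurable A -> p (A `*` setT) = mu A,
      forall B, measurable B -> p (setT `*` B) = nu B &
      forall i (l : seq (set T12)) e, 0 < e ->
        (forall E, E \in l -> exists A B, [/\ measurable A, measurable B & E = A `*` B]) ->
        exists2 c, P i c & forall E, E \in l -> `|c E - fine (p E)| < e].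
Proof.
have [c hc] := coupling_cluster.
have close x y : (forall e, 0 < e -> `|x - y| < e) -> x = y :> R.
  move=> h; apply/eqP; rewrite -subr_eq0 -normr_eq0; apply/eqP/le_anti.
  rewrite normr_ge0 andbT; apply/ler_addgt0Pr => e /h /ltW; by rewrite add0r.
have c_ge0 E : 0 <= c E.
  apply/ler_addgt0Pr => e e0; have [c' Pc'] := hc i0 [:: E] e e0.
  move=> /(_ E); rewrite inE eqxx => /(_ isT).
  have := coupling_content_01 (P_coupling Pc') E.
  by rewrite in_itv/= ltr_norml => /andP[? _] /andP[? ?]; lra.
have cD E F : measurable E -> measurable F -> E `&` F = set0 -> c (E `|` F) = c E + c F.
  move=> mE mF EF; apply: close => e e0.
  have [c' Pc' h] := hc i0 [:: E; F; E `|` F] (e / 3) (divr_gt0 e0 (ltr0n _ 3)).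
  have := coupling_contentD (P_coupling Pc') mE mF EF.
  have := h E; have := h F; have := h (E `|` F); rewrite !inE !eqxx ?orbT.
  move=> /(_ isT) + /(_ isT) + /(_ isT).
  by rewrite !ltr_norml => /andP[? ?] /andP[? ?] /andP[? ?] ?; apply/andP; split; lra.
have c1 A : measurable A -> (c (A `*` setT))%:E = mu A.
  move=> mA; have mufin : mu A \is a fin_num by exact: fin_num_measure.
  rewrite -(fineK mufin); congr EFin; apply: close => e e0.
  have [c' Pc' /(_ (A `*` setT))] := hc i0 [:: A `*` setT] e e0.
  rewrite inE eqxx => /(_ isT); rewrite distrC.
  by rewrite (_ : fine (mu A) = c' (A `*` setT))// -(coupling_content1 (P_coupling Pc') mA).
have c2 B : measurable B -> (c (setT `*` B))%:E = nu B.
  move=> mB; have nufin : nu B \is a fin_num by exact: fin_num_measure.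
  rewrite -(fineK nufin); congr EFin; apply: close => e e0.
  have [c' Pc' /(_ (setT `*` B))] := hc i0 [:: setT `*` B] e e0.
  rewrite inE eqxx => /(_ isT); rewrite distrC.
  by rewrite (_ : fine (nu B) = c' (setT `*` B))// -(coupling_content2 (P_coupling Pc') mB).
have [p hp] := coupling_measureP c_ge0 cD c1 c2.
exists p; split.
- by move=> A mA; rewrite hp// c1.
- by move=> B mB; rewrite hp// c2.
- move=> i l e e0 hl; have [c' Pc' h] := hc i l e e0; exists c' => // E El.
  by have [A [B [mA mB EAB]]] := hl E El; rewrite {2}EAB hp//= -EAB; exact: h.
Qed.

End tychonoff_coupling.

(** * Smooth functions on R^n *)

Section smooth_real.
Variable R : realType.
Implicit Types (f g : R -> R) (k : nat).

(** The derivative is exhibited as a witness, so that closure under sums, products and inverses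
    follows by induction on [k] from the usual formulas. *)
Fixpoint ksmooth1 k f : Prop := if k is k'.+1 then
  exists f', (forall x : R, is_derive x (1 : R) f (f' x)) /\ ksmooth1 k' f' else True.

Definition smooth1 f := forall k, ksmooth1 k f.

Lemma ksmooth1W k f : ksmooth1 k.+1 f -> ksmooth1 k f.
Proof.
by elim: k f => // k IH f [f' [df hf']]; exists f'; split => //; exact: IH.
Qed.

Lemma ksmooth1_cst k c : ksmooth1 k (fun=> c).
Proof.
elim: k c => // k IH c; exists (fun=> 0); split => // x.
exact: is_derive_cst.
Qed.

Lemma ksmooth1D k f g : ksmooth1 k f -> ksmooth1 k g -> ksmooth1 k (fun x => f x + g x).
Proof.
elim: k f g => // k IH f g [f' [df hf]] [g' [dg hg]].
exists (fun x => f' x + g' x); split; last exact: IH.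
by move=> x; apply: is_deriveD.
Qed.

Lemma ksmooth1M k f g : ksmooth1 k f -> ksmooth1 k g -> ksmooth1 k (fun x => f x * g x).
Proof.
elim: k f g => // k IH f g hf hg.
have [f' [df hf']] := hf; have [g' [dg hg']] := hg.
exists (fun x => f x * g' x + g x * f' x); split.
  by move=> x; apply: is_deriveM.
by apply: ksmooth1D; apply: IH => //; exact: ksmooth1W.
Qed.

Lemma ksmooth1V k f : (forall x, f x != 0) -> ksmooth1 k f -> ksmooth1 k (fun x => (f x)^-1).
Proof.
move=> f0; elim: k => // k IH hf; have [f' [df hf']] := hf.
exists (fun x => (-1 * ((f x)^-1 * (f x)^-1)) * f' x); split.
  move=> x; have fd : derivable f x 1 by [].
  apply: DeriveDef; first exact: derivableV.
  rewrite deriveV// derive_val /GRing.scale/=; congr (_ * _).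
  by rewrite mulN1r -invfM -expr2.
have IH' := IH (ksmooth1W hf).
by apply: ksmooth1M => //; apply: ksmooth1M; [exact: ksmooth1_cst|exact: ksmooth1M].
Qed.

Lemma ksmooth1_affine k f a b : ksmooth1 k f -> ksmooth1 k (fun x => f (a * x + b)).
Proof.
elim: k f => // k IH f [f' [df hf']].
exists (fun x => a * f' (a * x + b)); split; last first.
  by apply: ksmooth1M; [exact: ksmooth1_cst|exact: IH].
move=> x; rewrite mulrC.
have h : is_derive x 1 (fun y : R => a * y + b) a.
  have -> : a = a *: (1 : R) + 0 by rewrite addr0 /GRing.scale/= mulr1.
  rewrite {1}addr0 {1}/GRing.scale/= mulr1.
  by apply: (@is_deriveD _ _ _ (a \*: (id : R -> R)) (cst b)).
exact: (@is_derive1_comp _ f (fun y => a * y + b)).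
Qed.

Lemma smooth1P f : smooth1 f -> (forall x : R, is_derive x (1:R) f (derive1 f x)) /\ smooth1 (derive1 f).
Proof.
move=> hf; have [f' [df _]] := hf 1%N.
have E g : (forall x : R, is_derive x (1:R) f (g x)) -> derive1 f = g.
  by move=> dg; apply/funext => x; rewrite derive1E derive_val.
split; first by move=> x; rewrite (E _ df).
by move=> k; have [g [dg hg]] := hf k.+1; rewrite (E _ dg).
Qed.

Lemma smooth1_derive1n f n : smooth1 f -> smooth1 (derive1n n f).
Proof. by move=> hf; elim: n => // n IH; rewrite derive1nS; have [] := smooth1P IH. Qed.

Lemma smooth1_continuous f : smooth1 f -> continuous f.
Proof.
move=> hf x; have [df _] := smooth1P hf; apply: differentiable_continuous.
exact/derivable1_diffP.
Qed.

Lemma derive1n_out f (a b : R) n : smooth1 f ->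
  (forall x, x \notin `[a, b] -> f x = 0) -> forall x, x \notin `[a, b] -> derive1n n f x = 0.
Proof.
move=> hf f0; elim: n => // n IH x xab; rewrite derive1nS derive1E.
have oab : open (~` `[a, b]%classic : set R) by apply: closed_openC; exact: interval_closed.
have nb : nbhs x (~` `[a, b]%classic) by apply: open_nbhs_nbhs; split => //; exact/negP.
rewrite -(@derive_cst R R R 0 x 1); apply: near_eq_derive => //.
by near=> y; apply: IH; apply/negP; near: y.
Unshelve. all: by end_near. Qed.

Lemma smooth1_bounded f (a b : R) n : smooth1 f ->
  (forall x, x \notin `[a, b] -> f x = 0) -> exists2 C, 0 < C & forall x, `|derive1n n f x| <= C.
Proof.
move=> hf f0; have out := derive1n_out n hf f0.
have [ab|ba] := leP a b; last first.
  exists 1 => // x; rewrite out ?normr0//.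
  by rewrite in_itv/=; apply/negP => /andP[ax xb]; move: (le_trans ax xb); rewrite leNgt ba.
have c : continuous (fun x => `|derive1n n f x|).
  move=> x; apply: (@continuous_comp _ _ _ (derive1n n f)); last exact: norm_continuous.
  exact: smooth1_continuous (smooth1_derive1n n hf) x.
have [z _ hz] := @EVT_max R (fun x => `|derive1n n f x|) a b ab (continuous_subspaceT c).
exists (`|derive1n n f z| + 1); first by rewrite ltr_wpDl.
move=> x; have [xab|/out ->] := boolP (x \in `[a, b]).
  by apply: (le_trans (hz _ xab)); rewrite lerDl.
by rewrite normr0 addr_ge0.
Qed.

End smooth_real.

(** * A smooth bump whose translates sum to a constant *)

Section flat_function.
Variable R : realType.
Implicit Types (t x : R) (k : nat).

(** The classical flat function, with the powers of [1 / t] built in: differentiation stays inside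
    the family, sending index [k] to a combination of [k + 1] and [k + 2]. Smoothness of all members
    is then a single induction. *)
Definition flat k t : R := if 0 < t then t^-1 ^+ k * expR (- t^-1) else 0.

Lemma flat_gt0 k t : 0 < t -> 0 < flat k t.
Proof. by move=> t0; rewrite /flat t0 mulr_gt0 ?expR_gt0// exprn_gt0// invr_gt0. Qed.

Lemma flat_le0 k t : t <= 0 -> flat k t = 0.
Proof. by rewrite /flat; case: ltP. Qed.

Lemma flat_ge0 k t : 0 <= flat k t.
Proof. by have [/(flat_le0 k) ->//|/(flat_gt0 k)/ltW] := leP t 0. Qed.

(** The inequality [y <= exp y] at [y = x / (k + 1)], raised to the power [k + 1]. *)
Lemma expr_le_expR k x : 0 <= x -> x ^+ k.+1 <= k.+1%:R ^+ k.+1 * expR x.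
Proof.
move=> x0; have h : x / k.+1%:R <= expR (x / k.+1%:R).
  by apply: le_trans (expR_ge1Dx _); rewrite lerDr.
have -> : x ^+ k.+1 = k.+1%:R ^+ k.+1 * (x / k.+1%:R) ^+ k.+1.
  by rewrite -exprMn mulrC divfK.
have -> : expR x = expR (x / k.+1%:R) ^+ k.+1.
  by rewrite -expRM_natl mulrC divfK.
by rewrite ler_wpM2l// lerXn2r ?nnegrE ?expR_ge0// divr_ge0.
Qed.

Lemma flat_le k t : flat k.+1 t <= k.+1%:R ^+ k.+1.
Proof.
rewrite /flat; case: ltP => t0; last by rewrite exprn_ge0.
rewrite expRN ler_pdivrMr ?expR_gt0//; apply: expr_le_expR.
by rewrite invr_ge0 ltW.
Qed.

Lemma is_derive_flat k t : is_derive t (1:R) (flat k) (- k%:R * flat k.+1 t + flat k.+2 t).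
Proof.
have [t0|t0|<-] := ltgtP 0 t.
- have dV : is_derive t (1:R) (fun y : R => y^-1) (- t ^- 2).
    have h := @deriveV R R id t 1 (lt0r_neq0 t0) (@derivable_id _ _ t 1).
    apply: DeriveDef; first exact: (@derivableV R R id t 1 (lt0r_neq0 t0)).
    by rewrite h derive_id /GRing.scale/= mulr1.
  have dE : is_derive t (1:R) (fun y : R => expR (- y^-1)) (t ^- 2 * expR (- t^-1)).
    rewrite mulrC.
    apply: (@is_derive1_comp _ (@expR R) (fun y => - y^-1)).
    by rewrite -[X in is_derive _ _ _ X]opprK; exact: is_deriveN.
  have dX := @is_deriveX _ _ (fun y : R => y^-1) k t 1 _ dV.
  have := @is_deriveM _ _ _ _ t 1 _ _ dX dE.
  rewrite /flat t0 => h.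
  apply: (@near_eq_is_derive _ _ _ (((fun y : R => y^-1) ^+ k) * (fun y : R => expR (- y^-1)))).
    by near=> y; rewrite /flat (_ : 0 < y) ?fctE//; near: y; exact: lt_nbhsr.
  apply: (is_derive_eq h) => {h}.
  rewrite /GRing.scale/= fctE -!exprVn.
  move: (t^-1) (expR _) => u E; case: k {dX} => [|k].
    by rewrite !expr0 mul0r mul0r mulr0 addr0 oppr0 mul0r add0r mul1r.
  by rewrite !exprS /=; ring.
- apply: (@near_eq_is_derive _ _ _ (cst 0)).
    by near=> y; rewrite flat_le0// ltW//; near: y; exact: lt_nbhsl.
  rewrite !flat_le0 ?ltW// mulr0 addr0; exact: is_derive_cst.
rewrite !flat_le0// mulr0 addr0.
(* At 0 the quotient [flat k h / h] equals [h * flat k.+2 h] for positive [h], and [flat k.+2] is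
   bounded by [flat_le]; for negative [h] it vanishes. *)
have cv : h^-1 *: (((flat k \o shift 0) (h *: (1:R))) - flat k 0) @[h --> 0^'] --> (0 : R).
  apply/cvgr0Pnorm_le => e e0; near=> h.
  rewrite /= (flat_le0 k (lexx 0)) subr0 addr0 /GRing.scale/= mulr1.
  have [h0|h0] := leP h 0; first by rewrite flat_le0// mulr0 normr0 ltW.
  have -> : h^-1 * flat k h = h * flat k.+2 h.
    by rewrite /flat h0 !exprS; field; rewrite gt_eqF.
  rewrite ger0_norm ?mulr_ge0 ?flat_ge0// ?ltW//.
  apply: (@le_lt_trans _ _ (h * k.+2%:R ^+ k.+2)).
    by rewrite ler_wpM2l ?flat_le// ltW.
  rewrite -ltr_pdivlMr ?exprn_gt0//.
  have : `|h| < e / k.+2%:R ^+ k.+2; last by rewrite gtr0_norm.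
  by near: h; apply: dnbhs0_lt; rewrite divr_gt0// exprn_gt0.
by apply: DeriveDef; [apply/cvg_ex; exists 0|exact/cvg_lim].
Unshelve. all: by end_near. Qed.

Lemma ksmooth1_flat n k : ksmooth1 n (flat k).
Proof.
elim: n k => // n IH k; exists (fun t => - k%:R * flat k.+1 t + flat k.+2 t).
split; first exact: is_derive_flat.
by apply: ksmooth1D => //; apply: ksmooth1M => //; exact: ksmooth1_cst.
Qed.

Definition smoothstep t := flat 0 t / (flat 0 t + flat 0 (1 - t)).

Lemma smoothstep_den t : 0 < flat 0 t + flat 0 (1 - t).
Proof.
have [t0|t0] := ltP 0 t; first by rewrite ltr_wpDr ?flat_ge0 ?flat_gt0.
by rewrite ltr_wpDl ?flat_ge0 ?flat_gt0// subr_gt0 (le_lt_trans t0).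
Qed.

Lemma smooth1_smoothstep : smooth1 smoothstep.
Proof.
move=> n; apply: ksmooth1M; first exact: ksmooth1_flat.
apply: ksmooth1V => [t|]; first by rewrite gt_eqF ?smoothstep_den.
apply: ksmooth1D; first exact: ksmooth1_flat.
rewrite (_ : (fun x => _) = (fun t => flat 0 ((-1) * t + 1))); last first.
  by apply/funext => t; rewrite mulN1r addrC.
exact/ksmooth1_affine/ksmooth1_flat.
Qed.

Lemma smoothstep0 t : t <= 0 -> smoothstep t = 0.
Proof. by move=> t0; rewrite /smoothstep flat_le0// mul0r. Qed.

Lemma smoothstep1 t : 1 <= t -> smoothstep t = 1.
Proof.
move=> t1; rewrite /smoothstep (flat_le0 _ (t := 1 - t)) ?subr_le0// addr0.
by rewrite divff// gt_eqF// flat_gt0// (lt_le_trans _ t1).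
Qed.

Lemma smoothstep_ge0 t : 0 <= smoothstep t.
Proof. by rewrite divr_ge0 ?flat_ge0// ltW// smoothstep_den. Qed.

Lemma smoothstep_le1 t : smoothstep t <= 1.
Proof. by rewrite ler_pdivrMr ?smoothstep_den// mul1r lerDl flat_ge0. Qed.

(** A difference of two shifted steps rather than an arbitrary bump, so that sums of its translates
    telescope. *)
Definition smoothbump t := smoothstep (t + 1) - smoothstep t.

Lemma smooth1_smoothbump : smooth1 smoothbump.
Proof.
move=> n; apply: ksmooth1D.
  rewrite (_ : (fun x => _) = (fun t => smoothstep (1 * t + 1))); last first.
    by apply/funext => t; rewrite mul1r.
  exact/ksmooth1_affine/smooth1_smoothstep.
rewrite (_ : (fun x => _) = (fun t => (-1) * smoothstep t)); last first.
  by apply/funext => t; rewrite mulN1r.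
apply: ksmooth1M; [exact: ksmooth1_cst|exact: smooth1_smoothstep].
Qed.

Lemma smoothbump_ge0 t : 0 <= smoothbump t.
Proof.
rewrite /smoothbump; have [t0|t0] := leP t 0.
  by rewrite (smoothstep0 t0) subr0 smoothstep_ge0.
by rewrite smoothstep1 ?subr_ge0 ?smoothstep_le1// lerDr ltW.
Qed.

Lemma smoothbump_out t : t \notin `[-1, 1] -> smoothbump t = 0.
Proof.
rewrite in_itv/= negb_and -!ltNge => /orP[t1|t1].
  by rewrite /smoothbump !smoothstep0 ?subrr//; lra.
by rewrite /smoothbump !smoothstep1 ?subrr//; lra.
Qed.

End flat_function.

Section partition_of_unity.
Variable R : realType.

(* The sum telescopes in steps of length [M]. *)
Lemma smoothbump_partition (M L : nat) (t : R) : (0 < M)%N -> 1 <= t -> t <= L%:R / M%:R ->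
  \sum_(k < M + L) smoothbump (t - k%:R / M%:R) = M%:R.
Proof.
move=> M0 t1 tL; have M0' : 0 < M%:R :> R by rewrite ltr0n.
pose f (k : nat) := smoothstep (t - k%:R / M%:R).
pose a (k : nat) := smoothstep (t - k%:R / M%:R + 1).
have -> : \sum_(k < M + L) smoothbump (t - k%:R / M%:R) = \sum_(k < M + L) a k - \sum_(k < L + M) f k.
  rewrite (addnC L M) -sumrB; apply: eq_bigr => k _.
  by rewrite /smoothbump.
rewrite !big_split_ord/=.
have -> : \sum_(i < M) a i = M%:R.
  transitivity (\sum_(i < M) (1 : R)); last by rewrite sumr_const card_ord.
  apply: eq_bigr => i _; rewrite /a smoothstep1//.
  have : i%:R / M%:R <= 1 :> R by rewrite ler_pdivrMr// mul1r ler_nat ltnW.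
  lra.
have -> : \sum_(i < M) f (L + i)%N = 0.
  apply: big1 => i _; rewrite /f smoothstep0//.
  rewrite natrD mulrDl subr_le0 (le_trans tL)// lerDl divr_ge0//.
have -> : \sum_(i < L) a (M + i)%N = \sum_(i < L) f i.
  apply: eq_bigr => i _; rewrite /a /f natrD mulrDl divff ?gt_eqF//.
  by congr smoothstep; ring.
ring.
Qed.

End partition_of_unity.

(** * Smooth functions of several variables *)

Section smooth_rV.
Variables (R : realType) (n : nat).
Implicit Types (f g : 'rV[R]_n -> R) (x v : 'rV[R]_n) (i : 'I_n).

Fixpoint ksmooth k f : Prop := if k is k'.+1 then
  (forall x, differentiable f x) /\ forall i, ksmooth k' (partial i f) else True.

Definition smooth f := forall k, ksmooth k f.

(** [ksmooth] peels off the innermost derivative and [iter_partial] the outermost one, whence the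
    induction on the last element of [s]. *)
Lemma smooth_iter_partial f :
  (forall s x, differentiable (iter_partial s f) x) <-> smooth f.
Proof.
split=> [h k|h s]; last first.
  elim/last_ind: s f h => [|s i IH] f h x; first by have [] := h 1%N.
  rewrite /iter_partial foldr_rcons; apply: IH => k.
  by have [_] := h k.+1; apply.
elim: k f h => // k IH f h; split; first exact: (h [::]).
by move=> i; apply: IH => s x; have := h (rcons s i) x; rewrite /iter_partial foldr_rcons.
Qed.

Lemma smooth_diff f x : smooth f -> differentiable f x.
Proof. by move=> h; have [] := h 1%N. Qed.

Lemma smooth_partial f i : smooth f -> smooth (partial i f).
Proof. by move=> h k; have [_] := h k.+1; apply. Qed.

Lemma ksmoothW k f : ksmooth k.+1 f -> ksmooth k f.
Proof. by elim: k f => // k IH f [df h]; split => // i; exact: IH. Qed.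

Lemma partialE i f x : differentiable f x -> partial i f x = 'd f x (ebasis R i).
Proof. exact: deriveE. Qed.

Lemma deriv_sum_partial f x v : differentiable f x ->
  'd f x v = \sum_i v 0 i * partial i f x.
Proof.
move=> df; rewrite {1}(row_sum_delta v) linear_sum; apply: eq_bigr => i _.
by rewrite linearZ partialE.
Qed.

Lemma partial_cst i c x : partial i (fun=> c : R) x = 0.
Proof. exact: derive_cst. Qed.

Lemma partialD i f g x : differentiable f x -> differentiable g x ->
  partial i (fun y => f y + g y) x = partial i f x + partial i g x.
Proof. by move=> df dg; apply: deriveD; exact: diff_derivable. Qed.

Lemma partialM i f g x : differentiable f x -> differentiable g x ->
  partial i (fun y => f y * g y) x = partial i f x * g x + f x * partial i g x.
Proof.
move=> df dg; rewrite /partial (@deriveM _ _ f g); try exact: diff_derivable.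
by rewrite addrC /GRing.scale/= (mulrC (g x)).
Qed.

Lemma partialZ i c f x : differentiable f x ->
  partial i (fun y => c * f y) x = c * partial i f x.
Proof. by move=> df; apply: deriveZ; exact: diff_derivable. Qed.

Lemma ksmooth_cst k c : ksmooth k (fun=> c).
Proof.
elim: k c => // k IH c; split; first by move=> x; exact: differentiable_cst.
move=> i; rewrite (_ : partial i _ = fun=> 0); first exact: IH.
by apply/funext => x; rewrite partial_cst.
Qed.

Lemma ksmoothD k f g : ksmooth k f -> ksmooth k g -> ksmooth k (fun x => f x + g x).
Proof.
elim: k f g => // k IH f g [df hf] [dg hg]; split.
  by move=> x; exact: differentiableD.
move=> i; rewrite (_ : partial i _ = fun x => partial i f x + partial i g x).
  by apply: IH; [exact: hf|exact: hg].
by apply/funext => x; rewrite partialD.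
Qed.

Lemma ksmoothM k f g : ksmooth k f -> ksmooth k g -> ksmooth k (fun x => f x * g x).
Proof.
elim: k f g => // k IH f g hf hg; have [df hf'] := hf; have [dg hg'] := hg; split.
  by move=> x; exact: differentiableM.
move=> i; rewrite (_ : partial i _ = fun x => partial i f x * g x + f x * partial i g x).
  by apply: ksmoothD; apply: IH; [exact: hf'|exact: ksmoothW|exact: ksmoothW|exact: hg'].
by apply/funext => x; rewrite partialM.
Qed.

Lemma smooth_cst c : smooth (fun=> c). Proof. by move=> k; exact: ksmooth_cst. Qed.

Lemma smoothD f g : smooth f -> smooth g -> smooth (fun x => f x + g x).
Proof. by move=> hf hg k; exact: ksmoothD. Qed.

Lemma smoothM f g : smooth f -> smooth g -> smooth (fun x => f x * g x).
Proof. by move=> hf hg k; exact: ksmoothM. Qed.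

Lemma smoothZ c f : smooth f -> smooth (fun x => c * f x).
Proof. by move=> hf k; apply: ksmoothM => //; exact: ksmooth_cst. Qed.

Lemma ksmooth_sum k (I : Type) (r : seq I) (f : I -> 'rV[R]_n -> R) :
  (forall j, ksmooth k (f j)) -> ksmooth k (fun x => \sum_(j <- r) f j x).
Proof.
move=> hf; elim: r => [|j r IH].
  by under eq_fun do rewrite big_nil; exact: ksmooth_cst.
by under eq_fun do rewrite big_cons; exact: ksmoothD.
Qed.

Lemma smooth_sum (I : Type) (r : seq I) (f : I -> 'rV[R]_n -> R) :
  (forall j, smooth (f j)) -> smooth (fun x => \sum_(j <- r) f j x).
Proof. by move=> hf k; apply: ksmooth_sum => j; exact: hf. Qed.

Lemma partial_sum i (I : Type) (r : seq I) (f : I -> 'rV[R]_n -> R) x :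
  (forall j, differentiable (f j) x) ->
  differentiable (fun x => \sum_(j <- r) f j x) x /\
  partial i (fun x => \sum_(j <- r) f j x) x = \sum_(j <- r) partial i (f j) x.
Proof.
move=> df; elim: r => [|j r [IH1 IH2]].
  under eq_fun do rewrite big_nil.
  by rewrite big_nil partial_cst; split => //; exact: differentiable_cst.
under eq_fun do rewrite big_cons.
by rewrite big_cons partialD// IH2; split => //; exact: differentiableD.
Qed.

Lemma smooth_continuous f : smooth f -> continuous f.
Proof. by move=> h x; apply: differentiable_continuous; exact: smooth_diff. Qed.

Lemma partial_out (A : set 'rV[R]_n) f i : closed A ->
  (forall x, ~ A x -> f x = 0) -> forall x, ~ A x -> partial i f x = 0.
Proof.
move=> cA f0 x Ax.
have nb : nbhs x (~` A) by apply: open_nbhs_nbhs; split => //; exact: closed_openC.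
rewrite /partial -(@derive_cst R _ R 0 x (ebasis R i)); apply: near_eq_derive => //.
by near=> y; apply: f0; near: y.
Unshelve. all: by end_near. Qed.

End smooth_rV.

Section chain_rule.
Variables (R : realType) (n N : nat).
Variables (Phi : 'rV[R]_n -> 'rV[R]_N).
Implicit Types (F : 'rV[R]_N -> R) (x : 'rV[R]_n).

Lemma differentiable_row x : (forall j, differentiable (fun y => Phi y 0 j) x) ->
  differentiable Phi x.
Proof.
move=> dP; have -> : Phi = \sum_j (fun y => Phi y 0 j *: (delta_mx 0 j : 'rV[R]_N)).
  by apply/funext => y; rewrite fct_sumE; exact: row_sum_delta.
by apply: differentiable_sum => j; exact: differentiableZl.
Qed.

Lemma diff_row x v j : differentiable Phi x ->
  ('d Phi x v) 0 j = 'd (fun y => Phi y 0 j) x v.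
Proof.
move=> dP.
have dj : differentiable (fun y => Phi y 0 j) x.
  apply: (@differentiable_comp _ _ _ _ Phi (fun M : 'rV[R]_N => M 0 j)) => //.
  exact: differentiable_coord.
rewrite -!deriveE// derive_mx ?mxE//; exact: diff_derivable.
Qed.

Lemma partial_comp F x i : (forall j, differentiable (fun y => Phi y 0 j) x) ->
  differentiable F (Phi x) ->
  differentiable (F \o Phi) x /\
  partial i (F \o Phi) x = \sum_j partial j F (Phi x) * partial i (fun y => Phi y 0 j) x.
Proof.
move=> dP dF; have dP' := differentiable_row dP.
have dFP : differentiable (F \o Phi) x by exact: differentiable_comp.
split => //; rewrite partialE// diff_comp//= deriv_sum_partial//.
by apply: eq_bigr => j _; rewrite mulrC diff_row//; congr (_ * _); rewrite partialE.
Qed.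

Lemma ksmooth_comp k F : (forall j, ksmooth k (fun y => Phi y 0 j)) ->
  ksmooth k F -> ksmooth k (F \o Phi).
Proof.
elim: k F => // k IH F hP hF; have [dF hF'] := hF.
have dP j x : differentiable (fun y => Phi y 0 j) x by have [] := hP j.
split; first by move=> x; apply: differentiable_comp => //; exact: differentiable_row.
move=> i; rewrite (_ : partial i _ =
    fun x => \sum_j (partial j F \o Phi) x * partial i (fun y => Phi y 0 j) x).
  apply: ksmooth_sum => j; apply: ksmoothM.
    by apply: IH => [l|]; [exact: ksmoothW|exact: hF'].
  by have [_] := hP j; apply.
by apply/funext => x; have [] := partial_comp i (fun j => dP j x) (dF (Phi x)).
Qed.

Lemma smooth_comp F : (forall j, smooth (fun y => Phi y 0 j)) ->
  smooth F -> smooth (F \o Phi).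
Proof. by move=> hP hF k; apply: ksmooth_comp => // j; exact: hP. Qed.

End chain_rule.

Section composition_real.
Variables (R : realType) (n : nat).
Implicit Types (f : 'rV[R]_n -> R) (x : 'rV[R]_n) (i : 'I_n).

Lemma partial_comp1 (g : R -> R) f x i : smooth1 g -> differentiable f x ->
  differentiable (g \o f) x /\ partial i (g \o f) x = derive1 g (f x) * partial i f x.
Proof.
move=> hg df; have [dg _] := smooth1P hg.
have dg' : differentiable g (f x) by apply/derivable1_diffP.
have dgf : differentiable (g \o f) x by exact: differentiable_comp.
split => //; rewrite !partialE// diff_comp//= (deriv1E (f := g))//.
by rewrite /GRing.scale/= mulrC.
Qed.

Lemma ksmooth_comp1 k (g : R -> R) f : smooth1 g -> ksmooth k f -> ksmooth k (g \o f).
Proof.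
elim: k g f => // k IH g f hg hf; have [df hf'] := hf.
split; first by move=> x; have [dg _] := smooth1P hg; apply: differentiable_comp => //;
  exact/derivable1_diffP.
move=> i; rewrite (_ : partial i _ = fun x => (derive1 g \o f) x * partial i f x).
  apply: ksmoothM; last exact: hf'.
  by apply: IH; [have [] := smooth1P hg|exact: ksmoothW].
by apply/funext => x; have [] := partial_comp1 i hg (df x).
Qed.

Lemma partial_indep f x i : (forall h, f (h *: ebasis R i + x) = f x) -> partial i f x = 0.
Proof.
move=> h; rewrite /partial /derive.
rewrite (_ : (fun _ => _) = fun=> 0); first exact: lim_cst.
by apply/funext => t /=; rewrite h subrr scaler0.
Qed.

Lemma partial_coord i j x : partial i (fun y => y 0 j : R) x = (j == i)%:R.
Proof.
rewrite /partial deriveE; last exact: differentiable_coord.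
have := @derive_mx R 'rV[R]_n 1 n id x (ebasis R i) (@derivable_id _ _ _ _).
rewrite derive_id => /(congr1 (fun M : 'rV_n => M 0 j)); rewrite !mxE eqxx/= => ->.
by rewrite deriveE//; exact: differentiable_coord.
Qed.

Lemma ksmooth_coord k j : ksmooth k (fun y : 'rV[R]_n => y 0 j : R).
Proof.
case: k => // k; split; first by move=> x; exact: differentiable_coord.
move=> i; rewrite (_ : partial i _ = fun=> (j == i)%:R); first exact: ksmooth_cst.
by apply/funext => x; rewrite partial_coord.
Qed.

Lemma ksmooth_prod k (I : Type) (r : seq I) (P : pred I) (f : I -> 'rV[R]_n -> R) :
  (forall j, ksmooth k (f j)) -> ksmooth k (fun x => \prod_(j <- r | P j) f j x).
Proof.
move=> hf; elim: r => [|j r IH].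
  by under eq_fun do rewrite big_nil; exact: ksmooth_cst.
under eq_fun do rewrite big_cons.
by case: (P j) => //; exact: ksmoothM.
Qed.

Definition boxf (g : 'I_n -> R -> R) x : R := \prod_j g j (x 0 j).

Definition dbox i (g : 'I_n -> R -> R) j := if j == i then derive1 (g j) else g j.

Lemma smooth_boxf g : (forall j, smooth1 (g j)) -> smooth (boxf g).
Proof.
move=> hg k; apply: ksmooth_prod => j.
exact: (ksmooth_comp1 (hg j) (ksmooth_coord k j)).
Qed.

Lemma partial_boxf g i : (forall j, smooth1 (g j)) -> partial i (boxf g) = boxf (dbox i g).
Proof.
move=> hg; apply/funext => x.
pose rest (y : 'rV[R]_n) := \prod_(j | j != i) g j (y 0 j).
have hi := ksmooth_comp1 (hg i) (ksmooth_coord 1 i).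
have hr : ksmooth 1 rest.
  by apply: ksmooth_prod => j; exact: (ksmooth_comp1 (hg j) (ksmooth_coord 1 j)).
rewrite (_ : boxf g = fun y => (g i \o (fun z : 'rV[R]_n => z 0 i)) y * rest y); last first.
  by apply/funext => y; rewrite /boxf (bigD1 i).
rewrite partialM; [|by have [] := hi|by have [] := hr].
have [_ ->] := partial_comp1 i (hg i) (@differentiable_coord R 1 n x 0 i).
rewrite partial_coord eqxx mulr1 (_ : partial i rest x = 0) ?mulr0 ?addr0; last first.
  apply: partial_indep => h; apply: eq_bigr => j ji.
  by rewrite !mxE eqxx/= (negbTE ji) mulr0 add0r.
rewrite /boxf [RHS](bigD1 i)//= {1}/dbox eqxx; congr (_ * _).
by apply: eq_bigr => j ji; rewrite /dbox (negbTE ji).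
Qed.

End composition_real.

(** * Taylor expansion with coordinatewise bounds *)

Section taylor.
Variables (R : realType) (n : nat).
Implicit Types (f : 'rV[R]_n -> R) (x v : 'rV[R]_n) (i : 'I_n).

(** The sum norm is dual to bounds on the individual partial derivatives, so Taylor remainders come
    without dimensional constants. *)
Definition norm1 v : R := \sum_i `|v 0 i|.

Lemma norm1_ge0 v : 0 <= norm1 v. Proof. by apply: sumr_ge0. Qed.

Lemma line_derive f x v (t : R) : differentiable f (t *: v + x) ->
  is_derive t (1 : R) (fun s : R => f (s *: v + x)) (\sum_i v 0 i * partial i f (t *: v + x)).
Proof.
move=> df; rewrite -deriv_sum_partial//.
have dl : is_diff t (fun s : R => s *: v + x) (fun s : R => s *: v).
  have h : is_diff t ((fun s : R => s *: v) + cst x) ((fun s : R => s *: v) + 0).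
    by apply: is_diffD.
  by apply: (is_diff_eq h); rewrite addr0.
have dlt : differentiable (fun s : R => s *: v + x) t by [].
have dc : differentiable (f \o (fun s : R => s *: v + x)) t by exact: differentiable_comp.
apply: DeriveDef; first exact: diff_derivable.
rewrite deriveE// (diff_comp dlt df)/= diff_val.
by rewrite scale1r.
Qed.

Lemma mvt01 (f f' : R -> R) (C : R) : f 0 = 0 ->
  (forall t : R, is_derive t (1 : R) f (f' t)) -> 
  (forall t, 0 <= t <= 1 -> `|f' t| <= C) -> forall t, 0 <= t <= 1 -> `|f t| <= C.
Proof.
move=> f0 df hC t /andP[t0 t1].
have C0 : 0 <= C by apply: le_trans (hC 0 _) => //; rewrite lexx ler01.
move: t0; rewrite le_eqVlt => /orP[/eqP <-|t0]; first by rewrite f0 normr0.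
have cf : continuous f.
  move=> s; apply: differentiable_continuous; apply/derivable1_diffP.
  by have := df s => -[].
have [c c01] := MVT t0 (fun s _ => df s) (continuous_subspaceT cf).
rewrite f0 !subr0 => ->; rewrite normrM (ger0_norm (ltW t0)).
move: c01; rewrite in_itv/= => /andP[c0 ct].
apply: (@le_trans _ _ (C * 1)); last by rewrite mulr1.
apply: ler_pM => //; first exact: ltW.
by apply: hC; rewrite (ltW c0)/= (le_trans (ltW ct)).
Qed.

Lemma norm1_sum_le v (a : 'I_n -> R) C : (forall i, `|a i| <= C) ->
  `|\sum_i v 0 i * a i| <= norm1 v * C.
Proof.
move=> h; apply: le_trans (ler_norm_sum _ _ _) _; rewrite mulr_suml.
by apply: ler_sum => i _; rewrite normrM ler_wpM2l.
Qed.

Lemma taylor0 f x v C : smooth f -> (forall i y, `|partial i f y| <= C) ->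
  `|f (v + x) - f x| <= norm1 v * C.
Proof.
move=> hf hC; pose G (t : R) := f (t *: v + x) - f x.
have dG (t : R) : is_derive t (1:R) G (\sum_i v 0 i * partial i f (t *: v + x)).
  rewrite -[X in is_derive _ _ _ X]subr0.
  by apply: (@is_deriveB _ _ _ _ (cst (f x))); apply: line_derive; exact: smooth_diff.
have := mvt01 (f := G) (C := norm1 v * C) _ dG _ (t := 1).
rewrite /G scale1r scale0r add0r subrr; apply => //; last by rewrite ler01 lexx.
by move=> t _; apply: norm1_sum_le.
Qed.

(** The mean value theorem along the segment reduces the remainder to [taylor0] for the functions
    [partial i f]. The factor 1/2 of the sharp estimate is given up. [taylor2] repeats the argument
    one order higher. *)
Lemma taylor1 f x v C : smooth f -> (forall i j y, `|partial i (partial j f) y| <= C) ->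
  `|f (v + x) - f x - \sum_i v 0 i * partial i f x| <= norm1 v ^+ 2 * C.
Proof.
move=> hf hC; set D := \sum_i _.
pose G (t : R) := f (t *: v + x) - f x - t * D.
have dG (t : R) : is_derive t (1:R) G (\sum_i v 0 i * partial i f (t *: v + x) - D).
  apply: (@is_deriveB _ _ _ (fun t : R => f (t *: v + x) - f x) (fun t : R => t * D)).
    rewrite -[X in is_derive _ _ _ X]subr0.
    by apply: (@is_deriveB _ _ _ _ (cst (f x))); apply: line_derive; exact: smooth_diff.
  rewrite -[X in is_derive _ _ _ X]mulr1.
  rewrite (_ : (fun t : R => t * D) = D \*: (id : R -> R)).
    exact: is_deriveZ.
  by apply/funext => s; rewrite mulrC.
have := mvt01 (f := G) (C := norm1 v ^+ 2 * C) _ dG _ (t := 1).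
rewrite /G scale1r scale0r add0r subrr mul0r subr0 mul1r; apply => //; last by rewrite ler01 lexx.
move=> t /andP[t0 t1]; rewrite /D -sumrB expr2 -mulrA.
under eq_bigr do rewrite -mulrBr.
apply: norm1_sum_le => i; apply: le_trans (taylor0 _ _ (smooth_partial i hf) (fun j y => hC j i y)) _.
rewrite ler_wpM2r//.
  by apply: le_trans (hC i i x).
rewrite /norm1; apply: ler_sum => j _; rewrite mxE normrM ger0_norm//.
by rewrite ler_piMl.
Qed.

Lemma taylor2 f x v C : smooth f ->
  (forall i j k y, `|partial i (partial j (partial k f)) y| <= C) ->
  `|f (v + x) - f x - \sum_i v 0 i * partial i f x -
    2^-1 * \sum_i v 0 i * \sum_j v 0 j * partial j (partial i f) x| <= norm1 v ^+ 3 * C.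
Proof.
move=> hf hC; set D := \sum_i v 0 i * partial i f x; set H := \sum_i _ * \sum_j _.
pose G (t : R) := f (t *: v + x) - f x - t * D - 2^-1 * t ^+ 2 * H.
have dG (t : R) : is_derive t (1:R) G (\sum_i v 0 i * partial i f (t *: v + x) - D - t * H).
  apply: (@is_deriveB _ _ _ (fun t : R => f (t *: v + x) - f x - t * D) (fun t : R => 2^-1 * t ^+ 2 * H)).
    apply: (@is_deriveB _ _ _ (fun t : R => f (t *: v + x) - f x) (fun t : R => t * D)).
      rewrite -[X in is_derive _ _ _ X]subr0.
      by apply: (@is_deriveB _ _ _ _ (cst (f x))); apply: line_derive; exact: smooth_diff.
    rewrite -[X in is_derive _ _ _ X]mulr1.
    rewrite (_ : (fun t : R => t * D) = D \*: (id : R -> R)); first exact: is_deriveZ.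
    by apply/funext => s; rewrite mulrC.
  have h := @is_deriveX _ _ (id : R -> R) 2 t 1 1 (is_derive_id _ _).
  have {}h := @is_deriveZ _ _ _ _ (2^-1 * H) t 1 _ h.
  rewrite (_ : (fun t : R => 2^-1 * t ^+ 2 * H) = (2^-1 * H) \*: ((id : R -> R) ^+ 2)).
    apply: (is_derive_eq h); rewrite /GRing.scale/= expr1.
    by field.
  by apply/funext => s; rewrite /= fctE/= /GRing.scale/=; ring.
have := mvt01 (f := G) (C := norm1 v ^+ 3 * C) _ dG _ (t := 1).
rewrite /G scale1r scale0r add0r subrr !mul0r expr0n/= mulr0 mul0r !subr0 mul1r expr1n mulr1.
apply => //; last by rewrite ler01 lexx.
move=> t /andP[t0 t1]; rewrite /D /H -sumrB mulr_sumr -sumrB exprS -mulrA.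
rewrite (eq_bigr (fun i => v 0 i * (partial i f (t *: v + x) - partial i f x -
  \sum_j (t *: v) 0 j * partial j (partial i f) x))); last first.
  move=> i _; rewrite (mulrBr (v 0 i)) (mulrBr (v 0 i)); congr (_ - _).
  rewrite mulrCA; congr (_ * _); rewrite mulr_sumr; apply: eq_bigr => j _.
  by rewrite mxE mulrA.
apply: norm1_sum_le => i.
apply: le_trans (taylor1 _ _ (smooth_partial i hf) (fun j k y => hC j k i y)) _.
rewrite ler_wpM2r//; first by apply: le_trans (hC i i i x).
rewrite lerXn2r ?nnegrE ?norm1_ge0//.
rewrite /norm1; apply: ler_sum => j _; rewrite mxE normrM ger0_norm//.
by rewrite ler_piMl.
Qed.

End taylor.

(** * Density of products of one-variable functions *)

Section bounds.
Variables (R : realType) (n : nat).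
Implicit Types (f : 'rV[R]_n -> R) (x v : 'rV[R]_n) (i : 'I_n).

(** The norm is the maximum of the coordinates, so a product of one-variable functions supported in
    [[-B, B]] vanishes outside the ball of the same radius [B]. *)
Definition outside (B : R) f := forall x, B < `|x| -> f x = 0.

Lemma closed_normle (B : R) : closed [set x : 'rV[R]_n | `|x| <= B].
Proof.
rewrite (_ : [set _ | _] = Num.norm @^-1` [set y | y <= B])//.
apply: preimage_closed; last exact: closed_le.
by move=> x _; exact: norm_continuous.
Qed.

Lemma compact_normle (B : R) : compact [set x : 'rV[R]_n | `|x| <= B].
Proof.
apply: bounded_closed_compact; last exact: closed_normle.
exists B; split; first exact: num_real.
by move=> M BM x /= /le_trans; apply; exact: ltW.
Qed.

Lemma smooth_compactP f : smooth_compact f <-> smooth f /\ exists B, outside B f.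
Proof.
split=> [[h1 h2]|[h1 [B h2]]].
  split; first by apply/smooth_iter_partial => s x; exact: h1.
  have [M [Mr hM]] := compact_bounded h2.
  exists (M + 1) => x Mx; apply/eqP; apply: contraTT Mx => fx; rewrite -leNgt.
  by apply: hM; [rewrite ltrDl|exact: subset_closure].
split; first by apply/smooth_iter_partial.
have sub : closure [set x | f x != 0] `<=` [set x | `|x| <= B].
  rewrite [X in _ `<=` X](closure_id _).1; last exact: closed_normle.
  by apply: closure_subset => x /= fx; rewrite leNgt; apply: contra fx => /h2 ->.
exact: (subclosed_compact (@closed_closure _ _) (@compact_normle B) sub).
Qed.

Lemma outside_partial B f i : outside B f -> outside B (partial i f).
Proof.
move=> h x Bx; apply: (@partial_out _ _ [set x | `|x| <= B] f i).
- exact: closed_normle.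
- by move=> y /negP; rewrite -ltNge; exact: h.
- by apply/negP; rewrite -ltNge.
Qed.

Lemma smooth_bounded B f : smooth f -> outside B f -> exists2 C, 0 < C & forall x, `|f x| <= C.
Proof.
move=> hf h.
have : compact [set f x | x in [set x | `|x| <= B]].
  apply: continuous_compact; last exact: compact_normle.
  exact/continuous_subspaceT/smooth_continuous.
move=> /compact_bounded[M [Mr hM]].
exists (`|M| + 1) => [|x]; first by rewrite ltr_wpDl.
have [xB|/h ->] := leP `|x| B; last by rewrite normr0 addr_ge0.
apply: hM; last by exists x.
by rewrite (le_lt_trans (ler_norm M))// ltrDl.
Qed.

Lemma uniform_bound (I : finType) (f : I -> 'rV[R]_n -> R) :
  (forall a, exists2 C, 0 < C & forall x, `|f a x| <= C) ->
  exists2 C, 0 < C & forall a x, `|f a x| <= C.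
Proof.
move=> h.
have /choice[C hC] : forall a, exists C, 0 < C /\ forall x, `|f a x| <= C.
  by move=> a; have [C C0 hC] := h a; exists C.
exists (\sum_a C a + 1) => [|a x].
  by rewrite ltr_wpDl// sumr_ge0// => a _; have [/ltW] := hC a.
apply: (@le_trans _ _ (C a)); first by have [_] := hC a.
rewrite (bigD1 a)//= -addrA lerDl addr_ge0// sumr_ge0// => b _.
by have [/ltW] := hC b.
Qed.

Lemma smooth_bounded3 B f : smooth f -> outside B f -> exists2 C, 0 < C &
  [/\ forall x, `|f x| <= C, forall i x, `|partial i f x| <= C,
      forall i j x, `|partial i (partial j f) x| <= C &
      forall i j k x, `|partial i (partial j (partial k f)) x| <= C].
Proof.
move=> hf h.
have [C0 C00 h0] := smooth_bounded hf h.
have [C1 C10 h1] : exists2 C, 0 < C & forall i x, `|partial i f x| <= C.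
  apply: uniform_bound => i; apply: smooth_bounded; first exact: smooth_partial.
  exact: outside_partial h.
have [C2 C20 h2] : exists2 C, 0 < C & forall (ij : 'I_n * 'I_n) x, `|partial ij.1 (partial ij.2 f) x| <= C.
  apply: uniform_bound => i; apply: smooth_bounded; first by do 2 apply: smooth_partial.
  by do 2 apply: outside_partial; exact: h.
have [C3 C30 h3] : exists2 C, 0 < C & forall (ij : 'I_n * 'I_n * 'I_n) x,
    `|partial ij.1.1 (partial ij.1.2 (partial ij.2 f)) x| <= C.
  apply: uniform_bound => i; apply: smooth_bounded; first by do 3 apply: smooth_partial.
  by do 3 apply: outside_partial; exact: h.
exists (C0 + C1 + C2 + C3); first by rewrite !addr_gt0.
split.
- by move=> x; apply: le_trans (h0 x) _; lra.
- by move=> i x; apply: le_trans (h1 i x) _; lra.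
- by move=> i j x; apply: le_trans (h2 (i, j) x) _; lra.
- by move=> i j k x; apply: le_trans (h3 (i, j, k) x) _; lra.
Qed.

Lemma norm1Z (c : R) v : norm1 (c *: v) = `|c| * norm1 v.
Proof. by rewrite /norm1 mulr_sumr; apply: eq_bigr => i _; rewrite mxE normrM. Qed.

Lemma norm1D v w : norm1 (v + w) <= norm1 v + norm1 w.
Proof. by rewrite /norm1 -big_split/=; apply: ler_sum => i _; rewrite mxE ler_normD. Qed.

Lemma norm1_ebasis i : norm1 (ebasis R i) = 1.
Proof.
rewrite /norm1 (bigD1 i)//= big1 ?addr0; first by rewrite mxE !eqxx/= normr1.
by move=> j ji; rewrite mxE eqxx/= (negbTE ji) normr0.
Qed.

Lemma sum_ebasis (c : R) i (a : 'I_n -> R) :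
  \sum_j (c *: ebasis R i) 0 j * a j = c * a i.
Proof.
rewrite (bigD1 i)//= big1 ?addr0; first by rewrite !mxE !eqxx mulr1.
by move=> j ji; rewrite !mxE eqxx/= (negbTE ji) mulr0 mul0r.
Qed.

(* The second difference in the directions [i], [j] is, by the mean value
   theorem in the direction [i] and Taylor for [partial i f],
   [s^2 partial j (partial i f) x + O(s^3)]; it is symmetric in [i], [j]. *)
Lemma second_difference f x i j (s C : R) : smooth f ->
  (forall i j k y, `|partial i (partial j (partial k f)) y| <= C) ->
  0 < s -> `|f (s *: ebasis R i + (s *: ebasis R j + x)) - f (s *: ebasis R i + x) -
     f (s *: ebasis R j + x) + f x - s ^+ 2 * partial j (partial i f) x| <= 5 * s ^+ 3 * C.
Proof.
move=> hf hC s0.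
have C0 : 0 <= C by apply: le_trans (hC i i i x).
pose e := ebasis R i; pose y := s *: ebasis R j + x.
pose phi (t : R) := f (t *: e + y) - f (t *: e + x).
have dphi (t : R) : is_derive t (1:R) phi (partial i f (t *: e + y) - partial i f (t *: e + x)).
  have h z : is_derive t (1:R) (fun t : R => f (t *: e + z)) (partial i f (t *: e + z)).
    apply: (is_derive_eq (line_derive (smooth_diff _ hf))).
    have := sum_ebasis 1 i (fun i => partial i f (t *: e + z)).
    by rewrite scale1r mul1r.
  by apply: (@is_deriveB _ _ _ (fun t : R => f (t *: e + y)) (fun t : R => f (t *: e + x))).
have cf : continuous phi.
  move=> t; apply: differentiable_continuous; apply/derivable1_diffP.
  by have := dphi t => -[].
have [c] := MVT s0 (fun t _ => dphi t) (continuous_subspaceT cf).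
rewrite in_itv/= => /andP[c0 cs]; rewrite subr0 {1 2}/phi scale0r !add0r => hc.
rewrite (_ : _ + f x = f (s *: e + y) - f (s *: e + x) - (f y - f x)); last first.
  by rewrite /y /e; ring.
rewrite hc; set D := partial j (partial i f) x.
have t1 := @taylor1 _ _ _ x (c *: e + s *: ebasis R j) C (smooth_partial i hf)
   (fun j k y => hC j k i y).
have t2 := @taylor1 _ _ _ x (c *: e) C (smooth_partial i hf)
   (fun j k y => hC j k i y).
have n1 : norm1 (c *: e + s *: ebasis R j) ^+ 2 <= (2 * s) ^+ 2.
  rewrite lerXn2r ?nnegrE ?norm1_ge0 ?mulr_ge0// ?(ltW s0)//.
  apply: le_trans (norm1D _ _) _; rewrite !norm1Z !norm1_ebasis !mulr1 !gtr0_norm//.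
  by have := ltW cs; lra.
have n2 : norm1 (c *: e) ^+ 2 <= s ^+ 2.
  rewrite lerXn2r ?nnegrE ?norm1_ge0// ?(ltW s0)//.
  by rewrite norm1Z norm1_ebasis mulr1 gtr0_norm// ltW.
move: t1 t2.
have -> : \sum_k (c *: e + s *: ebasis R j) 0 k * partial k (partial i f) x =
    \sum_k (c *: e) 0 k * partial k (partial i f) x + s * D.
  rewrite /D -(sum_ebasis s j (fun k => partial k (partial i f) x)) -big_split/=; apply: eq_bigr => k _.
  by rewrite mxE mulrDl.
set S := \sum_k _ => t1 t2.
have -> : (partial i f (c *: e + y) - partial i f (c *: e + x)) * s - s ^+ 2 * D =
  s * ((partial i f (c *: e + s *: ebasis R j + x) - partial i f x - (S + s * D)) -
       (partial i f (c *: e + x) - partial i f x - S)).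
  by rewrite /y addrA; ring.
rewrite normrM (gtr0_norm s0) exprS mulrCA -!mulrA; apply: ler_wpM2l; first exact: ltW.
apply: le_trans (ler_normB _ _) _; apply: le_trans (lerD t1 t2) _.
apply: (@le_trans _ _ ((2 * s) ^+ 2 * C + s ^+ 2 * C)).
  by apply: lerD; apply: ler_wpM2r.
by rewrite le_eqVlt; apply/orP; left; apply/eqP; ring.
Qed.

(** Both mixed derivatives are approximated by the same second difference, divided by [s^2], up to
    an error of order [s]. *)
Lemma schwarz f x i j C : smooth f ->
  (forall i j k y, `|partial i (partial j (partial k f)) y| <= C) ->
  partial j (partial i f) x = partial i (partial j f) x.
Proof.
move=> hf hC; have C0 : 0 <= C by apply: le_trans (hC i i i x).
apply/eqP; rewrite -subr_eq0 -normr_eq0; apply/eqP/le_anti; rewrite normr_ge0 andbT.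
apply/ler_addgt0Pr => e e0; rewrite add0r.
(* The two applications of the second difference bound cost [5 + 5]; [C + 1] keeps the denominator
   positive when [C = 0]. *)
pose s := e / (10 * (C + 1)).
have s0 : 0 < s by rewrite divr_gt0// mulr_gt0// ltr_wpDl.
have h1 := second_difference x i j hf hC s0.
have h2 := second_difference x j i hf hC s0.
move: h1 h2; rewrite addrCA.
set a := f _; set b := f _; set c := f _; set d := f x.
set p := partial j _ x; set q := partial i _ x => h1 h2.
have : `|s ^+ 2 * (p - q)| <= 10 * s ^+ 3 * C.
  have -> : s ^+ 2 * (p - q) = (a - c - b + d - s ^+ 2 * q) - (a - b - c + d - s ^+ 2 * p) by ring.
  apply: le_trans (ler_normB _ _) _; apply: le_trans (lerD h2 h1) _.
  by rewrite le_eqVlt; apply/orP; left; apply/eqP; ring.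
rewrite normrM ger0_norm ?sqr_ge0// (_ : 10 * _ * _ = s ^+ 2 * (10 * s * C)); last by ring.
rewrite ler_pM2l ?exprn_gt0// => /le_trans; apply.
rewrite /s (_ : _ * _ * C = e * (C / (C + 1))).
  rewrite ler_piMr ?(ltW e0)// ler_pdivrMr ?mul1r ?lerDl//.
  by rewrite ltr_wpDl.
by field; rewrite gt_eqF// ltr_wpDl.
Qed.

End bounds.

(** * The span of compactly supported products *)

Section boxspan.
Variables (R : realType) (N : nat).

(** The radius [B] is part of the predicate because the approximants of one test function must share
    a compact support: the coefficients are only locally integrable. *)
Inductive boxspan (B : R) : ('rV[R]_N -> R) -> Prop :=
| boxspan0 : boxspan B (fun=> 0)
| boxspan_cons (c : R) (g : 'I_N -> R -> R) P : (forall j, smooth1 (g j)) ->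
    (forall j t, t \notin `[- B, B] -> g j t = 0) -> boxspan B P ->
    boxspan B (fun z => c * boxf g z + P z).

Lemma boxspanD B P Q : boxspan B P -> boxspan B Q -> boxspan B (fun z => P z + Q z).
Proof.
move=> hP hQ; elim: hP => [|c g P' h1 h2 _ IH].
  by rewrite (_ : (fun z => _) = Q)//; apply/funext => z; rewrite add0r.
rewrite (_ : (fun z => _) = fun z => c * boxf g z + (P' z + Q z)).
  exact: boxspan_cons.
by apply/funext => z; rewrite addrA.
Qed.

Lemma boxspanZ B (a : R) P : boxspan B P -> boxspan B (fun z => a * P z).
Proof.
elim=> [|c g P' h1 h2 _ IH].
  rewrite (_ : (fun z => _) = fun=> 0); first exact: boxspan0.
  by apply/funext => z; rewrite mulr0.
rewrite (_ : (fun z => _) = fun z => (a * c) * boxf g z + a * P' z).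
  exact: boxspan_cons.
by apply/funext => z; rewrite mulrDr mulrA.
Qed.

Lemma boxspan_sum B (I : Type) (r : seq I) (P : I -> 'rV[R]_N -> R) :
  (forall i, boxspan B (P i)) -> boxspan B (fun z => \sum_(i <- r) P i z).
Proof.
move=> h; elim: r => [|i r IH].
  rewrite (_ : (fun z => _) = fun=> 0); first exact: boxspan0.
  by apply/funext => z; rewrite big_nil.
rewrite (_ : (fun z => _) = fun z => P i z + \sum_(i <- r) P i z).
  exact: boxspanD.
by apply/funext => z; rewrite big_cons.
Qed.

Lemma boxspan_box B (g : 'I_N -> R -> R) : (forall j, smooth1 (g j)) ->
    (forall j t, t \notin `[- B, B] -> g j t = 0) -> boxspan B (boxf g).
Proof.
move=> h1 h2; rewrite (_ : boxf g = fun z => 1 * boxf g z + 0).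
  exact: (boxspan_cons _ h1 h2 (boxspan0 B)).
by apply/funext => z; rewrite mul1r addr0.
Qed.

(** The affine factor is absorbed by the [l]-th function of each product, which keeps its support.
    Hence a polynomial times a product of bumps stays in the span. *)
Lemma boxspan_coordM B l (p : R) P : boxspan B P -> boxspan B (fun z => (z 0 l - p) * P z).
Proof.
elim=> [|c g P' h1 h2 _ IH].
  rewrite (_ : (fun z => _) = fun=> 0); first exact: boxspan0.
  by apply/funext => z; rewrite mulr0.
pose g' j t := if j == l then (t - p) * g j t else g j t.
rewrite (_ : (fun z => _) = fun z => c * boxf g' z + (z 0 l - p) * P' z).
  apply: boxspan_cons => // j; rewrite /g'.
    case: eqP => // _ k; apply: ksmooth1M; last exact: h1.
    apply: ksmooth1D; last exact: ksmooth1_cst.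
    case: k => // k; exists (fun=> 1); split; first by move=> x; exact: is_derive_id.
    exact: ksmooth1_cst.
  by move=> t tB; rewrite h2 ?mulr0 ?if_same.
apply/funext => z; rewrite mulrDr mulrCA; congr (c * _ + _).
rewrite /boxf (bigD1 l)//= [RHS](bigD1 l)//= mulrA {1}/g' eqxx; congr (_ * _).
by apply: eq_bigr => j jl; rewrite /g' (negbTE jl).
Qed.

Lemma smooth_boxspan B P : boxspan B P -> smooth P.
Proof.
elim=> [|c g P' h1 h2 _ IH]; first exact: smooth_cst.
by apply: smoothD => //; apply: smoothZ; exact: smooth_boxf.
Qed.

Lemma boxf_out B (g : 'I_N -> R -> R) : 0 <= B ->
  (forall j t, t \notin `[- B, B] -> g j t = 0) -> outside B (boxf g).
Proof.
move=> B0 h z Bz.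
have [j zj] : exists j, B < `|z 0 j|.
  have nz : `|z| != 0 by rewrite gt_eqF// (le_lt_trans B0).
  have [[i j] /= zij] := mx_norm_neq0 nz.
  by exists j; move: Bz; rewrite [X in _ < X]zij (ord1 i).
rewrite /boxf (bigD1 j)//= h ?mul0r// in_itv/=.
by rewrite -ler_norml -ltNge.
Qed.

End boxspan.

Section taylor_polynomial.
Variables (R : realType) (N : nat) (psi : 'rV[R]_N -> R) (p : 'rV[R]_N) (C : R).
Hypothesis hpsi : smooth psi.
Hypothesis hC : forall i j k y, `|partial i (partial j (partial k psi)) y| <= C.
Implicit Types (z : 'rV[R]_N) (i j l : 'I_N).

Let w l z := z 0 l - p 0 l.

Lemma smooth_shiftcoord l : smooth (fun z => z 0 l - p 0 l : R).
Proof.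
by move=> k; apply: ksmoothD; [exact: ksmooth_coord|exact: ksmooth_cst].
Qed.

Lemma partial_shiftcoord i l z : partial i (fun z => z 0 l - p 0 l) z = (l == i)%:R.
Proof.
rewrite partialD; first by rewrite partial_coord partial_cst addr0.
  exact: differentiable_coord.
exact: differentiable_cst.
Qed.

Definition affpart (c : 'I_N -> R) z := \sum_l (z 0 l - p 0 l) * c l.

Lemma smooth_affpart c : smooth (affpart c).
Proof.
apply: smooth_sum => l; apply: smoothM; [exact: smooth_shiftcoord|exact: smooth_cst].
Qed.

Lemma partial_affpart i c z : partial i (affpart c) z = c i.
Proof.
have sl l : smooth (fun z => (z 0 l - p 0 l) * c l).
  by apply: smoothM; [exact: smooth_shiftcoord|exact: smooth_cst].
have [_ ->] := partial_sum i (index_enum 'I_N) (fun l => smooth_diff z (sl l)).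
rewrite (bigD1 i)//= big1 ?addr0.
  rewrite partialM; [|exact: smooth_diff (smooth_shiftcoord i)|exact: differentiable_cst].
  by rewrite partial_shiftcoord eqxx partial_cst mul1r mulr0 addr0.
move=> l li; rewrite partialM; [|exact: smooth_diff (smooth_shiftcoord l)|exact: differentiable_cst].
by rewrite partial_shiftcoord (negbTE li) partial_cst mul0r mulr0 addr0.
Qed.

Definition taylorpoly z := psi p + affpart (fun l => partial l psi p) z +
  2^-1 * \sum_l (z 0 l - p 0 l) * affpart (fun m => partial m (partial l psi) p) z.

Let quad l z := (z 0 l - p 0 l) * affpart (fun m => partial m (partial l psi) p) z.

Let smooth_quad l : smooth (quad l).
Proof. by apply: smoothM; [exact: smooth_shiftcoord|exact: smooth_affpart]. Qed.

Let smooth_quads : smooth (fun z => \sum_l quad l z).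
Proof. by apply: smooth_sum => l; exact: smooth_quad. Qed.

Lemma smooth_taylorpoly : smooth taylorpoly.
Proof.
apply: smoothD; last exact: (smoothZ 2^-1 smooth_quads).
by apply: smoothD; [exact: smooth_cst|exact: smooth_affpart].
Qed.

(** Differentiating the quadratic part hits either of the two coordinates; by symmetry of the second
    derivatives both contributions agree and cancel the factor 1/2. *)
Lemma partial_taylorpoly i : partial i taylorpoly =
  fun z => partial i psi p + affpart (fun m => partial m (partial i psi) p) z.
Proof.
apply/funext => z.
have s1 : smooth (fun z => psi p + affpart (fun l => partial l psi p) z).
  by apply: smoothD; [exact: smooth_cst|exact: smooth_affpart].
rewrite partialD; [|exact: smooth_diff|exact: smooth_diff (smoothZ 2^-1 smooth_quads)].
rewrite partialD; [|exact: differentiable_cst|exact: smooth_diff (smooth_affpart _)].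
rewrite partial_cst add0r partial_affpart; congr (_ + _).
rewrite partialZ; last exact: smooth_diff smooth_quads.
have [_ ->] := partial_sum i (index_enum 'I_N) (fun l => smooth_diff z (smooth_quad l)).
rewrite (eq_bigr (fun l => (l == i)%:R * affpart (fun m => partial m (partial l psi) p) z +
   (z 0 l - p 0 l) * partial l (partial i psi) p)); last first.
  move=> l _; rewrite /quad partialM; last first.
  - exact: smooth_diff (smooth_affpart _).
  - exact: smooth_diff (smooth_shiftcoord l).
  rewrite partial_shiftcoord.
  rewrite [partial i (affpart _) z]partial_affpart.
  by rewrite (schwarz p l i hpsi hC).
rewrite big_split/= -/(affpart (fun l => partial l (partial i psi) p) z).
rewrite (bigD1 i)//= eqxx mul1r big1 ?addr0; last by move=> l /negbTE ->; rewrite mul0r.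
by field.
Qed.

Lemma partial2_taylorpoly j i : partial j (partial i taylorpoly) =
  fun=> partial j (partial i psi) p.
Proof.
rewrite partial_taylorpoly; apply/funext => z.
rewrite partialD; [|exact: differentiable_cst|exact: smooth_diff (smooth_affpart _)].
by rewrite partial_cst add0r partial_affpart.
Qed.

Definition taylorrem z := psi z - taylorpoly z.

Lemma smooth_taylorrem : smooth taylorrem.
Proof.
rewrite (_ : taylorrem = fun z => psi z + (-1) * taylorpoly z).
  by apply: smoothD => //; apply: smoothZ; exact: smooth_taylorpoly.
by apply/funext => z; rewrite mulN1r.
Qed.

Lemma partial_taylorrem i : partial i taylorrem = fun z => partial i psi z - partial i taylorpoly z.
Proof.
apply/funext => z; rewrite (_ : taylorrem = fun z => psi z + (-1) * taylorpoly z); last first.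
  by apply/funext => y; rewrite mulN1r.
rewrite partialD; [|exact: smooth_diff|exact: smooth_diff (smoothZ (-1) smooth_taylorpoly)].
by rewrite partialZ ?mulN1r//; exact: smooth_diff smooth_taylorpoly.
Qed.

Lemma partial2_taylorrem j i : partial j (partial i taylorrem) =
  fun z => partial j (partial i psi) z - partial j (partial i psi) p.
Proof.
apply/funext => z; rewrite partial_taylorrem.
rewrite (_ : (fun y => _ - _) = fun y => partial i psi y + (-1) * partial i taylorpoly y); last first.
  by apply/funext => y; rewrite mulN1r.
have s := smooth_partial i smooth_taylorpoly.
rewrite partialD; [|exact: smooth_diff (smooth_partial i hpsi)|exact: smooth_diff (smoothZ (-1) s)].
rewrite partialZ; last exact: smooth_diff s.
by rewrite partial2_taylorpoly mulN1r.
Qed.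

(** The remainder and its first and second derivatives are of orders 3, 2 and 1 at [p]. In each
    Leibniz term this exceeds by at least one the number of derivatives that fall on a bump of width
    [1 / k], each of which costs a factor [k]. *)
Lemma taylorrem_le z : `|taylorrem z| <= norm1 (z - p) ^+ 3 * C.
Proof.
have := @taylor2 _ _ psi p (z - p) C hpsi hC; rewrite subrK; apply: le_trans.
rewrite le_eqVlt; apply/orP; left; apply/eqP; congr `|_|.
rewrite /taylorrem /taylorpoly /affpart !opprD !addrA.
congr (_ - _ - _).
  by apply: eq_bigr => l _; rewrite !mxE.
congr (_ * _); apply: eq_bigr => l _; rewrite !mxE; congr (_ * _).
by apply: eq_bigr => m _; rewrite !mxE.
Qed.

Lemma partial_taylorrem_le i z : `|partial i taylorrem z| <= norm1 (z - p) ^+ 2 * C.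
Proof.
have := @taylor1 _ _ (partial i psi) p (z - p) C (smooth_partial i hpsi) (fun j k y => hC j k i y).
rewrite subrK; apply: le_trans.
rewrite le_eqVlt; apply/orP; left; apply/eqP; congr `|_|.
rewrite partial_taylorrem partial_taylorpoly opprD addrA; congr (_ - _).
by apply: eq_bigr => l _; rewrite !mxE.
Qed.

Lemma partial2_taylorrem_le j i z : `|partial j (partial i taylorrem) z| <= norm1 (z - p) * C.
Proof.
rewrite partial2_taylorrem.
have := @taylor0 _ _ (partial j (partial i psi)) p (z - p) C.
rewrite subrK; apply; first by do 2 apply: smooth_partial.
by move=> k y; exact: hC.
Qed.

Lemma boxspan_taylorpoly B P : boxspan B P -> boxspan B (fun z => P z * taylorpoly z).
Proof.
move=> hP.
have aff c Q : boxspan B Q -> boxspan B (fun z => Q z * affpart c z).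
  move=> hQ; rewrite (_ : (fun z => _) = fun z => \sum_l c l * ((z 0 l - p 0 l) * Q z)).
    by apply: boxspan_sum => l; apply: boxspanZ; exact: boxspan_coordM.
  apply/funext => z; rewrite mulr_sumr; apply: eq_bigr => l _.
  by ring.
rewrite (_ : (fun z => _) = fun z => (psi p * P z + P z * affpart (fun l => partial l psi p) z) +
  2^-1 * \sum_l ((z 0 l - p 0 l) * P z) * affpart (fun m => partial m (partial l psi) p) z).
  apply: boxspanD.
    by apply: boxspanD; [exact: boxspanZ|exact: aff].
  apply: boxspanZ; apply: boxspan_sum => l; apply: aff; exact: boxspan_coordM.
apply/funext => z; rewrite /taylorpoly !mulrDr (mulrC (P z) (psi p)); congr (_ + _).
rewrite mulrCA mulr_sumr; congr (_ * _); apply: eq_bigr => l _.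
by rewrite mulrCA mulrA.
Qed.

End taylor_polynomial.

(** * Gluing Taylor polynomials on a lattice *)

Section box_approximation.
Variable R : realType.

Lemma derive1_affine (g : R -> R) (a b : R) : smooth1 g ->
  derive1 (fun t => g (a * t + b)) = fun t => a * derive1 g (a * t + b).
Proof.
move=> hg; have [dg _] := smooth1P hg; apply/funext => t; rewrite derive1E.
have h : is_derive t (1:R) (fun y : R => a * y + b) a.
  have -> : a = a *: (1 : R) + 0 by rewrite addr0 /GRing.scale/= mulr1.
  rewrite {1}addr0 {1}/GRing.scale/= mulr1.
  by apply: (@is_deriveD _ _ _ (a \*: (id : R -> R)) (cst b)).
have h2 := @is_derive1_comp _ g (fun y => a * y + b) t _ _ (dg _) h.
rewrite (_ : (fun t => _) = g \o (fun y => a * y + b))//.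
by rewrite derive_val mulrC.
Qed.

Lemma derive1Zl (g : R -> R) (a : R) : smooth1 g ->
  derive1 (fun t => a * g t) = fun t => a * derive1 g t.
Proof.
move=> hg; have [dg _] := smooth1P hg; apply/funext => t; rewrite derive1E.
have h := @is_deriveZ _ _ _ g a t 1 _ (dg t).
rewrite (_ : (fun t => _) = a \*: g)//.
by rewrite derive_val.
Qed.

Definition unit_ind (t : R) : R := ((`|t| <= 1)%R)%:R.

Lemma unit_ind_ge0 t : 0 <= unit_ind t. Proof. by rewrite ler0n. Qed.

(** At most three integers lie within distance 1 of [t]. Instead of counting, the indicator is
    dominated by [F j - F (j + 3)], whose sum telescopes to at most [F 0 + F 1 + F 2]. *)
Lemma unit_ind_sum (L : nat) (t : R) : \sum_(j < L) unit_ind (t - j%:R) <= 3.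
Proof.
pose F (j : nat) := smoothstep (t - j%:R + 2).
have -> : 3 = F 0%N + F 1%N + F 2 + (3 - F 0%N - F 1%N - F 2) by ring.
apply: (@le_trans _ _ (\sum_(j < L) (F j - F (j + 3)%N))).
  apply: ler_sum => j _; rewrite /unit_ind /F natrD.
  have [] := boolP (`|t - j%:R| <= 1)%R.
    rewrite ler_norml => /andP[h1 h2].
    rewrite smoothstep1; last by lra.
    by rewrite smoothstep0 ?subr0//; lra.
  rewrite -ltNge ltr_normr => /orP[h|h].
    by rewrite smoothstep1 ?subr_ge0 ?smoothstep_le1//; lra.
  by rewrite [X in _ - X]smoothstep0 ?subr0 ?smoothstep_ge0//; lra.
have -> : \sum_(j < L) (F j - F (j + 3)%N) =
    F 0%N + F 1%N + F 2 - F L - F L.+1 - F L.+2.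
  elim: L => [|L IH]; first by rewrite big_ord0; ring.
  rewrite big_ord_recr/= IH addn3; ring.
have := smoothstep_ge0 (t - L%:R + 2); rewrite -/(F L).
have := smoothstep_ge0 (t - L.+1%:R + 2); rewrite -/(F L.+1).
have := smoothstep_ge0 (t - L.+2%:R + 2); rewrite -/(F L.+2).
have := smoothstep_le1 (t - 0%:R + 2); rewrite -/(F 0%N).
have := smoothstep_le1 (t - 1%:R + 2); rewrite -/(F 1%N).
have := smoothstep_le1 (t - 2%:R + 2); rewrite -/(F 2).
move: (F 0%N) (F 1%N) (F 2) (F L) (F L.+1) (F L.+2) => a b c d e f.
by move=> *; lra.
Qed.

(** The bound keeps the indicator of the support, so that sums over a lattice only see the
    overlapping bumps. One constant serves all derivatives below order [n]. *)
Lemma smoothbump_unit_ind n : exists2 C, 1 <= C &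
  forall m t, (m < n)%N -> `|derive1n m (@smoothbump R) t| <= C * unit_ind t.
Proof.
elim: n => [|n [C C1 hC]]; first by exists 1.
have [D D0 hD] := smooth1_bounded n (@smooth1_smoothbump R) (@smoothbump_out R).
exists (C + D); first by rewrite (le_trans C1)// lerDl ltW.
move=> m t; rewrite ltnS leq_eqVlt => /orP[/eqP ->|mn]; last first.
  apply: le_trans (hC m t mn) _; rewrite ler_wpM2r ?unit_ind_ge0// lerDl ltW//.
have [tin|tout] := boolP (t \in `[-1, 1]).
  have -> : unit_ind t = 1 by rewrite /unit_ind ler_norml; move: tin; rewrite in_itv/= => /andP[-> ->].
  rewrite mulr1.
  by apply: le_trans (hD t) _; rewrite lerDr (le_trans ler01).
rewrite (derive1n_out n (@smooth1_smoothbump R) (@smoothbump_out R) tout) normr0.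
by rewrite mulr_ge0 ?unit_ind_ge0// addr_ge0 ?(ltW D0)// (le_trans ler01).
Qed.

Section lattice_box.
Variables (N : nat) (k : R) (c : 'I_N -> R) (C : R).
Hypothesis k0 : 0 < k.
Hypothesis C1 : 1 <= C.
Hypothesis hC : forall m t, (m < 4)%N -> `|derive1n m (@smoothbump R) t| <= C * unit_ind t.

Definition lattice_bump (l : 'I_N) (t : R) : R := smoothbump (k * t + c l).

(** A majorant of the bump and, up to powers of [k], of its derivatives of order at most three,
    which still knows the support. *)
Definition lattice_ind (z : 'rV[R]_N) : R := \prod_l (C * unit_ind (k * z 0 l + c l)).

Lemma lattice_ind_ge0 z : 0 <= lattice_ind z.
Proof.
by apply: prodr_ge0 => l _; rewrite mulr_ge0 ?unit_ind_ge0// (le_trans ler01).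
Qed.

Lemma smooth1_lattice_bump l : smooth1 (lattice_bump l).
Proof. by move=> n; apply: ksmooth1_affine; exact: smooth1_smoothbump. Qed.

(** With a multi-index [a] the family is closed under partial derivatives, so that all orders are
    estimated at once by [boxf_lattice_bumpn_le]. *)
Definition lattice_bumpn (a : 'I_N -> nat) (l : 'I_N) (t : R) : R :=
  k ^+ a l * derive1n (a l) (@smoothbump R) (k * t + c l).

Lemma smooth1_lattice_bumpn a l : smooth1 (lattice_bumpn a l).
Proof.
move=> n; apply: ksmooth1M; first exact: ksmooth1_cst.
by apply: ksmooth1_affine; apply: smooth1_derive1n; exact: smooth1_smoothbump.
Qed.

Lemma lattice_bump0 : lattice_bump = lattice_bumpn (fun=> 0%N).
Proof. by apply/funext => l; apply/funext => t; rewrite /lattice_bumpn expr0 mul1r. Qed.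

Lemma dbox_lattice_bumpn i a :
  dbox i (lattice_bumpn a) = lattice_bumpn (fun l => (a l + (l == i))%N).
Proof.
apply/funext => l; rewrite /dbox /lattice_bumpn; case: eqP => [_|_]; last first.
  by apply/funext => t; rewrite addn0.
rewrite addn1 derive1Zl; last first.
  by move=> n; apply: ksmooth1_affine; apply: smooth1_derive1n; exact: smooth1_smoothbump.
rewrite derive1_affine; last exact/smooth1_derive1n/smooth1_smoothbump.
by apply/funext => t; rewrite mulrA exprSr derive1nS.
Qed.

Lemma boxf_lattice_bumpn_le a z : (forall l, (a l < 4)%N) ->
  `|boxf (lattice_bumpn a) z| <= k ^+ (\sum_l a l) * lattice_ind z.
Proof.
move=> ha; rewrite /boxf normr_prod -prodrXr -big_split/=.
apply: ler_prod => l _; rewrite normr_ge0/= /lattice_bumpn normrM.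
rewrite ger0_norm ?exprn_ge0 ?(ltW k0)// ler_wpM2l ?exprn_ge0 ?(ltW k0)//.
exact: hC.
Qed.

Lemma partial_boxf_lattice i a :
  partial i (boxf (lattice_bumpn a)) = boxf (lattice_bumpn (fun l => (a l + (l == i))%N)).
Proof.
by rewrite partial_boxf ?dbox_lattice_bumpn//; exact: smooth1_lattice_bumpn.
Qed.

Lemma sum_eq_ord (i : 'I_N) : (\sum_(l < N) (l == i))%N = 1%N.
Proof. by rewrite (bigD1 i)//= eqxx big1// => l /negbTE ->. Qed.

Lemma boxf_lattice_bump_le z : `|boxf lattice_bump z| <= lattice_ind z.
Proof.
rewrite lattice_bump0; apply: le_trans (boxf_lattice_bumpn_le _ _) _ => //.
by rewrite big1// expr0 mul1r.
Qed.

Lemma partial_lattice_bump_le i z : `|partial i (boxf lattice_bump) z| <= k * lattice_ind z.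
Proof.
rewrite lattice_bump0 partial_boxf_lattice.
apply: le_trans (boxf_lattice_bumpn_le _ _) _; first by move=> l; case: eqP.
by rewrite sum_eq_ord expr1.
Qed.

Lemma partial2_lattice_bump_le i j z :
  `|partial i (partial j (boxf lattice_bump)) z| <= k ^+ 2 * lattice_ind z.
Proof.
rewrite lattice_bump0 !partial_boxf_lattice.
apply: le_trans (boxf_lattice_bumpn_le _ _) _; first by move=> l; do 2 case: eqP.
by rewrite big_split/= !sum_eq_ord.
Qed.

Lemma partial3_lattice_bump_le i j l z :
  `|partial i (partial j (partial l (boxf lattice_bump))) z| <= k ^+ 3 * lattice_ind z.
Proof.
rewrite lattice_bump0 !partial_boxf_lattice.
apply: le_trans (boxf_lattice_bumpn_le _ _) _; first by move=> m; do 3 case: eqP.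
by rewrite big_split/= big_split/= !sum_eq_ord.
Qed.

End lattice_box.

(* Second order Taylor polynomials glued by a lattice partition of unity
   approximate [psi] in C^2; every term is a combination of products of
   one-variable functions. *)
Lemma box_approx (N : nat) (psi : 'rV[R]_N -> R) (B : R) : smooth psi -> outside B psi ->
  exists B' : R, 0 <= B' /\ forall e, 0 < e -> exists P : 'rV[R]_N -> R, boxspan B' P /\
    [/\ forall z, `|psi z - P z| <= e,
        forall i z, `|partial i psi z - partial i P z| <= e &
        forall i j z, `|partial i (partial j psi) z - partial i (partial j P) z| <= e].
Proof.
move=> hpsi hB.
have [C3 C30 [_ _ _ hC3]] := smooth_bounded3 hpsi hB.
have [C0 C01 hC0] := smoothbump_unit_ind 4.
pose b := Num.bound `|B|; have bB : B < b%:R.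
  by apply: le_lt_trans (ler_norm B) _; exact: archi_boundP.
(* [psi] vanishes beyond [b], the lattice points reach out to [b + 1], and the half width [1 / k] of
   a bump is at most 1. *)
exists (b%:R + 2); split; first by rewrite addr_ge0.
move=> e e0.
(* [(C0 * 3)^N] bounds the sum of all majorants at a point, 4 is the number of Leibniz terms of a
   second derivative, and [N^3] comes from [norm1 (z - p a) <= N / k] on the support. *)
pose Cst := (C0 * 3) ^+ N * (4 * N%:R ^+ 3 * C3).
have Cst0 : 0 <= Cst.
  by rewrite !mulr_ge0// ?exprn_ge0 ?mulr_ge0 ?(ltW C30)// (le_trans ler01).
pose k := (Num.bound (Cst / e)).+1.
have k1 : 1 <= k%:R :> R by rewrite ler1n.
have k0 : 0 < k%:R :> R by rewrite ltr0n.
have kbig : Cst / k%:R <= e.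
  rewrite ler_pdivrMr// mulrC -ler_pdivrMr//.
  apply: (@le_trans _ _ (Num.bound (Cst / e))%:R); last by rewrite ler_nat.
  by apply: ltW; apply: archi_boundP; rewrite divr_ge0// ltW.
pose K := (k * b.+1)%N; pose L := (1 + (K + K))%N.
pose S := {ffun 'I_N -> 'I_L}.
pose c (a : S) (l : 'I_N) : R := K%:R - (a l : nat)%:R.
pose p (a : S) : 'rV[R]_N := \row_l (((a l : nat)%:R - K%:R) / k%:R).
pose rho (a : S) := boxf (lattice_bump k%:R (c a)).
pose Q (a : S) := lattice_ind k%:R (c a) C0.
pose T (a : S) := taylorpoly psi (p a).
pose u (a : S) := taylorrem psi (p a).
have srho a : smooth (rho a) by apply: smooth_boxf => l; exact: smooth1_lattice_bump.
have su a : smooth (u a) by exact: smooth_taylorrem.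
pose P (z : 'rV[R]_N) := \sum_a rho a z * T a z.
have spanP : boxspan (b%:R + 2) P.
  apply: boxspan_sum => a; apply: boxspan_taylorpoly; apply: boxspan_box.
    by move=> l; exact: smooth1_lattice_bump.
  move=> l t tB; rewrite /lattice_bump smoothbump_out//; apply: contra tB.
  have aL : (a l : nat)%:R <= 2 * K%:R :> R.
    by rewrite -natrM ler_nat mul2n -addnn -ltnS -add1n; exact: ltn_ord.
  have a0 : 0 <= (a l : nat)%:R :> R by [].
  rewrite !in_itv/= /c => /andP[h1 h2].
  have KE : K%:R = k%:R * (b%:R + 1) :> R by rewrite /K natrM -natr1.
  apply/andP; split; rewrite -(ler_pM2l k0); nra.
have QS (z : 'rV[R]_N) : \sum_a Q a z <= (C0 * 3) ^+ N.
  rewrite /Q /lattice_ind -(bigA_distr_bigA (fun (l : 'I_N) (j : 'I_L) =>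
    C0 * unit_ind (k%:R * z 0 l + (K%:R - (j : nat)%:R)))).
  rewrite -[X in _ <= _ ^+ X](card_ord N) -prodr_const.
  apply: ler_prod => l _; apply/andP; split.
    by apply: sumr_ge0 => j _; rewrite mulr_ge0 ?unit_ind_ge0// (le_trans ler01).
  rewrite -mulr_sumr ler_wpM2l ?(le_trans ler01)//.
  under eq_bigr do rewrite addrA.
  exact: unit_ind_sum.
have one (z : 'rV[R]_N) : (forall l, `|z 0 l| <= b%:R) -> \sum_a rho a z = 1.
  move=> zb; rewrite /rho /boxf -(bigA_distr_bigA (fun (l : 'I_N) (j : 'I_L) =>
    smoothbump (k%:R * z 0 l + (K%:R - (j : nat)%:R)))).
  apply: big1 => l _; under eq_bigr do rewrite addrA.
  have h := @smoothbump_partition R 1 (K + K) (k%:R * z 0 l + K%:R) isT.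
  transitivity (\sum_(j < 1 + (K + K)) smoothbump (k%:R * z 0 l + K%:R - (j : nat)%:R / 1%:R : R)).
    by apply: eq_bigr => j _; rewrite divr1.
  have := zb l; rewrite ler_norml => /andP[h1 h2].
  have KE : K%:R = k%:R * (b%:R + 1) :> R by rewrite /K natrM -natr1.
  by rewrite h// ?divr1 ?natrD KE; nra.
(* Where [psi] may be nonzero the bumps sum to 1, elsewhere [psi] is 0; in both cases [psi] equals
   [psi] times the sum of the bumps. *)
have E : (fun z : 'rV[R]_N => psi z - P z) = fun z => \sum_a rho a z * u a z.
  apply/funext => z; rewrite /u /taylorrem.
  under [RHS]eq_bigr do rewrite mulrBr.
  rewrite sumrB; congr (_ - _); rewrite -mulr_suml.
  have [/forallP zb|] := boolP [forall l, `|z 0 l| <= b%:R].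
    by rewrite one ?mul1r.
  rewrite negb_forall => /existsP[l]; rewrite -ltNge => zb.
  rewrite hB ?mulr0//; apply: lt_le_trans bB _; apply: le_trans (ltW zb) _.
  rewrite [leRHS]/Num.Def.normr/= mx_normrE; apply/bigmax_geP; right => /=.
  by exists (0, l).
have pd a (z : 'rV[R]_N) : Q a z != 0 -> norm1 (z - p a) <= N%:R / k%:R.
  move=> Qz; rewrite /norm1.
  apply: (@le_trans _ _ (\sum_(l < N) k%:R^-1)); last first.
    by rewrite sumr_const card_ord -[X in X <= _]mulr_natl lexx.
  apply: ler_sum => l _; move: Qz; rewrite /Q /lattice_ind prodf_seq_neq0 => /allP.
  move=> /(_ l (mem_index_enum l))/=; rewrite mulf_eq0 negb_or => /andP[_].
  rewrite /unit_ind pnatr_eq0 eqb0 negbK /c => h.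
  rewrite !mxE -(ler_pM2l k0) mulfV ?gt_eqF// -[X in X * _](gtr0_norm k0) -normrM.
  apply: le_trans h; rewrite le_eqVlt; apply/orP; left; apply/eqP; congr `|_|.
  by field; rewrite gt_eqF.
(* The scale count: [m] derivatives of the bump cost [k^m], a remainder of order [q > m] gains
   [k^-q], and a factor [1 / k] is left over. *)
have bd m q a (z : 'rV[R]_N) : (m < q <= 3)%N ->
    k%:R ^+ m * Q a z * (norm1 (z - p a) ^+ q * C3) <= Q a z * (N%:R ^+ 3 * C3 / k%:R).
  move=> /andP[mq q3]; have Q0 : 0 <= Q a z.
    by apply: lattice_ind_ge0 => //; exact: le_trans C01.
  have [->|Qn0] := eqVneq (Q a z) 0; first by rewrite mulr0 !mul0r.
  rewrite (_ : k%:R ^+ m * _ * _ = Q a z * C3 * (k%:R ^+ m * norm1 (z - p a) ^+ q)); last by ring.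
  rewrite (_ : Q a z * (_ / _) = Q a z * C3 * (N%:R ^+ 3 / k%:R)); last by ring.
  apply: ler_wpM2l; first by rewrite mulr_ge0// ltW.
  apply: (@le_trans _ _ (k%:R ^+ m * (N%:R / k%:R) ^+ q)).
    rewrite ler_wpM2l ?exprn_ge0 ?(ltW k0)// lerXn2r ?nnegrE ?norm1_ge0 ?divr_ge0 ?(ltW k0)//.
    exact: pd.
  rewrite exprMn exprVn mulrCA.
  apply: ler_pM; [by rewrite exprn_ge0| | |].
  - by rewrite mulr_ge0 ?invr_ge0 ?exprn_ge0 ?(ltW k0).
  - case: (N) => [|N']; first by rewrite !expr0n; case: q mq q3 => // q _ _.
    by rewrite ler_weXn2l ?ler1n.
  - rewrite ler_pdivrMr ?exprn_gt0// mulrC ler_pdivlMr// -exprSr.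
    by rewrite ler_weXn2l.
have fin (X : S -> R) (z : 'rV[R]_N) : (forall a, `|X a| <= Q a z * (4 * N%:R ^+ 3 * C3 / k%:R)) ->
    `|\sum_a X a| <= e.
  move=> hX; apply: le_trans kbig; apply: le_trans (ler_norm_sum _ _ _) _.
  apply: (@le_trans _ _ (\sum_a Q a z * (4 * N%:R ^+ 3 * C3 / k%:R))).
    by apply: ler_sum => a _.
  rewrite -mulr_suml mulrA /Cst; apply: ler_wpM2r; first by rewrite invr_ge0 ltW.
  apply: ler_wpM2r => //; by rewrite !mulr_ge0// ?exprn_ge0// ltW.
have t0 a z : `|u a z| <= norm1 (z - p a) ^+ 3 * C3 by exact: taylorrem_le.
have t1 a i z : `|partial i (u a) z| <= norm1 (z - p a) ^+ 2 * C3 by exact: partial_taylorrem_le.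
have t2 a j i z : `|partial j (partial i (u a)) z| <= norm1 (z - p a) ^+ 1 * C3.
  by rewrite expr1; exact: partial2_taylorrem_le.
have r0 a z : `|rho a z| <= k%:R ^+ 0 * Q a z.
  by rewrite expr0 mul1r; exact: boxf_lattice_bump_le.
have r1 a i z : `|partial i (rho a) z| <= k%:R ^+ 1 * Q a z.
  by rewrite expr1; exact: partial_lattice_bump_le.
have r2 a j i z : `|partial j (partial i (rho a)) z| <= k%:R ^+ 2 * Q a z.
  exact: partial2_lattice_bump_le.
have term m q a (z : 'rV[R]_N) (x y : R) : (m < q <= 3)%N -> `|x| <= k%:R ^+ m * Q a z ->
    `|y| <= norm1 (z - p a) ^+ q * C3 -> `|x * y| <= Q a z * (N%:R ^+ 3 * C3 / k%:R).
  by move=> mq hx hy; rewrite normrM; apply: le_trans (bd m q a z mq); exact: ler_pM.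
have four a (z : 'rV[R]_N) : Q a z * (4 * N%:R ^+ 3 * C3 / k%:R) =
  Q a z * (N%:R ^+ 3 * C3 / k%:R) + Q a z * (N%:R ^+ 3 * C3 / k%:R) +
  Q a z * (N%:R ^+ 3 * C3 / k%:R) + Q a z * (N%:R ^+ 3 * C3 / k%:R) by ring.
have Q0 a (z : 'rV[R]_N) : 0 <= Q a z * (N%:R ^+ 3 * C3 / k%:R).
  rewrite mulr_ge0// ?divr_ge0 ?mulr_ge0 ?exprn_ge0 ?(ltW C30) ?(ltW k0)//.
  by apply: lattice_ind_ge0 => //; exact: le_trans C01.
have sP : smooth P by exact: smooth_boxspan spanP.
pose Rm := (fun z => psi z - P z).
have RE : Rm = fun z => \sum_a rho a z * u a z by exact: E.
have RmE : Rm = fun z => psi z + (-1) * P z by apply/funext => z; rewrite mulN1r.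
have pRm i : partial i Rm = fun z => partial i psi z - partial i P z.
  apply/funext => z; rewrite RmE partialD; [|exact: smooth_diff|exact: smooth_diff (smoothZ _ sP)].
  by rewrite partialZ ?mulN1r//; exact: smooth_diff.
have ppRm i j : partial i (partial j Rm) = fun z => partial i (partial j psi) z - partial i (partial j P) z.
  apply/funext => z; rewrite pRm.
  rewrite (_ : (fun y => _ - _) = fun y => partial j psi y + (-1) * partial j P y); last first.
    by apply/funext => y; rewrite mulN1r.
  have s := smooth_partial j sP.
  rewrite partialD; [|exact: smooth_diff (smooth_partial j hpsi)|exact: smooth_diff (smoothZ _ s)].
  by rewrite partialZ ?mulN1r//; exact: smooth_diff.
have dR i : partial i Rm = fun z => \sum_a (partial i (rho a) z * u a z + rho a z * partial i (u a) z).
  apply/funext => z; rewrite RE.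
  have sm a : smooth (fun z => rho a z * u a z) by exact: smoothM.
  have [_ ->] := partial_sum i (index_enum S) (fun a => smooth_diff z (sm a)).
  by apply: eq_bigr => a _; rewrite partialM//; exact: smooth_diff.
have ddR j i : partial j (partial i Rm) = fun z => \sum_a
   ((partial j (partial i (rho a)) z * u a z + partial i (rho a) z * partial j (u a) z) +
    (partial j (rho a) z * partial i (u a) z + rho a z * partial j (partial i (u a)) z)).
  apply/funext => z; rewrite dR.
  have s1 a : smooth (fun z => partial i (rho a) z * u a z).
    by apply: smoothM => //; exact: smooth_partial.
  have s2 a : smooth (fun z => rho a z * partial i (u a) z).
    by apply: smoothM => //; exact: smooth_partial.
  have sm a : smooth (fun z => partial i (rho a) z * u a z + rho a z * partial i (u a) z).
    exact: smoothD.
  have [_ ->] := partial_sum j (index_enum S) (fun a => smooth_diff z (sm a)).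
  apply: eq_bigr => a _; rewrite partialD; [|exact: smooth_diff (s1 a)|exact: smooth_diff (s2 a)].
  have dr := smooth_diff z (srho a); have du := smooth_diff z (su a).
  have dri := smooth_diff z (smooth_partial i (srho a)).
  have dui := smooth_diff z (smooth_partial i (su a)).
  by rewrite !partialM.
exists P; split => //; split.
- move=> z; rewrite -/(Rm z) RE; apply: (fin _ z) => a; rewrite four.
  apply: le_trans (term 0%N 3 a z _ _ isT (r0 a z) (t0 a z)) _.
  by have := Q0 a z; set x := Q a z * _ => x0; lra.
- move=> i z; have -> : partial i psi z - partial i P z = partial i Rm z by rewrite pRm.
  rewrite dR; apply: (fin _ z) => a; rewrite four.
  apply: le_trans (ler_normD _ _) _.
  apply: le_trans (lerD (term 1%N 3 a z _ _ isT (r1 a i z) (t0 a z))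
                        (term 0%N 2 a z _ _ isT (r0 a z) (t1 a i z))) _.
  by have := Q0 a z; set x := Q a z * _ => x0; lra.
- move=> j i z; have -> : partial j (partial i psi) z - partial j (partial i P) z =
    partial j (partial i Rm) z by rewrite ppRm.
  rewrite ddR; apply: (fin _ z) => a; rewrite four.
  apply: le_trans (ler_normD _ _) _; rewrite -addrA; apply: lerD.
    apply: le_trans (ler_normD _ _) _; apply: lerD.
      exact: (term 2%N 3).
    exact: (term 1%N 2).
  apply: le_trans (ler_normD _ _) _; apply: lerD.
    exact: (term 1%N 2).
  exact: (term 0%N 1%N).
Qed.

End box_approximation.

(** * Integration and quantization *)

Section integrable_real.
Context d (T : measurableType d) (R : realType) (m : {measure set T -> \bar R}).
Implicit Types (f g : T -> R).

Definition L1 f := m.-integrable [set: T] (EFin \o f).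

Lemma L1_measurable f : L1 f -> measurable_fun setT f.
Proof. by move=> /measurable_int/measurable_EFinP. Qed.

Lemma L1D f g : L1 f -> L1 g -> L1 (fun x => f x + g x).
Proof. by move=> hf hg; exact: (integrableD measurableT hf hg). Qed.

Lemma L1Z c f : L1 f -> L1 (fun x => c * f x).
Proof. by move=> hf; exact: (integrableZl measurableT c hf). Qed.

Lemma L1N f : L1 f -> L1 (fun x => - f x).
Proof.
move=> hf; rewrite (_ : (fun x => - f x) = fun x => (-1) * f x); first exact: L1Z.
by apply/funext => x; rewrite mulN1r.
Qed.

Lemma L1B f g : L1 f -> L1 g -> L1 (fun x => f x - g x).
Proof. by move=> hf hg; apply: L1D => //; exact: L1N. Qed.

Lemma L1_cst0 : L1 (fun=> 0).
Proof. exact: integrable0. Qed.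

Lemma L1_sum (I : Type) (s : seq I) (f : I -> T -> R) : (forall i, L1 (f i)) ->
  L1 (fun x => \sum_(i <- s) f i x).
Proof.
move=> h; elim: s => [|i s IH].
  rewrite (_ : (fun x => _) = fun=> 0); first exact: L1_cst0.
  by apply/funext => x; rewrite big_nil.
rewrite (_ : (fun x => _) = fun x => f i x + \sum_(i <- s) f i x); first exact: L1D.
by apply/funext => x; rewrite big_cons.
Qed.

Lemma L1_norm f : L1 f -> L1 (fun x => `|f x|).
Proof. exact: integrable_norm. Qed.

Lemma L1_dom f g : measurable_fun setT f -> (forall x, `|f x| <= g x) -> L1 g -> L1 f.
Proof.
move=> mf fg; apply: le_integrable => //; first exact/measurable_EFinP.
by move=> x _ /=; rewrite lee_fin (le_trans (fg x))// ler_norm.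
Qed.

Lemma L1M_bounded f g C : L1 f -> measurable_fun setT g -> (forall x, `|g x| <= C) ->
  L1 (fun x => f x * g x).
Proof.
move=> hf mg gC; apply: (L1_dom (g := fun x => C * `|f x|)).
- by apply: measurable_funM => //; exact: L1_measurable.
- by move=> x; rewrite normrM mulrC ler_wpM2r.
- by apply: L1Z; exact: L1_norm.
Qed.

Lemma Rint_sum (I : Type) (s : seq I) (f : I -> T -> R) : (forall i, L1 (f i)) ->
  \int[m]_x (\sum_(i <- s) f i x) = \sum_(i <- s) \int[m]_x f i x.
Proof.
move=> h; elim: s => [|i s IH].
  rewrite big_nil; under eq_Rintegral do rewrite big_nil.
  by rewrite /Rintegral integral0.
rewrite big_cons; under eq_Rintegral do rewrite big_cons.
by rewrite RintegralD//; [rewrite IH|exact: h|exact: L1_sum].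
Qed.

Lemma Rint_norm_le f g : L1 f -> L1 g -> (forall x, `|f x| <= g x) ->
  `|\int[m]_x f x| <= \int[m]_x g x.
Proof.
move=> hf hg fg; apply: le_trans (le_normr_Rintegral measurableT hf) _.
apply: le_Rintegral => //; exact: L1_norm.
Qed.

End integrable_real.

Section integrable_prob.
Context d (T : measurableType d) (R : realType) (m : probability T R).

Lemma L1_cst (c : R) : L1 m (fun=> c).
Proof. exact: finite_measure_integrable_cst. Qed.

Lemma L1_bounded (f : T -> R) C : measurable_fun setT f -> (forall x, `|f x| <= C) -> L1 m f.
Proof. by move=> mf fC; apply: (L1_dom mf fC); exact: L1_cst. Qed.

Lemma Rint_cst (c : R) : \int[m]_x c = c.
Proof. by rewrite Rintegral_cst// (_ : _ setT = 1%E) ?mulr1//; exact: probability_setT. Qed.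

End integrable_prob.

Section tensor_integral.
Context d1 d2 (T1 : measurableType d1) (T2 : measurableType d2) (R : realType).
Variables (mu : probability T1 R) (nu : probability T2 R).
Local Notation munu := (mu \x nu)%E.

Lemma Rint_tensor (f : T1 -> R) (g : T2 -> R) : L1 mu f -> L1 nu g ->
  L1 munu (fun z => f z.1 * g z.2) /\
  \int[munu]_z (f z.1 * g z.2) = \int[mu]_x f x * \int[nu]_y g y.
Proof.
move=> hf hg.
have mf := L1_measurable hf; have mg := L1_measurable hg.
have mfg : measurable_fun setT (fun z : T1 * T2 => f z.1 * g z.2).
  apply: measurable_funM; [exact: (measurableT_comp mf)|exact: (measurableT_comp mg)].
have mfgE : measurable_fun setT (EFin \o (fun z : T1 * T2 => f z.1 * g z.2)).
  exact/measurable_EFinP.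
have i : munu.-integrable setT (EFin \o (fun z : T1 * T2 => f z.1 * g z.2)).
  apply/integrableP; split => //.
  have mabs : measurable_fun setT (fun z : T1 * T2 => `|(f z.1 * g z.2)%:E|%E).
    exact: (measurableT_comp _ mfgE).
  rewrite (fubini_tonelli1 (fun z : T1 * T2 => `|(f z.1 * g z.2)%:E|%E))//.
  have h x : (fubini_F nu (fun z : T1 * T2 => `|(f z.1 * g z.2)%:E|) x =
      `|f x|%:E * (\int[nu]_y `|g y|)%:E)%E.
    rewrite /fubini_F/=; under eq_integral do rewrite normrM EFinM.
    rewrite ge0_integralZl//.
      rewrite /Rintegral fineK//; apply: integrable_fin_num => //; exact: L1_norm.
    by apply/measurable_EFinP; exact: measurableT_comp.
  under eq_integral do rewrite h.
  have := integrable_lty measurableT (integrableZr measurableT (\int[nu]_y `|g y|) (L1_norm hf)).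
  by apply: le_lt_trans.
split => //; rewrite /Rintegral -integral12_prod_meas1// -fineM; last 2 first.
- by apply: integrable_fin_num.
- by apply: integrable_fin_num.
congr fine; rewrite /fubini_F/=.
have h x : (\int[nu]_y (f x * g y)%:E = (f x)%:E * \int[nu]_y (g y)%:E)%E.
  under eq_integral do rewrite EFinM.
  exact: integralZl.
under eq_integral do rewrite h.
rewrite -[X in (_ * X)%E](@fineK _ (\int[nu]_y (g y)%:E)%E); last exact: integrable_fin_num.
by rewrite -integralZr//; apply: eq_integral => x _; rewrite fineK//; exact: integrable_fin_num.
Qed.

End tensor_integral.

(** * Quantization of integrable functions *)

Section quantization.
Variable R : realType.
Implicit Types (t : R) (J : nat).

(** The integer numerator is kept apart because jumps have to be lattice translations. Values beyond
    [J] are replaced by 0, so that the quantized function is bounded by [J] and takes finitely many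
    values. *)
Definition zquant J t : int := if `|t| <= J%:R then Num.floor (J%:R * t) else 0.
Definition quant J t : R := (zquant J t)%:~R / J%:R.

Lemma quant_close J t : (0 < J)%N -> `|t| <= J%:R -> `|quant J t - t| <= J%:R^-1.
Proof.
move=> J0 tJ; rewrite /quant /zquant tJ.
have J0' : 0 < J%:R :> R by rewrite ltr0n.
have /andP[h1 h2] := floor_itv (J%:R * t); move: h2; rewrite intrD => h2.
rewrite -(ler_pM2l J0') mulfV ?gt_eqF// -[X in X * _](gtr0_norm J0') -normrM.
rewrite (_ : J%:R * _ = (Num.floor (J%:R * t))%:~R - J%:R * t); last by field; rewrite gt_eqF.
by rewrite ler_norml; apply/andP; split; lra.
Qed.

Lemma quant_far J t : J%:R < `|t| -> quant J t = 0.
Proof. by rewrite /quant /zquant leNgt => ->; rewrite mul0r. Qed.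

Lemma quant_le J t : (0 < J)%N -> `|quant J t| <= J%:R.
Proof.
move=> J0; have J0' : 0 < J%:R :> R by rewrite ltr0n.
have [tJ|/quant_far ->] := leP `|t| J%:R; last by rewrite normr0.
rewrite /quant /zquant tJ normrM normfV (gtr0_norm J0') ler_pdivrMr// ler_norml.
move: tJ; rewrite ler_norml => /andP[h1 h2].
apply/andP; split.
  rewrite (_ : - _ = (- (J * J)%:Z)%:~R :> R); last by rewrite intrN -pmulrn natrM.
  rewrite ler_int floor_ge_int intrN -pmulrn natrM -mulrN ler_pM2l//.
apply: le_trans (floor_le _) _.
by rewrite ler_pM2l.
Qed.

(** Uniform in [J], also where the value is truncated: this is the majorant for dominated
    convergence. *)
Lemma quant_err J t : (0 < J)%N -> `|quant J t - t| <= `|t| + 1.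
Proof.
move=> J0; have [tJ|tJ] := leP `|t| J%:R.
  apply: le_trans (quant_close J0 tJ) _.
  by rewrite (le_trans (_ : _ <= 1))// ?lerDr// invf_le1 ?ler1n// ltr0n.
by rewrite quant_far// sub0r normrN lerDl.
Qed.

Lemma quant_dom J t : (0 < J)%N -> `|quant J t| <= `|t| + 1.
Proof.
move=> J0; have [tJ|tJ] := leP `|t| J%:R; last by rewrite quant_far// normr0 addr_ge0.
rewrite -[quant J t](subrK t); apply: le_trans (ler_normD _ _) _.
rewrite addrC lerD2l; apply: le_trans (quant_close J0 tJ) _.
by rewrite invf_le1 ?ler1n// ltr0n.
Qed.

Lemma quant_cvg t : quant J t @[J --> \oo] --> t.
Proof.
apply/cvgrPdist_le => e e0; near=> J.
have J0 : (0 < J)%N by near: J; exists 1%N.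
have tJ : `|t| <= J%:R by near: J; exact: nbhs_infty_ger.
rewrite distrC; apply: le_trans (quant_close J0 tJ) _.
rewrite invf_ple ?posrE ?ltr0n//; near: J; exact: nbhs_infty_ger.
Unshelve. all: by end_near. Qed.

Lemma measurable_quant J : measurable_fun setT (quant J).
Proof.
apply: measurable_funM; last exact: measurable_cst.
rewrite (_ : (fun t => _) = fun t => if `|t| <= J%:R then (Num.floor (J%:R * t))%:~R else 0); last first.
  by apply/funext => t; rewrite /zquant; case: ifP.
apply: measurable_fun_ifT => //.
  by apply: measurable_fun_ler => //; exact: measurable_normr.
have fl : measurable_fun setT (fun t : R => (Num.floor t)%:~R : R).
  by apply: nondecreasing_measurable => // s t st; rewrite ler_int; exact: le_floor.
have mJ : measurable_fun setT (fun t : R => J%:R * t) by exact: measurable_funM.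
exact: (measurableT_comp fl mJ).
Qed.

Context d (T : measurableType d) (m : probability T R).

Lemma L1_quant J (f : T -> R) : measurable_fun setT f -> L1 m (fun x => quant J (f x)).
Proof.
move=> mf; have [J0|J0] := posnP J.
  rewrite (_ : (fun x => _) = fun=> 0); first exact: L1_cst0.
  by apply/funext => x; rewrite /quant J0 invr0 mulr0.
apply: (@L1_bounded _ _ _ m _ J%:R); last by move=> x; exact: quant_le.
by apply: measurableT_comp => //; exact: measurable_quant.
Qed.

Lemma dominated_cvg0 (g : nat -> T -> R) (h : T -> R) : L1 m h ->
  (forall J, measurable_fun setT (g J)) -> (forall J x, `|g J x| <= h x) ->
  (forall x, g J x @[J --> \oo] --> (0 : R)) -> \int[m]_x g J x @[J --> \oo] --> (0 : R).
Proof.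
move=> hh mg gh g0.
have cv x : (g J x)%:E @[J --> \oo] --> (0%E : \bar R) by apply: cvg_EFin; [exact: nearW|exact: g0].
have [_ _] := @dominated_convergence _ _ _ m setT measurableT
  (fun J x => (g J x)%:E) (fun=> 0%E) (fun x => (h x)%:E)
  (fun J => (iffRL (measurable_EFinP _ _) (mg J))) (@measurable_cst _ _ _ _ setT (0%E : \bar R))
  (aeW _ (fun x _ => cv x)) hh (aeW _ (fun x J _ => gh J x)).
rewrite integral0 => /fine_cvgP[_]; exact.
Qed.

Lemma measurable_quant_comp J (f : T -> R) : measurable_fun setT f -> measurable_fun setT (fun x => quant J (f x)).
Proof. by move=> mf; apply: measurableT_comp => //; exact: measurable_quant. Qed.

Lemma quant_L1_cvg (f : T -> R) : L1 m f ->
  \int[m]_x `|quant J (f x) - f x| @[J --> \oo] --> (0 : R).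
Proof.
move=> hf; have mf := L1_measurable hf.
rewrite -cvg_shiftS/=.
apply: (dominated_cvg0 (h := fun x => `|f x| + 1)).
- exact: L1D (L1_norm hf) (L1_cst m 1).
- move=> J; apply: measurableT_comp => //; apply: measurable_funB => //.
  exact: measurable_quant_comp.
- by move=> J x; rewrite normr_id quant_err.
- move=> x; rewrite -[X in _ --> X](@normr0 R R) -(subrr (f x)).
  apply: cvg_norm; apply: cvgB; last exact: cvg_cst.
  have := @quant_cvg (f x); rewrite -cvg_shiftS; exact.
Qed.

Lemma quant_L2_cvg (f : T -> R) : measurable_fun setT f -> L1 m (fun x => f x ^+ 2) ->
  \int[m]_x (quant J (f x) - f x) ^+ 2 @[J --> \oo] --> (0 : R).
Proof.
move=> mf hf; rewrite -cvg_shiftS/=.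
apply: (dominated_cvg0 (h := fun x => 2 * f x ^+ 2 + 2)).
- exact: L1D (L1Z 2 hf) (L1_cst m 2).
- move=> J; apply: measurable_funX; apply: measurable_funB => //.
  exact: measurable_quant_comp.
- move=> J x; rewrite normrX; have q := quant_err (f x) (ltn0Sn J).
  apply: (@le_trans _ _ ((`|f x| + 1) ^+ 2)); first by rewrite lerXn2r ?nnegrE ?addr_ge0.
  rewrite -(real_normK (num_real (f x))); move: (`|f x|) => y.
  have := sqr_ge0 (y - 1); rewrite !expr2; nra.
- move=> x; rewrite (_ : 0 = (f x - f x) * (f x - f x)); last by rewrite subrr mulr0.
  have cv : quant J.+1 (f x) - f x @[J --> \oo] --> f x - f x.
    apply: cvgB; last exact: cvg_cst.
    have := @quant_cvg (f x); rewrite -cvg_shiftS; exact.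
  by under eq_fun do rewrite expr2; exact: cvgM.
Qed.

End quantization.

(** * Lattice mollifiers *)

Section lattice_mollifier.
Variables (R : realType) (n H M Bn : nat).
Hypotheses (H0 : (0 < H)%N) (M0 : (0 < M)%N).

(** The spacing is [1 / (H * M)] and the states cover [[-(Bn + 2), Bn + 2]]. Of the margin 2, one
    unit is for the width of the mollifier and one for the jump, so that no mass leaves the lattice
    in one step. *)
Definition mol_half := (H * M * (Bn + 2))%N.
Local Notation K := mol_half.
Definition mol_size := (K + K).+1.
Local Notation L := mol_size.
Definition mol_state := {ffun 'I_n -> 'I_L}.
Local Notation S := mol_state.

Definition mol_off (j : nat) : R := (K%:R - j%:R) / M%:R.
(** A bump of half width [1 / H] centred at the lattice point [(j - K) / (H * M)]. The lattice is
    [M] times finer than the width, and by [smoothbump_partition] the overlapping translates sum to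
    [M], which explains the normalisation. *)
Definition mol1 (j : nat) (t : R) : R := M%:R^-1 * smoothbump (H%:R * t + mol_off j).
Definition mol (y : S) (p : 'rV[R]_n) : R := \prod_i mol1 (y i) (p 0 i).
Definition mol_pos (y : S) (i : 'I_n) : R := ((y i : nat)%:R - K%:R) / (H * M)%:R.
(** The equation is read in [int], so that a displacement beyond the range of indices matches no
    state instead of being truncated. *)
Definition mol_shift (D : 'I_n -> int) (y y' : S) : R :=
  \prod_i ((y' i : nat)%:Z == (y i : nat)%:Z + D i)%:R.

Implicit Types (y : S) (p : 'rV[R]_n) (t : R).

Let H0' : 0 < H%:R :> R. Proof. by rewrite ltr0n. Qed.
Let M0' : 0 < M%:R :> R. Proof. by rewrite ltr0n. Qed.
Let KE : K%:R = H%:R * M%:R * (Bn%:R + 2) :> R.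
Proof. by rewrite /mol_half !natrM natrD. Qed.

Lemma mol1_ge0 j t : 0 <= mol1 j t.
Proof. by rewrite mulr_ge0 ?invr_ge0 ?smoothbump_ge0// ltW. Qed.

Lemma mol_ge0 y p : 0 <= mol y p.
Proof. by apply: prodr_ge0 => i _; exact: mol1_ge0. Qed.

Lemma mol1_sum t : `|t| <= Bn%:R -> \sum_(j < L) mol1 j t = 1.
Proof.
rewrite ler_norml => /andP[t1 t2]; rewrite -mulr_sumr.
have H1 : 1 <= H%:R :> R by rewrite ler1n.
have ML : (M <= L)%N.
  rewrite /L leqW// (leq_trans _ (leq_addr _ _))// /mol_half mulnAC leq_pmull// muln_gt0 H0/=.
  by rewrite addn2.
have -> : \sum_(i < L) smoothbump (H%:R * t + mol_off i) =
   \sum_(k < M + (L - M)) smoothbump (H%:R * t + K%:R / M%:R - (k : nat)%:R / M%:R).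
  rewrite subnKC//; apply: eq_bigr => j _; rewrite /mol_off; congr smoothbump.
  by rewrite mulrBl addrA.
have KM : K%:R / M%:R = H%:R * (Bn%:R + 2) :> R by rewrite KE; field; rewrite gt_eqF.
rewrite smoothbump_partition ?mulVf ?gt_eqF// KM; first nra.
have -> : (L - M)%:R = K%:R + K%:R + 1 - M%:R :> R.
  by rewrite natrB// /mol_size -natr1 natrD.
rewrite ler_pdivlMr// mulrDl.
have -> : H%:R * (Bn%:R + 2) * M%:R = K%:R :> R by rewrite KE; ring.
have e1 : H%:R * t * M%:R <= K%:R - 2 * (H%:R * M%:R).
  rewrite KE; have : 0 <= (H%:R * M%:R) * (Bn%:R - t) by rewrite !mulr_ge0 ?subr_ge0// ltW.
  by lra.
have e2 : M%:R <= H%:R * M%:R :> R by rewrite ler_peMl// ltW.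
have e3 : 0 <= M%:R :> R by [].
lra.
Qed.

Lemma mol_sum (p : 'rV[R]_n) : (forall i, `|p 0 i| <= Bn%:R) -> \sum_y mol y p = 1.
Proof.
move=> hp; rewrite /mol -(bigA_distr_bigA (fun (i : 'I_n) (j : 'I_L) => mol1 j (p 0 i))).
by apply: big1 => i _; exact: mol1_sum.
Qed.

(** The displacement is a multiple of the spacing, so at most the index [j' - D] contributes. If
    this is not an index, the bump on the right vanishes too, because [t] stays away from the ends
    of the lattice. *)
Lemma mol1_shift t (D : int) (j' : 'I_L) : `|t| <= Bn%:R ->
  \sum_(j < L) mol1 j t * ((j' : nat)%:Z == (j : nat)%:Z + D)%:R =
  mol1 j' (t + D%:~R / (H * M)%:R).
Proof.
rewrite ler_norml => /andP[t1 t2].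
pose z := (j' : nat)%:Z - D.
have E : H%:R * (t + D%:~R / (H * M)%:R) + mol_off j' = H%:R * t + (K%:R - z%:~R) / M%:R.
  by rewrite /mol_off /z rmorphB/= -pmulrn natrM; field; rewrite !gt_eqF.
have H1 : 1 <= H%:R :> R by rewrite ler1n.
have KM : K%:R / M%:R = H%:R * (Bn%:R + 2) :> R by rewrite KE; field; rewrite gt_eqF.
have out (w : R) : w <= - 1 \/ w >= K%:R + K%:R + 1 -> smoothbump (H%:R * t + (K%:R - w) / M%:R) = 0.
  move=> hw; apply: smoothbump_out; rewrite in_itv/= negb_and -!ltNge mulrBl KM.
  case: hw => hw; apply/orP; [right|left].
    have w0 : w / M%:R < 0 by rewrite pmulr_llt0 ?invr_gt0//; lra.
    nra.
  have w0 : K%:R / M%:R + K%:R / M%:R < w / M%:R.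
    by rewrite -mulrDl ltr_pM2r ?invr_gt0//; lra.
  rewrite KM in w0; nra.
rewrite {2}/mol1 E.
have [z0|z0] := ltP z 0.
  rewrite out ?mulr0; last first.
    have : (z + 1)%:~R <= 0%:~R :> R by rewrite ler_int lezD1.
    by rewrite intrD => ?; left; lra.
  apply: big1 => j _; case: eqP => [jj|_]; last by rewrite mulr0.
  by exfalso; move: z0; rewrite /z jj addrK.
have [zL|zL] := ltP z L; last first.
  rewrite out ?mulr0; last first.
    right; have : (L%:Z%:~R : R) <= z%:~R by rewrite ler_int.
    by rewrite -pmulrn /mol_size -natr1 natrD.
  apply: big1 => j _; case: eqP => [jj|_]; last by rewrite mulr0.
  by exfalso; move: zL; rewrite /z jj addrK lez_nat leqNgt ltn_ord.
have zE : z = `|z|%N :> int by rewrite gez0_abs.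
have zL' : (`|z| < L)%N by rewrite -ltz_nat -zE.
rewrite (bigD1 (Ordinal zL'))//= big1 ?addr0; last first.
  move=> j /eqP jz; case: eqP => [jj|_]; last by rewrite mulr0.
  by exfalso; apply: jz; apply/val_inj => /=; rewrite /z jj addrK.
have zR : z%:~R = (`|z|%N)%:R :> R by rewrite {1}zE -pmulrn.
have zD : (j' : nat)%:Z == `|z|%N%:Z + D by rewrite -zE /z subrK.
by rewrite zD mulr1 zR.
Qed.

(** Translating the lattice state amounts to translating the point before mollification, with no
    discretisation error. This is what the quantization of the jumps buys. *)
Lemma mol_shift_sum (D : 'I_n -> int) (p : 'rV[R]_n) (y' : S) : (forall i, `|p 0 i| <= Bn%:R) ->
  \sum_y mol y p * mol_shift D y y' = mol y' (p + \row_i ((D i)%:~R / (H * M)%:R)).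
Proof.
move=> hp; rewrite /mol /mol_shift.
transitivity (\sum_(y : S) \prod_i (mol1 (y i) (p 0 i) *
    ((y' i : nat)%:Z == (y i : nat)%:Z + D i)%:R)).
  by apply: eq_bigr => y _; rewrite [RHS]big_split.
rewrite -(bigA_distr_bigA (fun (i : 'I_n) (j : 'I_L) =>
  mol1 j (p 0 i) * ((y' i : nat)%:Z == (j : nat)%:Z + D i)%:R)).
by apply: eq_bigr => i _; rewrite mol1_shift// !mxE.
Qed.

Lemma mol1_supp j t : mol1 j t != 0 -> `|(j%:R - K%:R) / (H * M)%:R - t| <= H%:R^-1.
Proof.
rewrite /mol1 mulf_eq0 negb_or => /andP[_ h].
have : H%:R * t + mol_off j \in `[-1, 1].
  by apply: contraNT h => /smoothbump_out ->.
rewrite in_itv/= -ler_norml => h1.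
rewrite -(ler_pM2l H0') mulfV ?gt_eqF// -[X in X * _](gtr0_norm H0') -normrM -normrN.
apply: le_trans h1; rewrite le_eqVlt; apply/orP; left; apply/eqP; congr `|_|.
by rewrite /mol_off natrM; field; rewrite !gt_eqF.
Qed.

Lemma mol_supp y p i : mol y p != 0 -> `|mol_pos y i - p 0 i| <= H%:R^-1.
Proof.
by rewrite /mol => /prodf_neq0/(_ i isT); exact: mol1_supp.
Qed.

Lemma mol_pos_le y i : `|mol_pos y i| <= Bn%:R + 2.
Proof.
have HM : 0 < (H * M)%:R :> R by rewrite ltr0n muln_gt0 H0.
rewrite /mol_pos normrM normfV (gtr0_norm HM) ler_pdivrMr// mulrC natrM -KE.
have := ltn_ord (y i); rewrite ltnS -(ler_nat R) natrD => h.
by rewrite ler_norml; apply/andP; split; have : 0 <= (y i : nat)%:R :> R by []; lra.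
Qed.

(** A state charged by [mol y p] is within [1 / H <= 1] of [p], which is bounded by [Bn], and the
    jump is at most 1; the target lies within [Bn + 2] and is a state. *)
Lemma mol_shift_row (D : 'I_n -> int) (y : S) (p : 'rV[R]_n) : (forall i, `|p 0 i| <= Bn%:R) ->
  (forall i, `|(D i)%:~R| <= (H * M)%:R :> R) ->
  mol y p * \sum_y' mol_shift D y y' = mol y p.
Proof.
move=> hp hD; have [->|yp] := eqVneq (mol y p) 0; first by rewrite mul0r.
have HM : 0 < (H * M)%:R :> R by rewrite ltr0n muln_gt0 H0.
rewrite /mol_shift -(bigA_distr_bigA (fun (i : 'I_n) (j : 'I_L) =>
  (((j : nat)%:Z == (y i : nat)%:Z + D i)%:R : R))).
rewrite big1 ?mulr1// => i _.
have h1 := mol_supp i yp; have h2 := hp i; have h3 := hD i.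
pose z := (y i : nat)%:Z + D i.
have H1 : H%:R^-1 <= 1 :> R by rewrite invf_le1// ler1n.
have hz : `|z%:~R - K%:R| <= K%:R :> R.
  have -> : z%:~R - K%:R = (mol_pos y i - p 0 i) * (H * M)%:R + p 0 i * (H * M)%:R + (D i)%:~R :> R.
    by rewrite /z /mol_pos intrD -pmulrn natrM; field; rewrite !gt_eqF.
  apply: le_trans (ler_normD _ _) _; apply: le_trans (lerD (ler_normD _ _) h3) _.
  rewrite !normrM (gtr0_norm HM) KE -natrM.
  have e1 : `|mol_pos y i - p 0 i| * (H * M)%:R <= 1 * (H * M)%:R.
    by rewrite ler_wpM2r// ?(ltW HM)// (le_trans h1).
  have e2 : `|p 0 i| * (H * M)%:R <= Bn%:R * (H * M)%:R by rewrite ler_wpM2r// ltW.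
  lra.
move: hz; rewrite ler_norml => /andP[z1 z2].
have z0 : 0 <= z by rewrite -(ler_int R); lra.
have zL : z < L%:Z by rewrite -(ltr_int R) -pmulrn /mol_size -natr1 natrD; lra.
have zE : z = `|z|%N :> int by rewrite gez0_abs.
have zL' : (`|z| < L)%N by rewrite -ltz_nat -zE.
rewrite (bigD1 (Ordinal zL'))//= big1 ?addr0; first by rewrite -zE eqxx.
move=> j /eqP jz; case: eqP => // jj.
by exfalso; apply: jz; apply/val_inj => /=; rewrite -/z in jj; rewrite -jj.
Qed.

Lemma mol_shift_pos (D : 'I_n -> int) (y y' : S) i : mol_shift D y y' != 0 ->
  mol_pos y' i = mol_pos y i + (D i)%:~R / (H * M)%:R.
Proof.
move=> /prodf_neq0/(_ i isT); rewrite pnatr_eq0 eqb0 negbK => /eqP h.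
have e : ((y' i : nat)%:Z)%:~R = ((y i : nat)%:Z + D i)%:~R :> R by rewrite h.
rewrite intrD -!pmulrn in e.
by rewrite /mol_pos -mulrDl e addrAC.
Qed.

Lemma mol_boxf y : mol y = fun p => M%:R^-1 ^+ n * boxf (lattice_bump H%:R (fun i => mol_off (y i))) p.
Proof.
apply/funext => p; rewrite /mol /mol1 big_split/= prodr_const card_ord.
by [].
Qed.

Lemma smooth_mol y : smooth (mol y).
Proof.
rewrite mol_boxf; apply: smoothZ; apply: smooth_boxf => l; exact: smooth1_lattice_bump.
Qed.

Lemma card_mol_state : #|{: S}| = (L ^ n)%N.
Proof. by rewrite card_ffun !card_ord. Qed.

Lemma mol_bounds_of (C0 : R) : 1 <= C0 ->
  (forall m t, (m < 4)%N -> `|derive1n m (@smoothbump R) t| <= C0 * unit_ind t) ->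
  forall y,
  [/\ forall i p, `|partial i (mol y) p| <= M%:R^-1 ^+ n * (H%:R ^+ 3 * C0 ^+ n),
      forall i j p, `|partial i (partial j (mol y)) p| <= M%:R^-1 ^+ n * (H%:R ^+ 3 * C0 ^+ n) &
      forall i j k p, `|partial i (partial j (partial k (mol y))) p| <=
        M%:R^-1 ^+ n * (H%:R ^+ 3 * C0 ^+ n)].
Proof.
move=> C01 hC0.
have H1 : 1 <= H%:R :> R by rewrite ler1n.
have C00 : 0 < C0 by exact: lt_le_trans ltr01 C01.
move=> y; set c := fun i => mol_off (y i).
have Mn : 0 <= M%:R^-1 ^+ n :> R by rewrite exprn_ge0// invr_ge0 ltW.
have sb : smooth (boxf (lattice_bump (H%:R : R) c)).
  by apply: smooth_boxf => l; exact: smooth1_lattice_bump.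
have p1 i : partial i (mol y) = fun p => M%:R^-1 ^+ n * partial i (boxf (lattice_bump H%:R c)) p.
  by apply/funext => p; rewrite mol_boxf partialZ//; exact: smooth_diff.
have p2 i j : partial i (partial j (mol y)) = fun p => M%:R^-1 ^+ n * partial i (partial j (boxf (lattice_bump H%:R c))) p.
  by apply/funext => p; rewrite p1 partialZ//; apply: smooth_diff; exact: smooth_partial.
have p3 i j k : partial i (partial j (partial k (mol y))) = fun p => M%:R^-1 ^+ n * partial i (partial j (partial k (boxf (lattice_bump H%:R c)))) p.
  by apply/funext => p; rewrite p2 partialZ//; apply: smooth_diff; do 2 apply: smooth_partial.
have li p : lattice_ind H%:R c C0 p <= C0 ^+ n.
  rewrite /lattice_ind -[X in _ <= _ ^+ X](card_ord n) -prodr_const.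
  apply: ler_prod => l _; rewrite mulr_ge0 ?unit_ind_ge0 ?(ltW C00)//=.
  by apply: ler_piMr; [exact: ltW|rewrite /unit_ind lern1 leq_b1].
have e m p : (m <= 3)%N -> H%:R ^+ m * lattice_ind H%:R c C0 p <= H%:R ^+ 3 * C0 ^+ n.
  move=> m3; apply: ler_pM; [by rewrite exprn_ge0|exact: lattice_ind_ge0| |exact: li].
  by rewrite ler_weXn2l.
split.
- move=> i p; rewrite p1 normrM (ger0_norm Mn) ler_wpM2l//.
  apply: le_trans (e 1%N p isT); rewrite expr1; exact: partial_lattice_bump_le.
- move=> i j p; rewrite p2 normrM (ger0_norm Mn) ler_wpM2l//.
  apply: le_trans (e 2%N p isT); exact: partial2_lattice_bump_le.
- move=> i j k p; rewrite p3 normrM (ger0_norm Mn) ler_wpM2l//.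
  apply: le_trans (e 3%N p isT); exact: partial3_lattice_bump_le.
Qed.

End lattice_mollifier.

(** The constant depends on [H] and is fixed before [M]. The factor [M^-n] compensates the number of
    states when errors are summed over the lattice. *)
Lemma mol_bounds (R : realType) (n H Bn : nat) : (0 < H)%N -> exists2 C : R, 0 < C &
  forall M, (0 < M)%N -> forall y : mol_state n H M Bn,
  [/\ forall i p, `|partial i (mol y) p| <= M%:R^-1 ^+ n * C,
      forall i j p, `|partial i (partial j (mol y)) p| <= M%:R^-1 ^+ n * C &
      forall i j k p, `|partial i (partial j (partial k (mol y))) p| <= M%:R^-1 ^+ n * C].
Proof.
move=> H0; have [C0 C01 hC0] := @smoothbump_unit_ind R 4.
exists (H%:R ^+ 3 * C0 ^+ n).
  by rewrite mulr_gt0// exprn_gt0 ?ltr0n// (lt_le_trans ltr01).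
move=> M M0; exact: mol_bounds_of.
Qed.

(** * Couplings of finite Markov chains *)

Section finite_couplings.
Variables (R : realFieldType) (S1 S2 : finType).
Implicit Types (m : S1 -> R) (n : S2 -> R) (p : S1 -> S2 -> R).

Definition fcoupling m n p := [/\ forall a b, 0 <= p a b,
  forall a, \sum_b p a b = m a & forall b, \sum_a p a b = n b].

Lemma fcoupling_sum m n p (f : S1 -> R) (g : S2 -> R) : fcoupling m n p ->
  \sum_a \sum_b p a b * (f a + g b) = \sum_a m a * f a + \sum_b n b * g b.
Proof.
move=> [_ p1 p2].
under eq_bigr do under eq_bigr do rewrite mulrDr.
under eq_bigr do rewrite big_split.
rewrite big_split/=; congr (_ + _).
  by apply: eq_bigr => a _; rewrite -mulr_suml p1.
by rewrite exchange_big/=; apply: eq_bigr => b _; rewrite -mulr_suml p2.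
Qed.

(** This is [min 1 (m / m')]; the first branch includes the states with [m' a = 0]. *)
Let ratio (T : finType) (m m' : T -> R) a := if m' a <= m a then 1 else m a / m' a.

Let ratioP (T : finType) (m m' : T -> R) a : 0 <= m a -> 0 <= m' a ->
  [/\ 0 <= ratio m m' a, ratio m m' a <= 1, ratio m m' a * m' a <= m a &
      m' a * (1 - ratio m m' a) <= `|m' a - m a| ].
Proof.
move=> m0 m'0; rewrite /ratio; case: ifPn => [mm|]; first by rewrite subrr mulr0 mul1r.
rewrite -ltNge => mm; have m'1 : 0 < m' a by exact: le_lt_trans mm.
split; first by rewrite divr_ge0.
- by rewrite ler_pdivrMr// mul1r ltW.
- by rewrite divfK// gt_eqF.
- by rewrite mulrBr mulr1 mulrCA divff ?gt_eqF// mulr1 ler_norm.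
Qed.

(** Thinning [p] by the ratios of the marginals brings both marginals below [m] and [n]; the missing
    mass is restored by the normalised product of the deficits [al] and [be]. The mass removed
    equals the mass added, hence the factor 2. *)
Lemma fcoupling_correct m n m' n' p :
  (forall a, 0 <= m a) -> (forall b, 0 <= n b) -> \sum_a m a = 1 -> \sum_b n b = 1 ->
  \sum_a m' a = 1 -> fcoupling m' n' p ->
  exists2 q, fcoupling m n q & \sum_a \sum_b `|q a b - p a b| <=
    2 * (\sum_a `|m' a - m a| + \sum_b `|n' b - n b|).
Proof.
move=> m0 n0 m1 n1 m'1 [p0 p1 p2].
have m'0 a : 0 <= m' a by rewrite -p1; apply: sumr_ge0 => b _.
have n'0 b : 0 <= n' b by rewrite -p2; apply: sumr_ge0 => a _.
pose r1 := ratio m m'; pose r2 := ratio n n'.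
have r1P a := ratioP (m0 a) (m'0 a); have r2P b := ratioP (n0 b) (n'0 b).
pose rho a b := r1 a * r2 b * p a b.
have rho0 a b : 0 <= rho a b.
  by apply: mulr_ge0 => //; apply: mulr_ge0; [have [] := r1P a|have [] := r2P b].
have rhop a b : rho a b <= p a b.
  rewrite -[leRHS]mul1r; apply: ler_wpM2r => //.
  by apply: mulr_ile1; [have [] := r1P a|have [] := r2P b|have [] := r1P a|have [] := r2P b].
pose al a := m a - \sum_b rho a b; pose be b := n b - \sum_a rho a b.
have al0 a : 0 <= al a.
  rewrite subr_ge0; have [_ _ + _] := r1P a; apply: le_trans.
  rewrite -p1 mulr_sumr; apply: ler_sum => b _; rewrite /rho -mulrA.
  apply: ler_wpM2l; first by have [] := r1P a.
  by rewrite ler_piMl//; have [] := r2P b.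
have be0 b : 0 <= be b.
  rewrite subr_ge0; have [_ _ + _] := r2P b; apply: le_trans.
  rewrite -p2 mulr_sumr; apply: ler_sum => a _; rewrite /rho -mulrA.
  rewrite ler_piMl//; last by have [] := r1P a.
  by apply: mulr_ge0 => //; have [] := r2P b.
pose mass := 1 - \sum_a \sum_b rho a b.
have mass1 : \sum_a al a = mass by rewrite sumrB m1.
have mass2 : \sum_b be b = mass by rewrite sumrB n1 exchange_big.
have mass0 : 0 <= mass by rewrite -mass1; apply: sumr_ge0.
(* If [mass] is 0 then the quotient is 0 by convention, but all deficits vanish as well. *)
have alm a : al a * (mass / mass) = al a.
  have [z|nz] := eqVneq mass 0; last by rewrite divff// mulr1.
  have /psumr_eq0P -> // : \sum_a al a = 0 by rewrite mass1.
  by rewrite mul0r.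
have bem b : be b * (mass / mass) = be b.
  have [z|nz] := eqVneq mass 0; last by rewrite divff// mulr1.
  have /psumr_eq0P -> // : \sum_b be b = 0 by rewrite mass2.
  by rewrite mul0r.
exists (fun a b => rho a b + al a * be b / mass).
  split.
  - by move=> a b; rewrite addr_ge0// divr_ge0// mulr_ge0.
  - move=> a; rewrite big_split/= -mulr_suml -mulr_sumr mass2 -mulrA alm.
    by rewrite addrC subrK.
  - move=> b; rewrite big_split/= -mulr_suml -mulr_suml mass1.
    by rewrite (mulrC mass) -mulrA bem addrC subrK.
have massle : mass <= \sum_a `|m' a - m a| + \sum_b `|n' b - n b|.
  have -> : mass = \sum_a \sum_b (p a b - rho a b).
    under eq_bigr do rewrite sumrB.
    by rewrite sumrB; under [X in _ = X - _]eq_bigr do rewrite p1; rewrite m'1.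
  have pf : fcoupling m' n' p by [].
  apply: (@le_trans _ _ (\sum_a \sum_b p a b * ((1 - r1 a) + (1 - r2 b)))).
    apply: ler_sum => a _; apply: ler_sum => b _.
    have [r10 r11 _ _] := r1P a; have [r20 r21 _ _] := r2P b.
    rewrite -[X in X - _]mul1r /rho -mulrBl mulrC; apply: ler_wpM2l => //.
    have : 0 <= (1 - r1 a) * (1 - r2 b) by apply: mulr_ge0; rewrite subr_ge0.
    by rewrite -/(r1 a) -/(r2 b); nra.
  rewrite (fcoupling_sum _ _ pf); apply: lerD; apply: ler_sum => x _.
    by have [] := r1P x.
  by have [] := r2P x.
apply: (@le_trans _ _ (\sum_a \sum_b ((p a b - rho a b) + al a * be b / mass))).
  apply: ler_sum => a _; apply: ler_sum => b _.
  have -> : rho a b + al a * be b / mass - p a b = al a * be b / mass - (p a b - rho a b) by ring.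
  apply: le_trans (ler_normB _ _) _; rewrite addrC !ger0_norm//.
    by rewrite divr_ge0// mulr_ge0.
  by rewrite subr_ge0.
under eq_bigr do rewrite big_split.
rewrite big_split/=.
have -> : \sum_a \sum_b (p a b - rho a b) = mass.
  under eq_bigr do rewrite sumrB.
  by rewrite sumrB; under [X in X - _]eq_bigr do rewrite p1; rewrite m'1.
have -> : \sum_a \sum_b al a * be b / mass = mass.
  under eq_bigr do rewrite -mulr_suml -mulr_sumr mass2 -mulrA alm.
  by rewrite mass1.
by rewrite [leRHS]mulr_natl mulr2n lerD.
Qed.

(* The law of the chain is moved back to the marginals [m], [n] after every step
   of [Q]; [p] is a Cesaro average of the resulting couplings. *)
Lemma fcoupling_almost_stationary m n m' n' (Q : S1 -> S2 -> S1 -> S2 -> R) e :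
  (forall a, 0 <= m a) -> (forall b, 0 <= n b) -> \sum_a m a = 1 -> \sum_b n b = 1 ->
  \sum_a m' a = 1 -> \sum_a `|m' a - m a| + \sum_b `|n' b - n b| <= e ->
  (forall p, fcoupling m n p ->
     fcoupling m' n' (fun a' b' => \sum_a \sum_b p a b * Q a b a' b')) ->
  forall N : nat, (0 < N)%N -> exists2 p, fcoupling m n p &
    forall (F : S1 -> S2 -> R) B, (forall a b, `|F a b| <= B) ->
    `|\sum_a \sum_b p a b * (\sum_a' \sum_b' Q a b a' b' * F a' b' - F a b)| <=
      B * (2 * e + 2 / N%:R).
Proof.
move=> m0 n0 m1 n1 m'1 he hQ.
pose p0 a b := m a * n b.
have hp0 : fcoupling m n p0.
  split; first by move=> a b; exact: mulr_ge0.
  - by move=> a; rewrite -mulr_sumr n1 mulr1.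
  - by move=> b; rewrite -mulr_suml m1 mul1r.
pose dot p (F : S1 -> S2 -> R) := \sum_a \sum_b p a b * F a b.
pose D (F : S1 -> S2 -> R) a b := \sum_a' \sum_b' Q a b a' b' * F a' b' - F a b.
have dotB p F B : fcoupling m n p -> (forall a b, `|F a b| <= B) -> `|dot p F| <= B.
  move=> [q0 q1 _] FB; apply: le_trans (ler_norm_sum _ _ _) _.
  rewrite -[leRHS]mul1r -m1 mulr_suml; apply: ler_sum => a _.
  apply: le_trans (ler_norm_sum _ _ _) _.
  rewrite -q1 mulr_suml; apply: ler_sum => b _.
  by rewrite normrM ger0_norm// ler_wpM2l.
(* [T] is the sum of the couplings before each of the [N] steps and [p] the current one. The drift
   of [F] along [T] telescopes to [dot p F - dot p0 F], up to the correction of the marginals, at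
   most [2 * e * B] per step. *)
have H N : exists p T, [/\ fcoupling m n p,
    fcoupling (fun a => N%:R * m a) (fun b => N%:R * n b) T &
    forall F B, (forall a b, `|F a b| <= B) ->
      `|dot p F - dot p0 F - dot T (D F)| <= N%:R * (2 * e * B)].
  elim: N => [|N [p [T [hp hT IH]]]].
    exists p0, (fun _ _ => 0); split => //.
      by split => *; rewrite ?big1 ?mul0r.
    move=> F B _; rewrite subrr sub0r mul0r normrN /dot big1 ?normr0// => a _.
    by rewrite big1// => b _; rewrite mul0r.
  have := hQ p hp; set p'' := (fun a' b' => _) => hp''.
  have [p' hp' pe] := fcoupling_correct m0 n0 m1 n1 m'1 hp''.
  exists p', (fun a b => T a b + p a b); split => //.
    case: hT => t0 t1 t2; case: hp => q0 q1 q2; split.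
    - by move=> a b; rewrite addr_ge0.
    - by move=> a; rewrite big_split/= t1 q1 -natr1 mulrDl mul1r.
    - by move=> a; rewrite big_split/= t2 q2 -natr1 mulrDl mul1r.
  move=> F B FB; have B0 : 0 <= B.
    have [a _|S10] := pickP S1; last first.
      by move: m1; rewrite big_pred0// => /eqP; rewrite eq_sym oner_eq0.
    have [b _|S20] := pickP S2; last first.
      by move: n1; rewrite big_pred0// => /eqP; rewrite eq_sym oner_eq0.
    exact: le_trans (FB a b).
  have eT : dot (fun a b => T a b + p a b) (D F) = dot T (D F) + dot p (D F).
    rewrite /dot -big_split/=; apply: eq_bigr => a _.
    by rewrite -big_split/=; apply: eq_bigr => b _; rewrite mulrDl.
  have eD : dot p (D F) = dot p'' F - dot p F.
    rewrite /dot -sumrB /D.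
    under eq_bigr do under eq_bigr do rewrite mulrBr.
    under eq_bigr do rewrite sumrB.
    rewrite !sumrB; congr (_ - _).
    transitivity (\sum_a \sum_b \sum_c \sum_d p a b * Q a b c d * F c d).
      apply: eq_bigr => a _; apply: eq_bigr => b _; rewrite mulr_sumr.
      apply: eq_bigr => c _; rewrite mulr_sumr.
      by apply: eq_bigr => d _; rewrite mulrA.
    transitivity (\sum_c \sum_d \sum_a \sum_b p a b * Q a b c d * F c d); last first.
      apply: eq_bigr => c _; apply: eq_bigr => d _; rewrite mulr_suml.
      by apply: eq_bigr => a _; rewrite mulr_suml.
    under eq_bigr do rewrite exchange_big/=.
    rewrite exchange_big/=; apply: eq_bigr => c _.
    under eq_bigr do rewrite exchange_big/=.
    by rewrite exchange_big.
  have h1 : `|dot p' F - dot p'' F| <= 2 * e * B.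
    rewrite /dot -sumrB; apply: le_trans (ler_norm_sum _ _ _) _.
    apply: (@le_trans _ _ (\sum_a \sum_b `|p' a b - p'' a b| * B)); last first.
      under eq_bigr do rewrite -mulr_suml.
      rewrite -mulr_suml; apply: ler_wpM2r => //; apply: (le_trans pe).
      by apply: ler_wpM2l.
    apply: ler_sum => a _; rewrite -sumrB; apply: le_trans (ler_norm_sum _ _ _) _.
    apply: ler_sum => b _; rewrite -mulrBl normrM; exact: ler_wpM2l.
  rewrite eT eD.
  have -> : dot p' F - dot p0 F - (dot T (D F) + (dot p'' F - dot p F)) =
    (dot p' F - dot p'' F) + (dot p F - dot p0 F - dot T (D F)) by ring.
  apply: le_trans (ler_normD _ _) _; rewrite -natr1 mulrDl mul1r addrC.
  by apply: lerD => //; exact: IH.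
move=> N N0; have [p [T [hp hT h]]] := H N.
have N0' : 0 < N%:R :> R by rewrite ltr0n.
exists (fun a b => T a b / N%:R).
  case: hT => t0 t1 t2; split.
  - by move=> a b; rewrite divr_ge0.
  - by move=> a; rewrite -mulr_suml t1 mulrC mulKf// gt_eqF.
  - by move=> a; rewrite -mulr_suml t2 mulrC mulKf// gt_eqF.
move=> F B FB; have -> : \sum_a \sum_b T a b / N%:R *
   (\sum_a' \sum_b' Q a b a' b' * F a' b' - F a b) = dot T (D F) / N%:R.
  rewrite /dot mulr_suml; apply: eq_bigr => a _; rewrite mulr_suml.
  by apply: eq_bigr => b _; rewrite mulrAC.
rewrite normrM normfV (ger0_norm (ltW N0')) ler_pdivrMr//.
have -> : dot T (D F) = - (dot p F - dot p0 F - dot T (D F)) + dot p F - dot p0 F by ring.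
apply: le_trans (ler_normB _ _) _.
apply: le_trans (lerD (ler_normD _ _) (lexx _)) _; rewrite normrN.
apply: le_trans (lerD (lerD (h F B FB) (dotB _ _ _ hp FB)) (dotB _ _ _ hp0 FB)) _.
rewrite (_ : B * _ * _ = N%:R * (2 * e * B) + B + B)//.
by field; rewrite gt_eqF.
Qed.

End finite_couplings.

(** * The lattice chain of one diffusion *)

Lemma ball_rowP (R : realType) n (x y : 'rV[R]_n) (e : R) : 0 < e ->
  (ball x e y <-> forall i, `|x 0 i - y 0 i| < e).
Proof.
move=> e0; rewrite -ball_normE/= /ball_/= /Num.Def.normr/= mx_normrE; split.
  by move=> /bigmax_ltP[_ h] i; have := h (0, i) isT; rewrite /= !mxE.
move=> h; apply/bigmax_ltP; split => // -[i j] _ /=; rewrite !mxE (ord1 i); exact: h.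
Qed.

Section measurable_row.
Context d (T : measurableType d) (R : realType) (n : nat) (phi : T -> 'rV[R]_n).
Hypothesis mphi : forall i, measurable_fun setT (fun x => phi x 0 i).

(** An open set is a countable union of cubes with rational centres, and the preimage of a cube is a
    finite intersection of conditions on coordinates. *)
Lemma measurable_preimage_open (O : set 'rV[R]_n) : open O -> measurable (phi @^-1` O).
Proof.
move=> oO.
pose Q := ('rV[rat]_n * nat)%type.
pose inb (qk : Q) := [set y : 'rV[R]_n | forall i, `|ratr (qk.1 0 i) - y 0 i| < (qk.2.+1)%:R^-1].
pose F (qk : Q) := [set x | inb qk `<=` O /\ inb qk (phi x)].
have -> : phi @^-1` O = \bigcup_qk F qk.
  apply/seteqP; split=> [x /= Ox|x [qk _ [/= sub]]]; last exact: sub.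
  have /nbhs_ballP[e /= e0 be] := open_nbhs_nbhs (conj oO Ox).
  have [k ke] : exists k : nat, k.+1%:R^-1 < e / 2.
    have [k _ /(_ _ (leqnn k))] := near_infty_natSinv_lt (PosNum (divr_gt0 e0 (ltr0n _ 2))).
    by exists k.
  have k0 : 0 < k.+1%:R^-1 :> R by rewrite invr_gt0 ltr0n.
  have /choice[q hq] : forall i, exists q : rat, `|ratr q - phi x 0 i| < k.+1%:R^-1 :> R.
    move=> i; have /(@rat_in_itvoo R)[q] : phi x 0 i < phi x 0 i + k.+1%:R^-1 by rewrite ltrDl.
    rewrite in_itv/= => /andP[q1 q2]; exists q.
    by rewrite ger0_norm ?subr_ge0 ?(ltW q1)// ltrBlDl.
  exists (\row_i q i, k) => //; split => /= [y hy|i]; last by rewrite mxE.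
  apply: be; apply/ball_rowP => // i.
  have := hy i; rewrite mxE => h1; have := hq i; rewrite distrC => h2.
  rewrite -(subrKA (ratr (q i))); apply: le_lt_trans (ler_normD _ _) _.
  by rewrite [e]splitr ltrD// (lt_trans _ ke).
apply: countable_bigcupT_measurable => [|qk]; first exact: countableP.
have [sub|nsub] := pselect (inb qk `<=` O); last first.
  by rewrite (_ : F qk = set0)//; apply/seteqP; split => // x [].
rewrite (_ : F qk = \bigcap_(i in [set: 'I_n]) [set x | `|ratr (qk.1 0 i) - phi x 0 i| < (qk.2.+1)%:R^-1]).
  apply: fin_bigcap_measurable => // i _.
  rewrite -[X in measurable X]setTI.
  apply: (@measurable_fun_ltr _ _ _ _ (fun x => `|ratr (qk.1 0 i) - phi x 0 i|) (fun=> (qk.2.+1)%:R^-1)) => //.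
  by apply: measurableT_comp => //; apply: measurable_funB.
apply/seteqP; split => x; first by move=> [_ h] i _; exact: h.
by move=> h; split => // i; exact: h.
Qed.

Lemma measurable_Rd : measurable_fun [set: T] (phi : T -> Rd R n).
Proof.
apply: (@measurability _ _ T (Rd R n) setT phi (@open 'rV[R]_n)); first by [].
move=> _ [U oU <-].
by rewrite setTI; exact: measurable_preimage_open.
Qed.

Lemma measurable_continuous_row (F : 'rV[R]_n -> R) : continuous F ->
  measurable_fun setT (fun x => F (phi x)).
Proof.
move=> cF; apply: (measurability _ (RGenOInfty.measurableE R)) => /= _ [_ [a ->] <-].
rewrite setTI (_ : _ @^-1` _ = phi @^-1` (F @^-1` [set y | a < y])).
  by apply: measurable_preimage_open; apply: open_comp; [move=> x _; exact: cF|exact: open_gt].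
by apply/seteqP; split => x /=; rewrite in_itv/= andbT.
Qed.

End measurable_row.

(** The generator seen through observables: if [b i] is the drift of the [i]-th observable and
    [s i k] its dispersion, [L (F o phi)] is [genop s b F] at [phi]. As in [Lop], there is no factor
    1/2 in front of the second order part. *)
Definition genop (R : realType) n r (s : 'I_n -> 'I_r -> R) (b : 'I_n -> R)
    (F : 'rV[R]_n -> R) (p : 'rV[R]_n) : R :=
  \sum_i \sum_j (\sum_k s i k * s j k) * partial j (partial i F) p +
  \sum_i b i * partial i F p.

(** * One step of the chain and its defect of invariance *)

Section one_marginal.
Context d (T : measurableType d) (R : realType) (mu : probability T R).
Variables (n r : nat) (phi : T -> 'rV[R]_n) (b : 'I_n -> T -> R) (s : 'I_n -> 'I_r -> T -> R).
Variable Bn : nat.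
Hypothesis mphi : forall i, measurable_fun setT (fun x => phi x 0 i).
Hypothesis phi_le : forall x i, `|phi x 0 i| <= Bn%:R.
Hypothesis bL1 : forall i, L1 mu (b i).
Hypothesis ms : forall i k, measurable_fun setT (s i k).
Hypothesis sL2 : forall i k, L1 mu (fun x => s i k x ^+ 2).
Variables (H J E : nat).
Hypotheses (H0 : (0 < H)%N) (J0 : (0 < J)%N) (E0 : (0 < E)%N) (JE : (J <= E)%N).
(** Quantized jumps are multiples of [1 / (J * E)] or [1 / (J * E^2)]; the spacing [1 / (H * M)]
    divides both. The time step is [E^-2] up to the number of jumps. *)
Local Notation M := (J * E ^ 2)%N.

Let M0 : (0 < M)%N. Proof. by rewrite muln_gt0 J0 expn_gt0 E0. Qed.
Let J0' : 0 < J%:R :> R. Proof. by rewrite ltr0n. Qed.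
Let E0' : 0 < E%:R :> R. Proof. by rewrite ltr0n. Qed.
Let H0' : 0 < H%:R :> R. Proof. by rewrite ltr0n. Qed.
Let E1' : 1 <= E%:R :> R. Proof. by rewrite ler1n. Qed.
(* [None] is the drift, [Some (k, sg)] a step along plus or minus the [k]-th
   column of [s]; all jumps are equally likely. *)
Definition jump := option ('I_r * bool).

Local Notation bq i := (fun x => quant J (b i x)).
Local Notation sq i k := (fun x => quant J (s i k x)).

Definition jumpz (w : jump) (x : T) (i : 'I_n) : int :=
  match w with
  | None => zquant J (b i x) * H%:Z
  | Some (k, sg) => (-1) ^+ sg * zquant J (s i k x) * (H * E)%:Z
  end.

Definition jumpr (w : jump) (i : 'I_n) (x : T) : R :=
  match w with
  | None => quant J (b i x) / E%:R ^+ 2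
  | Some (k, sg) => (-1) ^+ sg * quant J (s i k x) / E%:R
  end.

Lemma sum_jump (f : jump -> R) :
  \sum_w f w = f None + \sum_k (f (Some (k, false)) + f (Some (k, true))).
Proof.
rewrite (bigD1 None)//= (reindex_omap Some id)/=; last by case.
rewrite (eq_bigl xpredT); last by move=> p; rewrite eqxx.
congr (_ + _); rewrite (eq_bigr (fun p => f (Some (p.1, p.2)))); last by case.
rewrite -(pair_bigA _ (fun k sg => f (Some (k, sg))))/=; apply: eq_bigr => k _.
by rewrite big_bool addrC.
Qed.

Lemma jumpzE w x i : (jumpz w x i)%:~R / (H * M)%:R = jumpr w i x.
Proof.
rewrite /jumpz /jumpr /quant; case: w => [[k sg]|]; rewrite !intrM -?pmulrn ?rmorphXn/= ?rmorphN1 !natrM.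
  by field; rewrite !gt_eqF.
by field; rewrite !gt_eqF.
Qed.

Lemma jumpr_le_some k sg i x : `|jumpr (Some (k, sg)) i x| <= J%:R / E%:R.
Proof.
have := quant_le (s i k x) J0; rewrite /jumpr; move: (quant J _) => q hq.
by rewrite !normrM normr_sign mul1r normfV (gtr0_norm E0') ler_pM2r ?invr_gt0.
Qed.

Lemma jumpr_le_none i x : `|jumpr None i x| <= J%:R / E%:R ^+ 2.
Proof.
have := quant_le (b i x) J0; rewrite /jumpr; move: (quant J _) => q hq.
by rewrite normrM normfV (gtr0_norm (exprn_gt0 _ E0')) ler_pM2r ?invr_gt0 ?exprn_gt0.
Qed.

(** [J <= E] serves here: every jump stays within the unit margin of the lattice. *)
Lemma jumpr_le w i x : `|jumpr w i x| <= 1.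
Proof.
have JE1 : J%:R / E%:R <= 1 :> R by rewrite ler_pdivrMr// mul1r ler_nat.
case: w => [[k sg]|]; first exact: le_trans (jumpr_le_some _ _ _ _) _.
apply: le_trans (jumpr_le_none _ _) _; apply: le_trans JE1.
by rewrite ler_pM2l// lef_pV2 ?posrE ?exprn_gt0// expr2 ler_peMl// ltW.
Qed.

Lemma measurable_jumpr w i : measurable_fun setT (jumpr w i).
Proof.
case: w => [[k sg]|]; apply: measurable_funM => //; last first.
  by apply: measurable_quant_comp; exact: L1_measurable.
by apply: measurable_funM => //; exact: measurable_quant_comp.
Qed.

Local Notation S := (mol_state n H M Bn).
Local Notation shift := (@mol_shift R n H M Bn).
Local Notation pos := (@mol_pos R n H M Bn).

Implicit Types y : S.

(** [mass] is the lattice law, [mass_shift w] the flow of mass between states under the jump [w],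
    and [mass_jump w] the law after it. Although the jump depends on the point [x] and not only on
    its state, integration over the cell turns it into a transition between states. *)
Definition mass (y : S) := \int[mu]_x mol y (phi x).
Definition mass_shift (w : jump) (y y' : S) :=
  \int[mu]_x (mol y (phi x) * shift (jumpz w x) y y').
Definition mass_jump (w : jump) (y' : S) :=
  \int[mu]_x mol y' (phi x + \row_i jumpr w i x).
Lemma measurable_mol_phi y : measurable_fun setT (fun x => mol y (phi x) : R).
Proof.
rewrite /mol; apply: measurable_prod => i _; rewrite /mol1; apply: measurable_funM => //.
apply: (@measurableT_comp _ _ _ _ _ _ (@smoothbump R)).
  by apply: continuous_measurable_fun; exact: (smooth1_continuous (@smooth1_smoothbump R)).
by apply: measurable_funD => //; apply: measurable_funM.
Qed.

Lemma mol_phi_sum x : \sum_(y : S) mol y (phi x) = 1 :> R.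
Proof. exact: mol_sum. Qed.

Lemma mol_phi_le1 y x : mol y (phi x) <= 1 :> R.
Proof.
rewrite -(mol_phi_sum x) (bigD1 y)//= lerDl; apply: sumr_ge0 => z _; exact: mol_ge0.
Qed.

Lemma mol_phi_norm y x : `|mol y (phi x) : R| <= 1.
Proof. by rewrite ger0_norm ?mol_ge0// mol_phi_le1. Qed.

Lemma L1_mol_phi (f : T -> R) y : L1 mu f -> L1 mu (fun x => mol y (phi x) * f x).
Proof.
move=> hf; under eq_fun do rewrite mulrC.
by apply: (@L1M_bounded _ _ _ _ _ _ 1) => //; [exact: measurable_mol_phi|exact: mol_phi_norm].
Qed.

Lemma L1_mass y : L1 mu (fun x => mol y (phi x)).
Proof. by apply: (@L1_bounded _ _ _ _ _ 1); [exact: measurable_mol_phi|exact: mol_phi_norm]. Qed.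

Lemma mass_ge0 y : 0 <= mass y.
Proof. by apply: Rintegral_ge0 => x _; exact: mol_ge0. Qed.

Lemma Rint_mol_phi_sum (f : T -> R) : L1 mu f ->
  \sum_(y : S) \int[mu]_x (mol y (phi x) * f x) = \int[mu]_x f x.
Proof.
move=> hf; rewrite -Rint_sum; last by move=> y; exact: L1_mol_phi.
by apply: eq_Rintegral => x _; rewrite -mulr_suml mol_phi_sum mul1r.
Qed.

Lemma mass_sum : \sum_y mass y = 1.
Proof.
rewrite -[RHS](Rint_cst mu) -(Rint_mol_phi_sum (L1_cst mu 1)).
by apply: eq_bigr => y _; apply: eq_Rintegral => x _; rewrite mulr1.
Qed.

Lemma mol_shift01 D (y y' : S) : 0 <= shift D y y' <= 1.
Proof.
rewrite /mol_shift; apply/andP; split; first by apply: prodr_ge0 => i _.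
by rewrite prodr_ile1// => i; rewrite ler0n lern1 leq_b1.
Qed.

Lemma measurable_mol_shift w y y' : measurable_fun setT (fun x => shift (jumpz w x) y y' : R).
Proof.
rewrite /mol_shift; apply: measurable_prod => i _.
rewrite (_ : (fun x => _) = fun x => if ((y' i : nat)%:R - (y i : nat)%:R) / (H * M)%:R == jumpr w i x then 1 else 0 : R).
  apply: measurable_fun_ifT => //; apply: measurable_fun_eqr => //.
  exact: measurable_jumpr.
apply/funext => x; rewrite -jumpzE.
have HM : (H * M)%:R != 0 :> R by rewrite pnatr_eq0 muln_eq0 negb_or -!lt0n H0 M0.
rewrite (inj_eq (mulIf (invr_neq0 HM))) subr_eq addrC.
rewrite !pmulrn -intrD eqr_int; by case: eqP.
Qed.

Lemma L1_mass_shift w y y' : L1 mu (fun x => mol y (phi x) * shift (jumpz w x) y y').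
Proof.
apply: L1_mol_phi; apply: (@L1_bounded _ _ _ _ _ 1); first exact: measurable_mol_shift.
by move=> x; have /andP[? ?] := mol_shift01 (jumpz w x) y y'; rewrite ger0_norm.
Qed.

Lemma mass_shift_ge0 w y y' : 0 <= mass_shift w y y'.
Proof.
apply: Rintegral_ge0 => x _; rewrite mulr_ge0 ?mol_ge0//.
by have /andP[] := mol_shift01 (jumpz w x) y y'.
Qed.

Lemma jumpz_le w x i : `|(jumpz w x i)%:~R| <= (H * M)%:R :> R.
Proof.
have HM : 0 < (H * M)%:R :> R by rewrite ltr0n muln_gt0 H0 M0.
have := jumpr_le w i x; rewrite -jumpzE normrM normfV (gtr0_norm HM).
by rewrite ler_pdivrMr// mul1r.
Qed.

Lemma mass_shift_row w y : \sum_y' mass_shift w y y' = mass y.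
Proof.
rewrite -Rint_sum; last by move=> y'; exact: L1_mass_shift.
apply: eq_Rintegral => x _; rewrite -mulr_sumr; apply: mol_shift_row => //.
by move=> i; exact: jumpz_le.
Qed.

Lemma mass_shift_col w y' : \sum_y mass_shift w y y' = mass_jump w y'.
Proof.
rewrite -Rint_sum; last by move=> y; exact: L1_mass_shift.
apply: eq_Rintegral => x _; rewrite mol_shift_sum//; congr mol.
by congr (_ + _); apply/rowP => i; rewrite !mxE jumpzE.
Qed.

(** The conditional expectation of [f] given the state [y], multiplied by the mass of [y]; leaving
    it unnormalised avoids a division on null states. *)
Definition mean (f : T -> R) y := \int[mu]_x (mol y (phi x) * f x).

(** An identity and not an estimate, because the jump is a displacement between lattice points. It
    provides the hypotheses [hd1] and [hd2] of the synchronous chain. *)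
Lemma mass_shift_pos w y i : \sum_y' mass_shift w y y' * pos y' i =
  mass y * pos y i + mean (jumpr w i) y.
Proof.
have L1j : L1 mu (fun x => mol y (phi x) * jumpr w i x).
  apply: L1_mol_phi; apply: (@L1_bounded _ _ _ _ _ 1); first exact: measurable_jumpr.
  by move=> x; exact: jumpr_le.
have L1p : L1 mu (fun x => pos y i * mol y (phi x)) by apply: L1Z; exact: L1_mass.
have -> : mass y * pos y i = \int[mu]_x (pos y i * mol y (phi x)).
  by rewrite RintegralZl//; [rewrite mulrC|exact: L1_mass].
rewrite -RintegralD//.
rewrite (eq_bigr (fun y' => \int[mu]_x (pos y' i * (mol y (phi x) * shift (jumpz w x) y y')))); last first.
  by move=> y' _; rewrite RintegralZl//; [rewrite mulrC|exact: L1_mass_shift].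
rewrite -Rint_sum; last by move=> y'; apply: L1Z; exact: L1_mass_shift.
apply: eq_Rintegral => x _.
transitivity (\sum_(y' : S) mol y (phi x) * (shift (jumpz w x) y y') * (pos y i + jumpr w i x)).
  apply: eq_bigr => y' _; rewrite mulrC.
  have [->|h] := eqVneq (shift (jumpz w x) y y' : R) 0; first by rewrite mulr0 !mul0r.
  by rewrite (mol_shift_pos i h) jumpzE.
rewrite -mulr_suml -mulr_sumr mol_shift_row//; last by move=> j; exact: jumpz_le.
by rewrite mulrDr mulrC.
Qed.

(** The first summand stands for [r] pairs of third order remainders with [norm1] at most
    [n * J / E], the second for the second order remainder of the drift jump, of size at most
    [n * J / E^2]; the powers of [E] are factored out. *)
Definition jump_rem : R := r%:R * (2 * (n%:R * J%:R) ^+ 3) + (n%:R * J%:R) ^+ 2.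

Lemma norm1_le (v : 'rV[R]_n) c : (forall i, `|v 0 i| <= c) -> norm1 v <= n%:R * c.
Proof.
move=> h; rewrite /norm1; apply: (@le_trans _ _ (\sum_(i < n) c)); first exact: ler_sum.
by rewrite sumr_const card_ord mulr_natl.
Qed.

(** Opposite jumps cancel to first order, and their two halves of the quadratic form add up to the
    full one. The drift jump is already of order [E^-2] and contributes its linear part only. *)
Lemma genop_jump (F : 'rV[R]_n -> R) C p x : smooth F ->
  (forall i j z, `|partial i (partial j F) z| <= C) ->
  (forall i j k z, `|partial i (partial j (partial k F)) z| <= C) ->
  0 <= C ->
  `|\sum_w (F (p + \row_i jumpr w i x) - F p) -
    E%:R ^- 2 * genop (fun i k => quant J (s i k x)) (fun i => quant J (b i x)) F p| <=
  E%:R ^- 2 * (C * (jump_rem / E%:R)).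
Proof.
move=> hF h2 h3 C0.
pose v (k : 'I_r) : 'rV[R]_n := \row_i jumpr (Some (k, false)) i x.
pose u : 'rV[R]_n := \row_i jumpr None i x.
have vN k : \row_i jumpr (Some (k, true)) i x = - v k.
  by apply/rowP => i; rewrite !mxE /jumpr expr1 expr0 mul1r mulN1r mulNr.
pose Q k := \sum_i v k 0 i * \sum_j v k 0 j * partial j (partial i F) p.
have GE : E%:R ^- 2 * genop (fun i k => quant J (s i k x)) (fun i => quant J (b i x)) F p =
    \sum_k Q k + \sum_i u 0 i * partial i F p.
  rewrite /genop mulrDr; congr (_ + _); last first.
    rewrite mulr_sumr; apply: eq_bigr => i _; rewrite !mxE /=; ring.
  rewrite /Q [RHS]exchange_big/= mulr_sumr; apply: eq_bigr => i _.
  under [RHS]eq_bigr do rewrite mulr_sumr.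
  rewrite [RHS]exchange_big/= mulr_sumr; apply: eq_bigr => j _.
  rewrite mulrA mulr_sumr mulr_suml; apply: eq_bigr => k _.
  by rewrite !mxE /= expr0 !mul1r -exprVn; ring.
pose D (w : 'rV[R]_n) := \sum_i w 0 i * partial i F p.
pose a k := F (v k + p) - F p - D (v k) - 2^-1 * Q k.
pose a' k := F (- v k + p) - F p - D (- v k) - 2^-1 * Q k.
pose a0 := F (u + p) - F p - D u.
have DN w : D (- w) = - D w.
  by rewrite /D -sumrN; apply: eq_bigr => i _; rewrite !mxE mulNr.
rewrite GE sum_jump.
have -> : F (p + \row_i jumpr None i x) - F p +
    \sum_k (F (p + \row_i jumpr (Some (k, false)) i x) - F p +
            (F (p + \row_i jumpr (Some (k, true)) i x) - F p)) -
    (\sum_k Q k + \sum_i u 0 i * partial i F p) = \sum_k (a k + a' k) + a0.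
  rewrite (eq_bigr (fun k => Q k + (a k + a' k))); last first.
    by move=> k _; rewrite vN /a /a' DN ![p + _]addrC -/(v k); field.
  by rewrite big_split/= /a0 -/(D u) [p + _]addrC -/u; ring.
have JE0 : 0 <= J%:R / E%:R :> R by rewrite mulr_ge0// invr_ge0.
have vle k : norm1 (v k) <= n%:R * (J%:R / E%:R).
  by apply: norm1_le => i; rewrite mxE; exact: jumpr_le_some.
have cube c : 0 <= c -> c <= n%:R * (J%:R / E%:R) -> c ^+ 3 * C <= (n%:R * (J%:R / E%:R)) ^+ 3 * C.
  by move=> c0 h; rewrite ler_wpM2r// lerXn2r ?nnegrE// (le_trans c0).
have ha k : `|a k| <= (n%:R * (J%:R / E%:R)) ^+ 3 * C.
  by apply: le_trans (cube _ (norm1_ge0 _) (vle k)); exact: taylor2.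
have ha' k : `|a' k| <= (n%:R * (J%:R / E%:R)) ^+ 3 * C.
  apply: le_trans (cube _ (norm1_ge0 (- v k)) _); last first.
    by apply: norm1_le => i; rewrite !mxE normrN; exact: jumpr_le_some.
  have := taylor2 p (- v k) hF h3; congr (`|_ - 2^-1 * _| <= _).
  apply: eq_bigr => i _; rewrite mxE mulNr -mulrN -sumrN; congr (_ * _).
  by apply: eq_bigr => j _; rewrite mxE mulNr opprK.
have ha0 : `|a0| <= (n%:R * (J%:R / E%:R ^+ 2)) ^+ 2 * C.
  apply: le_trans (taylor1 p u hF h2) _; rewrite ler_wpM2r//.
  rewrite lerXn2r ?nnegrE ?norm1_ge0 ?mulr_ge0 ?invr_ge0//.
  by apply: norm1_le => i; rewrite mxE; exact: jumpr_le_none.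
apply: le_trans (ler_normD _ _) _.
apply: le_trans (lerD _ ha0) _.
  apply: le_trans (ler_norm_sum _ _ _) _.
  apply: ler_sum => k _; apply: le_trans (ler_normD _ _) _; exact: lerD (ha k) (ha' k).
rewrite sumr_const card_ord -[X in X + _]mulr_natl.
have -> : r%:R * ((n%:R * (J%:R / E%:R)) ^+ 3 * C + (n%:R * (J%:R / E%:R)) ^+ 3 * C) +
   (n%:R * (J%:R / E%:R ^+ 2)) ^+ 2 * C =
   E%:R ^- 2 * (C * ((r%:R * (2 * (n%:R * J%:R) ^+ 3) + (n%:R * J%:R) ^+ 2 / E%:R) / E%:R)).
  by field; rewrite gt_eqF.
rewrite ler_wpM2l ?invr_ge0 ?exprn_ge0// ler_wpM2l// ler_wpM2r ?invr_ge0// lerD2l.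
by rewrite ler_pdivrMr// ler_peMr// exprn_ge0// mulr_ge0.
Qed.

Definition defect x := \sum_i \sum_j `|\sum_k (quant J (s i k x) * quant J (s j k x) - s i k x * s j k x)| +
  \sum_i `|quant J (b i x) - b i x|.

Lemma L1_ss i j k : L1 mu (fun x => s i k x * s j k x).
Proof.
apply: (L1_dom (g := fun x => s i k x ^+ 2 + s j k x ^+ 2)); last exact: L1D.
  exact: measurable_funM.
move=> x; rewrite normrM; have := sqr_ge0 (`|s i k x| - `|s j k x|).
rewrite sqrrB !real_normK ?num_real// => h.
have h1 : 0 <= `|s i k x| * `|s j k x| by rewrite mulr_ge0.
lra.
Qed.

Lemma L1_sqsq i j k : L1 mu (fun x => quant J (s i k x) * quant J (s j k x)).
Proof.
apply: (@L1M_bounded _ _ _ _ _ _ J%:R); first exact: L1_quant.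
  exact: measurable_quant_comp.
by move=> x; exact: quant_le.
Qed.

Lemma L1_defect : L1 mu defect.
Proof.
apply: L1D; last first.
  by apply: L1_sum => i; apply: L1_norm; apply: L1B => //; apply: L1_quant; exact: L1_measurable.
apply: L1_sum => i; apply: L1_sum => j; apply: L1_norm; apply: L1_sum => k.
by apply: L1B; [exact: L1_sqsq|exact: L1_ss].
Qed.

Lemma genop_defect (F : 'rV[R]_n -> R) C p x :
  (forall i z, `|partial i F z| <= C) -> (forall i j z, `|partial i (partial j F) z| <= C) ->
  `|genop (fun i k => quant J (s i k x)) (fun i => quant J (b i x)) F p -
    genop (fun i k => s i k x) (fun i => b i x) F p| <= C * defect x.
Proof.
move=> h1 h2; rewrite /genop opprD addrACA -!sumrB /defect mulrDr !mulr_sumr.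
apply: le_trans (ler_normD _ _) _; apply: lerD.
  apply: le_trans (ler_norm_sum _ _ _) _; apply: ler_sum => i _.
  rewrite -sumrB mulr_sumr; apply: le_trans (ler_norm_sum _ _ _) _; apply: ler_sum => j _.
  by rewrite -mulrBl -sumrB normrM mulrC ler_wpM2r.
apply: le_trans (ler_norm_sum _ _ _) _; apply: ler_sum => i _.
by rewrite -mulrBl normrM mulrC ler_wpM2r.
Qed.

Lemma L1_genop (F : 'rV[R]_n -> R) C : smooth F ->
  (forall i z, `|partial i F z| <= C) -> (forall i j z, `|partial i (partial j F) z| <= C) ->
  L1 mu (fun x => genop (fun i k => s i k x) (fun i => b i x) F (phi x)).
Proof.
move=> hF h1 h2; apply: L1D.
  apply: L1_sum => i; apply: L1_sum => j; apply: (@L1M_bounded _ _ _ _ _ _ C) => //.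
    by apply: L1_sum => k; exact: L1_ss.
  apply: measurable_continuous_row => //; apply: smooth_continuous.
  by do 2 apply: smooth_partial.
apply: L1_sum => i; apply: (@L1M_bounded _ _ _ _ _ _ C) => //.
by apply: measurable_continuous_row => //; apply: smooth_continuous; exact: smooth_partial.
Qed.

Hypothesis inv : forall F : 'rV[R]_n -> R, smooth F ->
  \int[mu]_x genop (fun i k => s i k x) (fun i => b i x) F (phi x) = 0.

Lemma L1_mass_jump w y : L1 mu (fun x => mol y (phi x + \row_i jumpr w i x)).
Proof.
rewrite (_ : (fun x => _) = fun x => \sum_(y' : S) mol y' (phi x) * shift (jumpz w x) y' y).
  by apply: L1_sum => y'; exact: L1_mass_shift.
apply/funext => x; rewrite mol_shift_sum//; congr mol.
by congr (_ + _); apply/rowP => i; rewrite !mxE jumpzE.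
Qed.

(** The mollifier [mol y] itself is the test function: by invariance the integral of its generator
    vanishes and may be subtracted. What remains is the Taylor error and the quantization error. *)
Lemma mass_jump_err (C : R) y : 0 <= C ->
  (forall i z, `|partial i (mol y) z| <= C) ->
  (forall i j z, `|partial i (partial j (mol y)) z| <= C) ->
  (forall i j k z, `|partial i (partial j (partial k (mol y))) z| <= C) ->
  `|\sum_w (mass_jump w y - mass y)| <=
    E%:R ^- 2 * (C * (\int[mu]_x defect x + jump_rem / E%:R)).
Proof.
move=> C0 h1 h2 h3; have sm : smooth (@mol R n H M Bn y) by exact: smooth_mol.
pose G x := genop (fun i k => s i k x) (fun i => b i x) (mol y) (phi x).
have LG : L1 mu G by exact: L1_genop h1 h2.
have LD w : L1 mu (fun x => mol y (phi x + \row_i jumpr w i x) - mol y (phi x)).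
  by apply: L1B; [exact: L1_mass_jump|exact: L1_mass].
have -> : \sum_w (mass_jump w y - mass y) =
    \int[mu]_x (\sum_w (mol y (phi x + \row_i jumpr w i x) - mol y (phi x)) - E%:R ^- 2 * G x).
  rewrite RintegralB//; [|exact: L1_sum|exact: L1Z].
  rewrite RintegralZl// inv// mulr0 subr0 Rint_sum//; apply: eq_bigr => w _.
  by rewrite RintegralB//; [exact: L1_mass_jump|exact: L1_mass].
have Ld := L1_defect.
have -> : E%:R ^- 2 * (C * (\int[mu]_x defect x + jump_rem / E%:R)) =
    \int[mu]_x (E%:R ^- 2 * (C * (defect x + jump_rem / E%:R))).
  rewrite RintegralZl//; last by apply: L1Z; apply: L1D => //; exact: L1_cst.
  rewrite RintegralZl//; last by apply: L1D => //; exact: L1_cst.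
  rewrite [in RHS]RintegralD//; last exact: L1_cst.
  by congr (_ * (_ * (_ + _))); exact/esym/Rint_cst.
apply: Rint_norm_le.
- by apply: L1B; [exact: L1_sum|exact: L1Z].
- by apply: L1Z; apply: L1Z; apply: L1D => //; exact: L1_cst.
move=> x; have t := genop_jump (phi x) x sm h2 h3 C0.
have t' := genop_defect (phi x) x h1 h2.
rewrite -(subrKA (E%:R ^- 2 * genop (fun i k => quant J (s i k x)) (fun i => quant J (b i x)) (mol y) (phi x))).
apply: le_trans (ler_normD _ _) _.
have t2 : `|E%:R ^- 2 * genop (fun i k => quant J (s i k x)) (fun i => quant J (b i x)) (mol y) (phi x) -
    E%:R ^- 2 * G x| <= E%:R ^- 2 * (C * defect x).
  rewrite -mulrBr normrM ger0_norm ?invr_ge0 ?exprn_ge0//.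
  by rewrite ler_wpM2l ?invr_ge0 ?exprn_ge0.
apply: le_trans (lerD t t2) _.
by rewrite le_eqVlt; apply/orP; left; apply/eqP; ring.
Qed.

(** The number of states is at most [M^n] times this constant, since the number of indices per
    coordinate is [2 * H * M * (Bn + 2) + 1]. *)
Definition lattice_const : R := (2 * H%:R * (Bn%:R + 2) + 1) ^+ n.

(** The total variation error of one step. The count of states cancels the [M^-n] of the mollifiers,
    so the bound is [E^-2] times a quantity that is small for fine quantization and large [E],
    however fine the lattice. *)
Lemma mass_jump_total_err (C : R) : 0 <= C -> (forall y : S,
  [/\ forall i p, `|partial i (mol y) p| <= M%:R^-1 ^+ n * C,
      forall i j p, `|partial i (partial j (mol y)) p| <= M%:R^-1 ^+ n * C &
      forall i j k p, `|partial i (partial j (partial k (mol y))) p| <= M%:R^-1 ^+ n * C]) ->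
  \sum_y `|#|{: jump}|%:R^-1 * \sum_w mass_jump w y - mass y| <=
    (#|{: jump}|%:R^-1 * E%:R ^- 2) * (lattice_const * C * (\int[mu]_x defect x + jump_rem / E%:R)).
Proof.
move=> C0 hC.
have W0 : 0 < #|{: jump}|%:R :> R by rewrite ltr0n; apply/card_gt0P; exists None.
have M0' : 0 < M%:R :> R by rewrite ltr0n.
have D0 : 0 <= \int[mu]_x defect x + jump_rem / E%:R.
  rewrite addr_ge0//; last by rewrite divr_ge0// /jump_rem addr_ge0// ?mulr_ge0// ?exprn_ge0 ?mulr_ge0.
  apply: Rintegral_ge0 => x _; rewrite /defect addr_ge0 ?sumr_ge0// => i _.
  by rewrite sumr_ge0.
pose c := #|{: jump}|%:R^-1 * (E%:R ^- 2 * (M%:R^-1 ^+ n * C * (\int[mu]_x defect x + jump_rem / E%:R))).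
apply: (@le_trans _ _ (\sum_(y : S) c)).
  apply: ler_sum => y _.
  have -> : #|{: jump}|%:R^-1 * \sum_w mass_jump w y - mass y =
      #|{: jump}|%:R^-1 * \sum_w (mass_jump w y - mass y).
    rewrite sumrB mulrBr; congr (_ - _); rewrite sumr_const; move: (mass y) => u.
    by rewrite -[u *+ _]mulr_natl mulKf// gt_eqF.
  rewrite normrM gtr0_norm ?invr_gt0// /c ler_pM2l ?invr_gt0//.
  have [h1 h2 h3] := hC y; apply: mass_jump_err => //.
  by rewrite mulr_ge0// exprn_ge0// invr_ge0 ltW.
rewrite sumr_const card_mol_state -[c *+ _]mulr_natl.
have -> : (#|{: jump}|%:R^-1 * E%:R ^- 2) * (lattice_const * C * (\int[mu]_x defect x + jump_rem / E%:R)) =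
  (M%:R ^+ n * lattice_const) * c.
  by rewrite /c exprVn; field; rewrite !gt_eqF// exprn_gt0.
apply: ler_wpM2r.
  by rewrite /c !mulr_ge0// ?invr_ge0 ?exprn_ge0 ?ler0n ?invr_ge0.
rewrite natrX /lattice_const -exprMn; apply: lerXn2r; rewrite ?nnegrE ?ler0n//.
rewrite /mol_size -natr1 natrD /mol_half natrM natrM natrD.
have : 1 <= M%:R :> R by rewrite ler1n.
move: (M%:R : R) (H%:R : R) (Bn%:R : R) => a c' e h; rewrite -subr_ge0.
rewrite (_ : _ - _ = a - 1) ?subr_ge0//; ring.
Qed.

End one_marginal.

(** * Almost stationary couplings of two diffusions *)

Section finite_chain.
Variables (R : realType) (A B W : finType).
Variables (m : A -> R) (n : B -> R) (p : A -> B -> R).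
Hypothesis m0 : forall a, 0 <= m a.
Hypothesis n0 : forall b, 0 <= n b.

Lemma fcoupling_eq0 a b : fcoupling m n p -> (m a == 0) || (n b == 0) -> p a b = 0.
Proof.
move=> [p0 p1 p2] /orP[/eqP h|/eqP h].
  by move: (p1 a); rewrite h => /psumr_eq0P; apply.
by move: (p2 b); rewrite h => /psumr_eq0P; apply.
Qed.

(* The value 1 on the null set makes [kappa_row] and [kappa_col] hold for all
   indices, hence the marginals of [mixture] exact. *)
Definition kappa a b : R := if (m a == 0) || (n b == 0) then 1 else p a b / (m a * n b).

Hypothesis hp : fcoupling m n p.

Lemma kappa_ge0 a b : 0 <= kappa a b.
Proof.
rewrite /kappa; case: ifP => // _; have [p0 _ _] := hp.
by rewrite divr_ge0 ?mulr_ge0.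
Qed.

Lemma kappaE a b : kappa a b * (m a * n b) = p a b.
Proof.
rewrite /kappa; case: ifP => [h|/negbT].
  by rewrite (fcoupling_eq0 hp h) mul1r; apply/eqP; rewrite mulf_eq0.
by rewrite negb_or => /andP[? ?]; rewrite mulfVK// mulf_neq0.
Qed.

Lemma kappa_row a : \sum_b n b = 1 -> \sum_b kappa a b * n b = 1.
Proof.
move=> n1; have [ma|ma] := eqVneq (m a) 0.
  by rewrite -[RHS]n1; apply: eq_bigr => b _; rewrite /kappa ma eqxx mul1r.
have [_ p1 _] := hp; apply: (mulfI ma); rewrite mulr1 -[RHS]p1 mulr_sumr.
by apply: eq_bigr => b _; rewrite -kappaE mulrCA.
Qed.

Lemma kappa_col b : \sum_a m a = 1 -> \sum_a kappa a b * m a = 1.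
Proof.
move=> m1; have [nb|nb] := eqVneq (n b) 0.
  by rewrite -[RHS]m1; apply: eq_bigr => a _; rewrite /kappa nb eqxx orbT mul1r.
have [_ _ p2] := hp; apply: (mulfI nb); rewrite mulr1 -[RHS]p2 mulr_sumr.
by apply: eq_bigr => a _; rewrite -kappaE; ring.
Qed.

Variables (sh1 : W -> A -> A -> R) (sh2 : W -> B -> B -> R).
Hypothesis sh1_0 : forall w a a', 0 <= sh1 w a a'.
Hypothesis sh2_0 : forall w b b', 0 <= sh2 w b b'.
Hypothesis row1 : forall w a, \sum_a' sh1 w a a' = m a.
Hypothesis row2 : forall w b, \sum_b' sh2 w b b' = n b.

(** The same uniformly drawn [w] moves both components. Rows of null states vanish since the inverse
    of 0 is 0; this does no harm, as [p] does not charge them. *)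
Definition synchronous a b a' b' : R :=
  #|W|%:R^-1 * \sum_w ((m a)^-1 * sh1 w a a') * ((n b)^-1 * sh2 w b b').

Lemma synchronous_ge0 a b a' b' : 0 <= synchronous a b a' b'.
Proof.
rewrite /synchronous mulr_ge0 ?invr_ge0// sumr_ge0// => w _.
by rewrite !mulr_ge0 ?invr_ge0.
Qed.

Lemma kappa_synchronous a b a' b' :
  p a b * synchronous a b a' b' = #|W|%:R^-1 * \sum_w kappa a b * (sh1 w a a' * sh2 w b b').
Proof.
rewrite /synchronous mulrCA; congr (_ * _); rewrite mulr_sumr; apply: eq_bigr => w _.
rewrite -kappaE; have [ma|ma] := eqVneq (m a) 0.
  have := row1 w a; rewrite ma => /psumr_eq0P -> //; ring.
have [nb|nb] := eqVneq (n b) 0.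
  have := row2 w b; rewrite nb => /psumr_eq0P -> //; ring.
by field; rewrite ma nb.
Qed.

Hypothesis W0 : (0 < #|W|)%N.
Hypothesis m1 : \sum_a m a = 1.
Hypothesis n1 : \sum_b n b = 1.

(** Summation over the target of one component returns its mass, and [kappa_row] or [kappa_col]
    removes the dependence on its source. The marginals after the step are therefore the same for
    every coupling [p]. *)
Lemma synchronous_fcoupling : fcoupling (fun a' => #|W|%:R^-1 * \sum_w \sum_a sh1 w a a')
  (fun b' => #|W|%:R^-1 * \sum_w \sum_b sh2 w b b')
  (fun a' b' => \sum_a \sum_b p a b * synchronous a b a' b').
Proof.
have [p0 _ _] := hp; split.
- by move=> a' b'; do 2 apply: sumr_ge0 => ? _; rewrite mulr_ge0// synchronous_ge0.
- move=> a'; rewrite exchange_big/= [in RHS]exchange_big/= mulr_sumr; apply: eq_bigr => a _.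
  rewrite exchange_big/=.
  under eq_bigr do under eq_bigr do rewrite kappa_synchronous.
  under eq_bigr do rewrite -mulr_sumr exchange_big/=.
  rewrite -mulr_sumr; congr (_ * _); rewrite exchange_big/=; apply: eq_bigr => w _.
  under eq_bigr do under eq_bigr do rewrite mulrA.
  under eq_bigr do rewrite -mulr_sumr row2 mulrAC.
  by rewrite -mulr_suml kappa_row// mul1r.
- move=> b'; rewrite exchange_big/=.
  under eq_bigr do rewrite exchange_big/=.
  rewrite exchange_big/= [in RHS]exchange_big/= mulr_sumr; apply: eq_bigr => b _.
  rewrite exchange_big/=.
  under eq_bigr do under eq_bigr do rewrite kappa_synchronous.
  under eq_bigr do rewrite -mulr_sumr exchange_big/=.
  rewrite -mulr_sumr; congr (_ * _); rewrite exchange_big/=; apply: eq_bigr => w _.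
  rewrite exchange_big/= (eq_bigr (fun a => kappa a b * m a * sh2 w b b')).
    by rewrite -mulr_suml kappa_col// mul1r.
  by move=> a _; rewrite -(row1 w a) mulr_sumr mulr_suml; apply: eq_bigr => a' _; rewrite mulrA.
Qed.

Variables (pos1 : A -> R) (pos2 : B -> R) (d1 : W -> A -> R) (d2 : W -> B -> R).
Hypothesis hd1 : forall w a, \sum_a' sh1 w a a' * pos1 a' = m a * pos1 a + d1 w a.
Hypothesis hd2 : forall w b, \sum_b' sh2 w b b' * pos2 b' = n b * pos2 b + d2 w b.

(** Given [w], the increments factor, and the drift of the product of positions is read off from
    [(m pos1 + d1)(n pos2 + d2)]. The product [d1 w a * d2 w b] with a common [w] is the source of
    the cross term of the doubled operator. *)
Lemma synchronous_drift :
  \sum_a \sum_b p a b * (\sum_a' \sum_b' synchronous a b a' b' * (pos1 a' * pos2 b') - pos1 a * pos2 b) =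
  #|W|%:R^-1 * \sum_a \sum_b kappa a b * \sum_w (d1 w a * (n b * pos2 b) + m a * pos1 a * d2 w b + d1 w a * d2 w b).
Proof.
rewrite mulr_sumr; apply: eq_bigr => a _; rewrite mulr_sumr; apply: eq_bigr => b _.
rewrite mulrBr -kappaE.
have W0' : #|W|%:R != 0 :> R by rewrite pnatr_eq0 -lt0n.
have -> : kappa a b * (m a * n b) * (\sum_a' \sum_b' synchronous a b a' b' * (pos1 a' * pos2 b')) =
   #|W|%:R^-1 * \sum_w kappa a b * ((m a * pos1 a + d1 w a) * (n b * pos2 b + d2 w b)).
  rewrite kappaE mulr_sumr.
  under eq_bigr do rewrite mulr_sumr.
  under eq_bigr do under eq_bigr do rewrite mulrA kappa_synchronous -mulrA mulr_suml.
  under eq_bigr do rewrite -mulr_sumr.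
  rewrite -[LHS]mulr_sumr; congr (_ * _).
  under eq_bigr do rewrite exchange_big/=.
  rewrite exchange_big/=; apply: eq_bigr => w _.
  rewrite -hd1 -hd2 mulr_suml mulr_sumr; apply: eq_bigr => a' _.
  rewrite !mulr_sumr; apply: eq_bigr => b' _; ring.
have -> : kappa a b * (m a * n b) * (pos1 a * pos2 b) =
  #|W|%:R^-1 * \sum_(w : W) kappa a b * ((m a * pos1 a) * (n b * pos2 b)).
  by rewrite sumr_const -[_ *+ #|_|]mulr_natl mulKf//; ring.
rewrite -mulrBr; congr (_ * _); rewrite -sumrB mulr_sumr; apply: eq_bigr => w _; ring.
Qed.

End finite_chain.

(** * Densities of couplings *)

Section coupling_density.
Context d1 d2 (T1 : measurableType d1) (T2 : measurableType d2) (R : realType).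
Variables (mu : probability T1 R) (nu : probability T2 R).

(* [w] is the density, with respect to [P], of a coupling of [mu] and [nu]. *)
Record coupling_density (P : probability (T1 * T2)%type R) (w : T1 * T2 -> R) : Prop :=
  CouplingDensity {
  cdensity_measurable : measurable_fun setT w;
  cdensity_ge0 : forall z, 0 <= w z;
  cdensity1 : forall f, L1 mu f ->
    L1 P (fun z => f z.1 * w z) /\ \int[P]_z (f z.1 * w z) = \int[mu]_x f x;
  cdensity2 : forall g, L1 nu g ->
    L1 P (fun z => g z.2 * w z) /\ \int[P]_z (g z.2 * w z) = \int[nu]_y g y }.

Variables (P : probability (T1 * T2)%type R) (w : T1 * T2 -> R).
Hypothesis cw : coupling_density P w.

(** A majorant that separates the variables is integrated by the marginals, with a result that does
    not depend on the coupling. *)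
Lemma cdensity_le (f : T1 * T2 -> R) a c : measurable_fun setT f -> L1 mu a -> L1 nu c ->
  (forall z, `|f z| <= a z.1 + c z.2) ->
  L1 P (fun z => f z * w z) /\
  `|\int[P]_z (f z * w z)| <= \int[mu]_x a x + \int[nu]_y c y.
Proof.
move=> mf ha hc fac; have [La Ia] := cdensity1 cw ha; have [Lc Ic] := cdensity2 cw hc.
have bound z : `|f z * w z| <= a z.1 * w z + c z.2 * w z.
  by rewrite normrM (ger0_norm (cdensity_ge0 cw z)) -mulrDl ler_wpM2r ?(cdensity_ge0 cw).
have Lf : L1 P (fun z => f z * w z).
  apply: (L1_dom _ bound); last exact: L1D.
  by apply: measurable_funM => //; exact: cdensity_measurable cw.
split => //; rewrite -Ia -Ic -RintegralD//.
by apply: Rint_norm_le => //; exact: L1D.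
Qed.

End coupling_density.

Section mixture.
Context d1 d2 (T1 : measurableType d1) (T2 : measurableType d2) (R : realType).
Variables (mu : probability T1 R) (nu : probability T2 R) (A B : finType).
Variables (u : A -> T1 -> R) (v : B -> T2 -> R).
Hypothesis mu_ : forall a, measurable_fun setT (u a).
Hypothesis mv_ : forall b, measurable_fun setT (v b).
Hypothesis u0 : forall a x, 0 <= u a x.
Hypothesis v0 : forall b y, 0 <= v b y.
Hypothesis u1 : forall x, \sum_a u a x = 1.
Hypothesis v1 : forall y, \sum_b v b y = 1.
Variable p : A -> B -> R.
Local Notation m := (fun a => \int[mu]_x u a x).
Local Notation n := (fun b => \int[nu]_y v b y).
Hypothesis hp : fcoupling m n p.
Local Notation P := (mu \x nu)%E.

(** The coupling that draws a pair of states from [p] and then, independently, points from the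
    normalised laws [u a mu] and [v b nu]. Independence within a pair makes integrals of tensor
    products factor into products of means. *)
Definition mixture (z : T1 * T2) := \sum_a \sum_b kappa m n p a b * (u a z.1 * v b z.2).

Let L1u a : L1 mu (u a).
Proof.
apply: (@L1_bounded _ _ _ _ _ 1) => // x; rewrite ger0_norm// -(u1 x) (bigD1 a)//= lerDl.
by rewrite sumr_ge0.
Qed.

Let L1v b : L1 nu (v b).
Proof.
apply: (@L1_bounded _ _ _ _ _ 1) => // y; rewrite ger0_norm// -(v1 y) (bigD1 b)//= lerDl.
by rewrite sumr_ge0.
Qed.

Let L1fu f a : L1 mu f -> L1 mu (fun x => u a x * f x).
Proof.
move=> hf; under eq_fun do rewrite mulrC.
apply: (@L1M_bounded _ _ _ _ _ _ 1) => // x; rewrite ger0_norm// -(u1 x) (bigD1 a)//= lerDl.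
by rewrite sumr_ge0.
Qed.

Let L1gv g b : L1 nu g -> L1 nu (fun y => v b y * g y).
Proof.
move=> hg; under eq_fun do rewrite mulrC.
apply: (@L1M_bounded _ _ _ _ _ _ 1) => // y; rewrite ger0_norm// -(v1 y) (bigD1 b)//= lerDl.
by rewrite sumr_ge0.
Qed.

Lemma mixture_tensor f g : L1 mu f -> L1 nu g ->
  L1 P (fun z => f z.1 * g z.2 * mixture z) /\
  \int[P]_z (f z.1 * g z.2 * mixture z) =
  \sum_a \sum_b kappa m n p a b * (\int[mu]_x (u a x * f x) * \int[nu]_y (v b y * g y)).
Proof.
move=> hf hg.
pose F a b := fun z : T1 * T2 => kappa m n p a b * ((u a z.1 * f z.1) * (v b z.2 * g z.2)).
have LF a b : L1 P (F a b).
  by apply: L1Z; have [] := Rint_tensor (L1fu a hf) (L1gv b hg).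
have E : (fun z => f z.1 * g z.2 * mixture z) = fun z => \sum_a \sum_b F a b z.
  apply/funext => z; rewrite /mixture mulr_sumr; apply: eq_bigr => a _.
  by rewrite mulr_sumr; apply: eq_bigr => b _; rewrite /F; ring.
rewrite E; split; first by apply: L1_sum => a; exact: L1_sum.
rewrite Rint_sum; last by move=> a; exact: L1_sum.
apply: eq_bigr => a _; rewrite Rint_sum//; apply: eq_bigr => b _.
have [LT IT] := Rint_tensor (L1fu a hf) (L1gv b hg).
by rewrite RintegralZl// IT.
Qed.

Lemma mixture_coupling : coupling_density mu nu P mixture.
Proof.
have sm : \sum_a \int[mu]_x u a x = 1.
  by rewrite -Rint_sum// -[RHS](Rint_cst mu); apply: eq_Rintegral => x _; rewrite u1.
have sn : \sum_b \int[nu]_y v b y = 1.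
  by rewrite -Rint_sum// -[RHS](Rint_cst nu); apply: eq_Rintegral => x _; rewrite v1.
have m0 a : 0 <= \int[mu]_x u a x by apply: Rintegral_ge0 => x _; exact: u0.
have n0 b : 0 <= \int[nu]_y v b y by apply: Rintegral_ge0 => x _; exact: v0.
have mE a : \int[mu]_x (u a x * 1) = \int[mu]_x u a x.
  by apply: eq_Rintegral => x _; rewrite mulr1.
have nE b : \int[nu]_y (v b y * 1) = \int[nu]_y v b y.
  by apply: eq_Rintegral => x _; rewrite mulr1.
split.
- apply: measurable_sum => a; apply: measurable_sum => b.
  apply: measurable_funM => //; apply: measurable_funM.
    by apply: measurableT_comp => //; exact: measurable_fst.
  by apply: measurableT_comp => //; exact: measurable_snd.
- move=> z; do 2 apply: sumr_ge0 => ? _; rewrite mulr_ge0 ?mulr_ge0//.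
  exact: kappa_ge0.
- move=> f hf; have [L I] := mixture_tensor hf (L1_cst nu 1).
  rewrite (_ : (fun z => f z.1 * mixture z) = fun z => f z.1 * 1 * mixture z); last first.
    by apply/funext => z; rewrite mulr1.
  split => //; rewrite I.
  rewrite (eq_bigr (fun a => \int[mu]_x (u a x * f x))).
    rewrite -Rint_sum; last by move=> a; exact: L1fu.
    by apply: eq_Rintegral => x _; rewrite -mulr_suml u1 mul1r.
  move=> a _; rewrite -[RHS]mul1r -[X in _ = X * _](kappa_row hp a sn) mulr_suml.
  apply: eq_bigr => b _; rewrite mulrA [RHS]mulrAC; congr (_ * _); exact: nE.
- move=> g hg; have [L I] := mixture_tensor (L1_cst mu 1) hg.
  rewrite (_ : (fun z => g z.2 * mixture z) = fun z => 1 * g z.2 * mixture z); last first.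
    by apply/funext => z; rewrite mul1r.
  split => //; rewrite I exchange_big/=.
  rewrite (eq_bigr (fun b => \int[nu]_y (v b y * g y))).
    rewrite -Rint_sum; last by move=> b; exact: L1gv.
    by apply: eq_Rintegral => x _; rewrite -mulr_suml v1 mul1r.
  move=> b _; rewrite -[RHS]mul1r -[X in _ = X * _](kappa_col hp b sm) mulr_suml.
  apply: eq_bigr => a _; rewrite mulrA; congr (_ * _ * _); exact: mE.
Qed.

End mixture.

(* A diffusion with bounded observable [phi], seen through its martingale
   problem: [b] and [s] are the drift and the dispersion of [phi], and [mu] is
   infinitesimally invariant for the functions of [phi]. *)
Record martingale_data d (T : measurableType d) (R : realType) (mu : probability T R)
    n r (phi : T -> 'rV[R]_n) (b : 'I_n -> T -> R) (s : 'I_n -> 'I_r -> T -> R) (Bn : nat) : Prop :=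
  MartingaleData {
  mdata_phi : forall i, measurable_fun setT (fun x => phi x 0 i);
  mdata_phi_le : forall x i, `|phi x 0 i| <= Bn%:R;
  mdata_b : forall i, L1 mu (b i);
  mdata_s : forall i k, measurable_fun setT (s i k);
  mdata_s2 : forall i k, L1 mu (fun x => s i k x ^+ 2);
  mdata_inv : forall F : 'rV[R]_n -> R, smooth F ->
    \int[mu]_x genop (fun i k => s i k x) (fun i => b i x) F (phi x) = 0 }.

Section mean_jump.
Context d (T : measurableType d) (R : realType) (mu : probability T R).
Variables (n r : nat) (phi : T -> 'rV[R]_n) (b : 'I_n -> T -> R) (s : 'I_n -> 'I_r -> T -> R).
Variables (Bn H J E : nat).
Hypothesis hd : martingale_data mu phi b s Bn.
Hypotheses (H0 : (0 < H)%N) (J0 : (0 < J)%N) (E0 : (0 < E)%N).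
Local Notation S := (mol_state n H (J * E ^ 2) Bn).

Lemma meanZ c f (y : S) : L1 mu f -> mean mu phi (fun x => c * f x) y = c * mean mu phi f y.
Proof.
move=> hf; rewrite /mean -RintegralZl//; last first.
  by apply: (L1_mol_phi (mdata_phi hd) (mdata_phi_le hd)).
by apply: eq_Rintegral => x _; rewrite mulrCA.
Qed.

Lemma mean_jump_none i (y : S) : mean mu phi (jumpr b s J E None i) y =
  E%:R ^- 2 * mean mu phi (fun x => quant J (b i x)) y.
Proof.
rewrite -meanZ; last by apply: L1_quant; exact: L1_measurable (mdata_b hd i).
by congr (mean _ _ _ y); apply/funext => x; rewrite /jumpr mulrC.
Qed.

Lemma mean_jump_some k sg i (y : S) : mean mu phi (jumpr b s J E (Some (k, sg)) i) y =
  (-1) ^+ sg * E%:R^-1 * mean mu phi (fun x => quant J (s i k x)) y.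
Proof.
rewrite -meanZ; last by apply: L1_quant; exact: (mdata_s hd).
by congr (mean _ _ _ y); apply/funext => x; rewrite /jumpr mulrAC.
Qed.

End mean_jump.

(** * The synchronous chain at fixed scales *)

Section discrete_stage.
Context d1 d2 (T1 : measurableType d1) (T2 : measurableType d2) (R : realType).
Variables (mu : probability T1 R) (nu : probability T2 R) (n r Bn : nat).
Variables (phi1 : T1 -> 'rV[R]_n) (b1 : 'I_n -> T1 -> R) (s1 : 'I_n -> 'I_r -> T1 -> R).
Variables (phi2 : T2 -> 'rV[R]_n) (b2 : 'I_n -> T2 -> R) (s2 : 'I_n -> 'I_r -> T2 -> R).
Hypothesis hd1 : martingale_data mu phi1 b1 s1 Bn.
Hypothesis hd2 : martingale_data nu phi2 b2 s2 Bn.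
Variables (H J E N : nat).
Hypotheses (H0 : (0 < H)%N) (J0 : (0 < J)%N) (E0 : (0 < E)%N) (JE : (J <= E)%N) (N0 : (0 < N)%N).
Local Notation M := (J * E ^ 2)%N.
Local Notation S := (mol_state n H M Bn).
Local Notation pos := (@mol_pos R n H M Bn).
Variable C : R.
Hypothesis C0 : 0 <= C.
Hypothesis hC : forall y : S,
  [/\ forall i p, `|partial i (mol y) p| <= M%:R^-1 ^+ n * C,
      forall i j p, `|partial i (partial j (mol y)) p| <= M%:R^-1 ^+ n * C &
      forall i j k p, `|partial i (partial j (partial k (mol y))) p| <= M%:R^-1 ^+ n * C].

Local Notation m := (fun y : S => mass mu phi1 y).
Local Notation m' := (fun y : S => mass nu phi2 y).
Local Notation W := (#|{: jump r}|%:R : R).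

(** [(Bn + 2)^2] bounds the product of two positions. Dividing the almost stationarity estimate by
    the step weight [W^-1 * E^-2] cancels this factor in the invariance error but multiplies the
    averaging error [2 / N] by [W * E^2]. *)
Definition stage_bound : R := (Bn%:R + 2) ^+ 2 *
  (2 * (lattice_const R n Bn H * C * (\int[mu]_x defect b1 s1 J x + \int[nu]_x defect b2 s2 J x +
     2 * (jump_rem R n r J / E%:R))) + 2 * (W * E%:R ^+ 2) / N%:R).

Lemma discrete_stage : exists2 p : S -> S -> R, fcoupling m m' p &
  forall i j, `|\sum_y \sum_y' kappa m m' p y y' *
    (mean mu phi1 (fun x => quant J (b1 i x)) y * (m' y' * pos y' j) +
     m y * pos y i * mean nu phi2 (fun x => quant J (b2 j x)) y' +
     E%:R ^- 2 * (mean mu phi1 (fun x => quant J (b1 i x)) y * mean nu phi2 (fun x => quant J (b2 j x)) y') +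
     2 * \sum_k mean mu phi1 (fun x => quant J (s1 i k x)) y * mean nu phi2 (fun x => quant J (s2 j k x)) y')|
  <= stage_bound.
Proof.
have [p1 l1 L1 ms1 sL1 i1] := hd1; have [p2 l2 L2 ms2 sL2 i2] := hd2.
have W0 : 0 < W by rewrite ltr0n; apply/card_gt0P; exists None.
have E0' : 0 < E%:R :> R by rewrite ltr0n.
have m0 (y : S) : 0 <= mass mu phi1 y by exact: mass_ge0.
have m'0 (y : S) : 0 <= mass nu phi2 y by exact: mass_ge0.
have sm : \sum_(y : S) mass mu phi1 y = 1 by exact: mass_sum.
have sm' : \sum_(y : S) mass nu phi2 y = 1 by exact: mass_sum.
pose sh1 w (y y' : S) := mass_shift mu phi1 b1 s1 w y y'.
pose sh2 w (y y' : S) := mass_shift nu phi2 b2 s2 w y y'.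
have sh10 w y y' : 0 <= sh1 w y y' by exact: mass_shift_ge0.
have sh20 w y y' : 0 <= sh2 w y y' by exact: mass_shift_ge0.
have row1 w y : \sum_y' sh1 w y y' = mass mu phi1 y by exact: (mass_shift_row p1 l1 L1 ms1).
have row2 w y : \sum_y' sh2 w y y' = mass nu phi2 y by exact: (mass_shift_row p2 l2 L2 ms2).
pose n1 (y' : S) := W^-1 * \sum_w \sum_y sh1 w y y'.
pose n2 (y' : S) := W^-1 * \sum_w \sum_y sh2 w y y'.
have n1E y' : n1 y' = W^-1 * \sum_w mass_jump mu phi1 b1 s1 w y'.
  by congr (_ * _); apply: eq_bigr => w _; exact: (mass_shift_col p1 l1 L1 ms1).
have n2E y' : n2 y' = W^-1 * \sum_w mass_jump nu phi2 b2 s2 w y'.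
  by congr (_ * _); apply: eq_bigr => w _; exact: (mass_shift_col p2 l2 L2 ms2).
have sn1 : \sum_y' n1 y' = 1.
  rewrite -mulr_sumr exchange_big/= (eq_bigr (fun=> 1)) => [|w _]; last first.
    by rewrite exchange_big/= -[RHS]sm; apply: eq_bigr => y _; exact: row1.
  by rewrite sumr_const mulVf// gt_eqF.
pose e := (W^-1 * E%:R ^- 2) * (lattice_const R n Bn H * C *
  (\int[mu]_x defect b1 s1 J x + \int[nu]_x defect b2 s2 J x + 2 * (jump_rem R n r J / E%:R))).
have he : \sum_y `|n1 y - mass mu phi1 y| + \sum_y `|n2 y - mass nu phi2 y| <= e.
  under eq_bigr do rewrite n1E.
  under [X in _ + X]eq_bigr do rewrite n2E.
  have := lerD (mass_jump_total_err p1 l1 L1 ms1 sL1 H0 J0 E0 i1 C0 hC)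
    (mass_jump_total_err p2 l2 L2 ms2 sL2 H0 J0 E0 i2 C0 hC).
  by move=> h; apply: le_trans h _; rewrite le_eqVlt; apply/orP; left; apply/eqP; rewrite /e; ring.
have cardW : (0 < #|{: jump r}|)%N by rewrite -(ltr0n R).
have [p hp hF] := fcoupling_almost_stationary m0 m'0 sm sm' sn1 he
  (fun p hp => synchronous_fcoupling m0 m'0 hp sh10 sh20 row1 row2 sm sm') N0.
exists p => // i j.
have F0 (y y' : S) : `|pos y i * pos y' j| <= (Bn%:R + 2) ^+ 2.
  rewrite normrM expr2; by apply: ler_pM => //; apply: mol_pos_le => //; rewrite muln_gt0 J0 expn_gt0 E0.
have := hF _ _ F0; rewrite (synchronous_drift hp sh10 sh20 row1 row2 cardW
  (d1 := fun w y => mean mu phi1 (jumpr b1 s1 J E w i) y)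
  (d2 := fun w y => mean nu phi2 (jumpr b2 s2 J E w j) y)); last 2 first.
- by move=> w y; exact: (mass_shift_pos p1 l1 L1 ms1).
- by move=> w y; exact: (mass_shift_pos p2 l2 L2 ms2).
set X := \sum_y \sum_y' _; set Y := \sum_y \sum_y' _.
(* The drift jump gives the two drift terms and a product of order [E^-4]. In each pair of opposite
   jumps the terms linear in an increment cancel, while the products of simultaneous increments have
   equal signs and double. *)
have -> : X = E%:R ^- 2 * Y.
  rewrite /Y mulr_sumr; apply: eq_bigr => y _; rewrite mulr_sumr; apply: eq_bigr => y' _.
  rewrite [RHS]mulrCA; congr (_ * _).
  rewrite sum_jump !(mean_jump_none hd1)// !(mean_jump_none hd2)//.
  rewrite [RHS]mulrDr; congr (_ + _); first by ring.
  rewrite mulr_sumr mulr_sumr; apply: eq_bigr => k _.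
  rewrite !(mean_jump_some hd1)// !(mean_jump_some hd2)// expr0 expr1; field.
  by rewrite gt_eqF.
rewrite normrM [`|W^-1|]gtr0_norm ?invr_gt0// normrM [`|E%:R ^- 2|]gtr0_norm ?invr_gt0 ?exprn_gt0//.
rewrite mulrA -invfM ler_pdivrMl ?mulr_gt0 ?exprn_gt0// => h; apply: le_trans h _.
rewrite le_eqVlt; apply/orP; left; apply/eqP; rewrite /stage_bound /e.
have N0' : N%:R != 0 :> R by rewrite pnatr_eq0 -lt0n.
by field; rewrite N0' !gt_eqF.
Qed.

End discrete_stage.

Lemma L1_quant_err2 d (T : measurableType d) (R : realType) (m : probability T R) (f : T -> R) J :
  measurable_fun setT f -> L1 m (fun x => f x ^+ 2) -> (0 < J)%N ->
  L1 m (fun x => (quant J (f x) - f x) ^+ 2).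
Proof.
move=> mf Lf J0; apply: (L1_dom (g := fun x => 2 * f x ^+ 2 + 2)).
- by apply: measurable_funX; apply: measurable_funB => //; exact: measurable_quant_comp.
- move=> x; rewrite ger0_norm ?sqr_ge0// -real_normK ?num_real//.
  have h := quant_err (f x) J0; have h0 := normr_ge0 (quant J (f x) - f x).
  apply: (@le_trans _ _ ((`|f x| + 1) ^+ 2)); first by rewrite lerXn2r ?nnegrE// addr_ge0.
  by have := sqr_ge0 (`|f x| - 1); rewrite !(sqrrB, sqrrD) real_normK ?num_real//; lra.
- by apply: L1D; [exact: L1Z|exact: L1_cst].
Qed.

Section mean_position.
Context d (T : measurableType d) (R : realType) (mu : probability T R).
Variables (n r : nat) (phi : T -> 'rV[R]_n) (b : 'I_n -> T -> R) (s : 'I_n -> 'I_r -> T -> R).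
Variables (Bn H J E : nat).
Hypothesis hd : martingale_data mu phi b s Bn.
Hypotheses (H0 : (0 < H)%N) (J0 : (0 < J)%N) (E0 : (0 < E)%N).
Local Notation M := (J * E ^ 2)%N.
Local Notation S := (mol_state n H M Bn).
Local Notation pos := (@mol_pos R n H M Bn).

Let M0 : (0 < M)%N. Proof. by rewrite muln_gt0 J0 expn_gt0 E0. Qed.
Let mphi := mdata_phi hd.
Let phi_le := mdata_phi_le hd.

Lemma L1_phi i : L1 mu (fun x => phi x 0 i).
Proof. by apply: (@L1_bounded _ _ _ _ _ Bn%:R) => // x; exact: phi_le. Qed.

(** On the support of a mollifier the observable differs from the lattice position by at most the
    half width [1 / H]. *)
Lemma mean_position (y : S) i :
  `|mean mu phi (fun x => phi x 0 i) y - mass mu phi y * pos y i| <= mass mu phi y / H%:R.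
Proof.
have L0 : L1 mu (fun x => mol y (phi x)) by exact: L1_mass.
have Lp : L1 mu (fun x => mol y (phi x) * phi x 0 i).
  by apply: (L1_mol_phi mphi phi_le) => //; exact: L1_phi.
have -> : mean mu phi (fun x => phi x 0 i) y - mass mu phi y * pos y i =
    \int[mu]_x (mol y (phi x) * phi x 0 i - pos y i * mol y (phi x)).
  by rewrite RintegralB//; [rewrite RintegralZl// [in RHS]mulrC|exact: L1Z].
have -> : mass mu phi y / H%:R = \int[mu]_x (H%:R^-1 * mol y (phi x)).
  by rewrite RintegralZl// mulrC.
apply: Rint_norm_le; [by apply: L1B => //; exact: L1Z|exact: L1Z|] => x.
have [->|h] := eqVneq (mol y (phi x) : R) 0; first by rewrite !(mulr0, mul0r) subr0 normr0.
rewrite mulrC -mulrBl normrM (ger0_norm (mol_ge0 _ _)) ler_wpM2r ?mol_ge0//.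
rewrite distrC; exact: mol_supp.
Qed.

Lemma mean_norm f (y : S) : L1 mu f -> `|mean mu phi f y| <= mean mu phi (fun x => `|f x|) y.
Proof.
move=> hf; apply: Rint_norm_le.
- exact: (L1_mol_phi mphi phi_le).
- by apply: (L1_mol_phi mphi phi_le) => //; exact: L1_norm.
- by move=> x; rewrite normrM (ger0_norm (mol_ge0 _ _)).
Qed.

Lemma mean_sum f : L1 mu f -> \sum_(y : S) mean mu phi f y = \int[mu]_x f x.
Proof. by move=> hf; exact: (Rint_mol_phi_sum mphi phi_le). Qed.

Lemma L1_quant_b i : L1 mu (fun x => quant J (b i x)).
Proof. by apply: L1_quant; exact: L1_measurable (mdata_b hd i). Qed.

Lemma Rint_quant_b_le i : \int[mu]_x `|quant J (b i x)| <= \int[mu]_x `|b i x| + 1.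
Proof.
have -> : \int[mu]_x `|b i x| + 1 = \int[mu]_x (`|b i x| + 1).
  rewrite RintegralD//; [|exact: L1_norm (mdata_b hd i)|exact: L1_cst].
  by congr (_ + _); exact/esym/Rint_cst.
apply: le_Rintegral => //.
- exact: L1_norm (L1_quant_b i).
- by apply: L1D; [exact: L1_norm (mdata_b hd i)|exact: L1_cst].
- by move=> x _; exact: quant_dom.
Qed.

Lemma L1_s i k : L1 mu (s i k).
Proof.
apply: (L1_dom (g := fun x => s i k x ^+ 2 + 1)); first exact: (mdata_s hd).
  move=> x; have := sqr_ge0 (`|s i k x| - 1); rewrite sqrrB real_normK ?num_real//.
  by have := normr_ge0 (s i k x); lra.
by apply: L1D; [exact: (mdata_s2 hd)|exact: L1_cst].
Qed.

Lemma L1_sq_err i k : L1 mu (fun x => (quant J (s i k x) - s i k x) ^+ 2).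
Proof. exact: L1_quant_err2 (mdata_s hd i k) (mdata_s2 hd i k) J0. Qed.

End mean_position.

Lemma normM_amgm (R : realType) (t a b : R) : 0 < t ->
  `|a * b| <= 2^-1 * (t^-1 * a ^+ 2) + 2^-1 * (t * b ^+ 2).
Proof.
move=> t0; rewrite normrM; have := sqr_ge0 (`|a| - t * `|b|).
rewrite sqrrB exprMn !real_normK ?num_real// => h.
rewrite -(ler_pM2l t0) !mulrDr.
have -> : t * (2^-1 * (t^-1 * a ^+ 2)) = 2^-1 * a ^+ 2 by field; rewrite gt_eqF.
lra.
Qed.

(** The weighted inequality between arithmetic and geometric means separates the variables, as
    [cdensity_le] requires. The terms with weight [t] are made small by the choice of [t], those
    with [1 / t] afterwards by fine quantization. *)
Lemma quant_prod_le (R : realType) (t : R) J (u u' : R) : 0 < t -> (0 < J)%N ->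
  `|u * u' - quant J u * quant J u'| <=
  2^-1 * (t^-1 * (quant J u - u) ^+ 2) + t * (u ^+ 2 + 1) +
  (2^-1 * (t^-1 * (quant J u' - u') ^+ 2) + t * u' ^+ 2).
Proof.
move=> t0 J0; have := quant_dom u J0; move: (quant J u) (quant J u') => q q' qu.
rewrite (_ : u * u' - q * q' = - ((q - u) * u' + (q' - u') * q)); last by ring.
rewrite normrN; apply: le_trans (ler_normD _ _) _.
apply: le_trans (lerD (normM_amgm _ _ t0) (normM_amgm _ _ t0)) _.
have q2 : q ^+ 2 <= 2 * u ^+ 2 + 2.
  rewrite -[q ^+ 2]real_normK ?num_real//.
  apply: (@le_trans _ _ ((`|u| + 1) ^+ 2)); first by rewrite lerXn2r ?nnegrE// addr_ge0.
  by have := sqr_ge0 (`|u| - 1); rewrite !(sqrrB, sqrrD) real_normK ?num_real//; lra.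
have h1 : t * q ^+ 2 <= t * (2 * u ^+ 2 + 2) by rewrite ler_pM2l.
have h2 : 0 <= t * u' ^+ 2 by rewrite mulr_ge0 ?sqr_ge0// ltW.
move: (t^-1 * _) (t^-1 * _) => A B; lra.
Qed.

(** * From lattice means back to integrals *)

Section stage.
Context d1 d2 (T1 : measurableType d1) (T2 : measurableType d2) (R : realType).
Variables (mu : probability T1 R) (nu : probability T2 R) (n r Bn : nat).
Variables (phi1 : T1 -> 'rV[R]_n) (b1 : 'I_n -> T1 -> R) (s1 : 'I_n -> 'I_r -> T1 -> R).
Variables (phi2 : T2 -> 'rV[R]_n) (b2 : 'I_n -> T2 -> R) (s2 : 'I_n -> 'I_r -> T2 -> R).
Hypothesis hd1 : martingale_data mu phi1 b1 s1 Bn.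
Hypothesis hd2 : martingale_data nu phi2 b2 s2 Bn.

Section fixed_scale.
Variables (H J E : nat).
Hypotheses (H0 : (0 < H)%N) (J0 : (0 < J)%N) (E0 : (0 < E)%N).
Local Notation M := (J * E ^ 2)%N.
Local Notation S := (mol_state n H M Bn).
Local Notation pos := (@mol_pos R n H M Bn).
Local Notation m := (fun y : S => mass mu phi1 y).
Local Notation m' := (fun y : S => mass nu phi2 y).
Variable p : S -> S -> R.
Hypothesis hp : fcoupling m m' p.

Definition stage_density : T1 * T2 -> R :=
  mixture mu nu (fun (y : S) x => mol y (phi1 x)) (fun (y : S) x => mol y (phi2 x)) p.
Local Notation w := stage_density.
Local Notation P := (mu \x nu)%E.

Let M0 : (0 < M)%N. Proof. by rewrite muln_gt0 J0 expn_gt0 E0. Qed.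

Lemma stage_tensor f g : L1 mu f -> L1 nu g ->
  L1 P (fun z => f z.1 * g z.2 * w z) /\
  \int[P]_z (f z.1 * g z.2 * w z) =
  \sum_y \sum_y' kappa m m' p y y' * (mean mu phi1 f y * mean nu phi2 g y').
Proof.
move=> hf hg; apply: mixture_tensor => //.
- by move=> y; exact: (measurable_mol_phi (mdata_phi hd1)).
- by move=> y; exact: (measurable_mol_phi (mdata_phi hd2)).
- by move=> y x; exact: mol_ge0.
- by move=> y x; exact: mol_ge0.
- by move=> x; apply: mol_sum => // i; exact: (mdata_phi_le hd1).
- by move=> x; apply: mol_sum => // i; exact: (mdata_phi_le hd2).
Qed.

Lemma stage_coupling : coupling_density mu nu P w.
Proof.
apply: mixture_coupling => //.
- by move=> y; exact: (measurable_mol_phi (mdata_phi hd1)).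
- by move=> y; exact: (measurable_mol_phi (mdata_phi hd2)).
- by move=> y x; exact: mol_ge0.
- by move=> y x; exact: mol_ge0.
- by move=> x; apply: mol_sum => // i; exact: (mdata_phi_le hd1).
- by move=> x; apply: mol_sum => // i; exact: (mdata_phi_le hd2).
Qed.

Local Notation kap y y' := (kappa m m' p y y').

Let p0 : forall y y', 0 <= kap y y'.
Proof. by move=> y y'; apply: kappa_ge0 => // z; exact: mass_ge0. Qed.

Let sm : \sum_(y : S) mass mu phi1 y = 1.
Proof. exact: (mass_sum mu (mdata_phi hd1) (mdata_phi_le hd1)). Qed.

Let sm' : \sum_(y : S) mass nu phi2 y = 1.
Proof. exact: (mass_sum nu (mdata_phi hd2) (mdata_phi_le hd2)). Qed.

Lemma kappa_mean1 (f : S -> R) :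
  \sum_y \sum_y' kap y y' * (f y * m' y') = \sum_y f y.
Proof.
apply: eq_bigr => y _; rewrite -[RHS]mul1r -(kappa_row hp y sm') mulr_suml.
by apply: eq_bigr => y' _; ring.
Qed.

Lemma kappa_mean2 (g : S -> R) :
  \sum_y \sum_y' kap y y' * (m y * g y') = \sum_y' g y'.
Proof.
rewrite exchange_big/=; apply: eq_bigr => y' _.
rewrite -[RHS]mul1r -(kappa_col hp y' sm) mulr_suml.
by apply: eq_bigr => y _; ring.
Qed.

Lemma kappa_norm_le (f g : S -> S -> R) : (forall y y', `|f y y'| <= g y y') ->
  `|\sum_y \sum_y' kap y y' * f y y'| <= \sum_y \sum_y' kap y y' * g y y'.
Proof.
move=> fg; apply: le_trans (ler_norm_sum _ _ _) _; apply: ler_sum => y _.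
apply: le_trans (ler_norm_sum _ _ _) _; apply: ler_sum => y' _.
by rewrite normrM (ger0_norm (p0 _ _)) ler_wpM2l.
Qed.

(** Under the mixture the integral is a [kappa] combination of products of means, where
    [mean_position] trades the observable for the lattice position. *)
Lemma drift_err1 f j : L1 mu f ->
  `|\int[P]_z (f z.1 * phi2 z.2 0 j * w z) -
    \sum_y \sum_y' kap y y' * (mean mu phi1 f y * (m' y' * pos y' j))| <=
  H%:R^-1 * \int[mu]_x `|f x|.
Proof.
move=> hf; have [_ ->] := stage_tensor hf (L1_phi hd2 j).
have -> : H%:R^-1 * \int[mu]_x `|f x| =
    \sum_y \sum_y' kap y y' * (H%:R^-1 * mean mu phi1 (fun x => `|f x|) y * m' y').
  rewrite kappa_mean1 -mulr_sumr (mean_sum hd1)//; exact: L1_norm.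
rewrite -sumrB; under eq_bigr do rewrite -sumrB.
under eq_bigr do under eq_bigr do rewrite -mulrBr -mulrBr.
apply: kappa_norm_le => y y'; rewrite normrM.
rewrite (_ : _ * _ * _ = mean mu phi1 (fun x => `|f x|) y * (m' y' / H%:R)); last by ring.
apply: ler_pM => //; [exact: (mean_norm hd1)|exact: (mean_position hd2)].
Qed.

Lemma drift_err2 g i : L1 nu g ->
  `|\int[P]_z (phi1 z.1 0 i * g z.2 * w z) -
    \sum_y \sum_y' kap y y' * (m y * pos y i * mean nu phi2 g y')| <=
  H%:R^-1 * \int[nu]_x `|g x|.
Proof.
move=> hg; have [_ ->] := stage_tensor (L1_phi hd1 i) hg.
have -> : H%:R^-1 * \int[nu]_x `|g x| =
    \sum_y \sum_y' kap y y' * (m y * (H%:R^-1 * mean nu phi2 (fun x => `|g x|) y')).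
  rewrite kappa_mean2 -mulr_sumr (mean_sum hd2)//; exact: L1_norm.
rewrite -sumrB; under eq_bigr do rewrite -sumrB.
under eq_bigr do under eq_bigr do rewrite -mulrBr -mulrBl.
apply: kappa_norm_le => y y'; rewrite normrM [leRHS]mulrA.
apply: ler_pM => //; [exact: (mean_position hd1)|exact: (mean_norm hd2)].
Qed.

Lemma measurable_tensor (f : T1 -> R) (g : T2 -> R) : measurable_fun setT f -> measurable_fun setT g ->
  measurable_fun setT (fun z : T1 * T2 => f z.1 * g z.2).
Proof.
move=> mf mg; apply: measurable_funM.
  by apply: (measurableT_comp mf); exact: measurable_fst.
by apply: (measurableT_comp mg); exact: measurable_snd.
Qed.

Lemma stage_diff f f' g g' a c : L1 mu f -> L1 mu f' -> L1 nu g -> L1 nu g' -> L1 mu a -> L1 nu c ->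
  (forall x y, `|f x * g y - f' x * g' y| <= a x + c y) ->
  `|\int[P]_z (f z.1 * g z.2 * w z) - \int[P]_z (f' z.1 * g' z.2 * w z)| <=
  \int[mu]_x a x + \int[nu]_y c y.
Proof.
move=> hf hf' hg hg' ha hc h.
have [L _] := stage_tensor hf hg; have [L' _] := stage_tensor hf' hg'.
rewrite -RintegralB//.
have mD : measurable_fun setT (fun z : T1 * T2 => f z.1 * g z.2 - f' z.1 * g' z.2).
  by apply: measurable_funB; apply: measurable_tensor;
    [exact: L1_measurable hf|exact: L1_measurable hg|exact: L1_measurable hf'|exact: L1_measurable hg'].
have [_] := cdensity_le stage_coupling mD ha hc (fun z => h z.1 z.2).
apply: le_trans; rewrite le_eqVlt; apply/orP; left; apply/eqP; congr `|_|.
by apply: eq_Rintegral => z _; rewrite mulrBl.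
Qed.

Definition stage_form i j (z : T1 * T2) := b1 i z.1 * phi2 z.2 0 j + phi1 z.1 0 i * b2 j z.2 +
  2 * \sum_k s1 i k z.1 * s2 j k z.2.

Definition stage_drift i j :=
  \sum_y \sum_y' kappa m m' p y y' *
    (mean mu phi1 (fun x => quant J (b1 i x)) y * (m' y' * pos y' j) +
     m y * pos y i * mean nu phi2 (fun x => quant J (b2 j x)) y' +
     E%:R ^- 2 * (mean mu phi1 (fun x => quant J (b1 i x)) y * mean nu phi2 (fun x => quant J (b2 j x)) y') +
     2 * \sum_k mean mu phi1 (fun x => quant J (s1 i k x)) y * mean nu phi2 (fun x => quant J (s2 j k x)) y').

Definition sigma_err t i j k : R :=
  2^-1 * (t^-1 * (\int[mu]_x (quant J (s1 i k x) - s1 i k x) ^+ 2 +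
                  \int[nu]_x (quant J (s2 j k x) - s2 j k x) ^+ 2)) +
  t * (\int[mu]_x s1 i k x ^+ 2 + \int[nu]_x s2 j k x ^+ 2 + 1).

(** The terms account for the drift of the discrete chain, the quantization of the drifts against
    bounded observables, the replacement of observables by lattice positions, the quantization of
    the dispersions, and the product of the two drift jumps, which occurs in the chain but not in
    the doubled operator. *)
Lemma stage_err t i j : 0 < t ->
  `|\int[P]_z (stage_form i j z * w z)| <= `|stage_drift i j| +
   Bn%:R * (\int[mu]_x `|quant J (b1 i x) - b1 i x| + \int[nu]_x `|quant J (b2 j x) - b2 j x|) +
   H%:R^-1 * (\int[mu]_x `|b1 i x| + \int[nu]_x `|b2 j x| + 2) +
   2 * \sum_k sigma_err t i j k + J%:R ^+ 2 / E%:R ^+ 2.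
Proof.
move=> t0.
have Lb1 := mdata_b hd1 i; have Lb2 := mdata_b hd2 j.
have Lq1 := L1_quant_b J hd1 i; have Lq2 := L1_quant_b J hd2 j.
have Lp1 := L1_phi hd1 i; have Lp2 := L1_phi hd2 j.
pose I (f : T1 -> R) (g : T2 -> R) := \int[P]_z (f z.1 * g z.2 * w z).
pose b1q := fun x => quant J (b1 i x); pose b2q := fun x => quant J (b2 j x).
pose p1 := fun x => phi1 x 0 i; pose p2 := fun x => phi2 x 0 j.
pose s1q k := fun x => quant J (s1 i k x); pose s2q k := fun x => quant J (s2 j k x).
have Lsq1 k : L1 mu (s1q k) by apply: L1_quant; exact: (mdata_s hd1).
have Lsq2 k : L1 nu (s2q k) by apply: L1_quant; exact: (mdata_s hd2).
have T1' := stage_tensor Lb1 Lp2; have T2' := stage_tensor Lp1 Lb2.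
have T3 k := stage_tensor (L1_s hd1 i k) (L1_s hd2 j k).
have IE : \int[P]_z (stage_form i j z * w z) = I (b1 i) p2 + I p1 (b2 j) + 2 * \sum_k I (s1 i k) (s2 j k).
  have [A1 _] := T1'; have [A2 _] := T2'.
  have A3 k : L1 P (fun z => s1 i k z.1 * s2 j k z.2 * w z) by have [] := T3 k.
  transitivity (\int[P]_z (b1 i z.1 * p2 z.2 * w z + p1 z.1 * b2 j z.2 * w z +
      2 * \sum_k s1 i k z.1 * s2 j k z.2 * w z)).
    by apply: eq_Rintegral => z _; rewrite /stage_form -mulr_suml /p1 /p2; ring.
  rewrite RintegralD//; [|exact: L1D|by apply: L1Z; exact: L1_sum].
  by rewrite RintegralD// RintegralZl ?Rint_sum//; exact: L1_sum.
pose KS (F : S -> S -> R) := \sum_y \sum_y' kap y y' * F y y'.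
have KSD F G : KS (fun y y' => F y y' + G y y') = KS F + KS G.
  rewrite /KS -big_split/=; apply: eq_bigr => y _; rewrite -big_split/=.
  by apply: eq_bigr => y' _; rewrite mulrDr.
have KSZ c F : KS (fun y y' => c * F y y') = c * KS F.
  rewrite /KS mulr_sumr; apply: eq_bigr => y _; rewrite mulr_sumr.
  by apply: eq_bigr => y' _; rewrite mulrCA.
have KSs (F : 'I_r -> S -> S -> R) : KS (fun y y' => \sum_k F k y y') = \sum_k KS (F k).
  rewrite /KS [RHS]exchange_big/=; apply: eq_bigr => y _; rewrite [RHS]exchange_big/=.
  by apply: eq_bigr => y' _; rewrite mulr_sumr.
have YE : stage_drift i j = \sum_y \sum_y' kap y y' * (mean mu phi1 b1q y * (m' y' * pos y' j)) +
  \sum_y \sum_y' kap y y' * (m y * pos y i * mean nu phi2 b2q y') +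
  E%:R ^- 2 * I b1q b2q + 2 * \sum_k I (s1q k) (s2q k).
  rewrite {1}/I (stage_tensor Lq1 Lq2).2.
  rewrite (eq_bigr (fun k => KS (fun y y' => mean mu phi1 (s1q k) y * mean nu phi2 (s2q k) y'))); last first.
    by move=> k _; exact: (stage_tensor (Lsq1 k) (Lsq2 k)).2.
  rewrite -(KSs (fun k y y' => mean mu phi1 (s1q k) y * mean nu phi2 (s2q k) y')).
  by rewrite -/(KS _) -[X in _ + X + _]KSZ -KSZ -!KSD.
have e1 : `|I (b1 i) p2 - I b1q p2| <= Bn%:R * \int[mu]_x `|quant J (b1 i x) - b1 i x|.
  have La : L1 mu (fun x => `|quant J (b1 i x) - b1 i x|) by apply: L1_norm; exact: L1B.
  have := stage_diff Lb1 Lq1 Lp2 Lp2 (L1Z Bn%:R La) (L1_cst0 nu).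
  rewrite RintegralZl// Rint_cst addr0; apply=> x y; rewrite addr0 -mulrBl normrM mulrC distrC.
  by rewrite ler_wpM2r// (mdata_phi_le hd2).
have e2 : `|I p1 (b2 j) - I p1 b2q| <= Bn%:R * \int[nu]_x `|quant J (b2 j x) - b2 j x|.
  have La : L1 nu (fun x => `|quant J (b2 j x) - b2 j x|) by apply: L1_norm; exact: L1B.
  have := stage_diff Lp1 Lp1 Lb2 Lq2 (L1_cst0 mu) (L1Z Bn%:R La).
  rewrite [\int[nu]_x (_ * _)]RintegralZl// Rint_cst add0r; apply=> x y; rewrite add0r -mulrBr normrM distrC.
  by rewrite ler_wpM2r// (mdata_phi_le hd1).
have e3 := drift_err1 j Lq1; have e4 := drift_err2 i Lq2.
have e5 k : `|I (s1 i k) (s2 j k) - I (s1q k) (s2q k)| <= sigma_err t i j k.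
  pose a x := 2^-1 * (t^-1 * (quant J (s1 i k x) - s1 i k x) ^+ 2) + t * (s1 i k x ^+ 2 + 1).
  pose c y := 2^-1 * (t^-1 * (quant J (s2 j k y) - s2 j k y) ^+ 2) + t * (s2 j k y ^+ 2).
  have La1 := L1_sq_err hd1 J0 i k; have La2 := mdata_s2 hd1 i k.
  have Lc1 := L1_sq_err hd2 J0 j k; have Lc2 := mdata_s2 hd2 j k.
  have La3 : L1 mu (fun x => s1 i k x ^+ 2 + 1) by apply: L1D => //; exact: L1_cst.
  have La : L1 mu a by apply: L1D; [do 2 apply: L1Z|apply: L1Z].
  have Lc : L1 nu c by apply: L1D; [do 2 apply: L1Z|apply: L1Z].
  have Ia : \int[mu]_x a x = 2^-1 * (t^-1 * \int[mu]_x (quant J (s1 i k x) - s1 i k x) ^+ 2) +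
      t * (\int[mu]_x s1 i k x ^+ 2 + 1).
    rewrite /a (RintegralD measurableT (L1Z _ (L1Z _ La1)) (L1Z _ La3)).
    rewrite (RintegralZl _ measurableT (L1Z _ La1)) (RintegralZl _ measurableT La1).
    rewrite (RintegralZl _ measurableT La3) (RintegralD measurableT La2 (L1_cst mu 1)).
    by congr (_ + _ * (_ + _)); exact: Rint_cst.
  have Ic : \int[nu]_x c x = 2^-1 * (t^-1 * \int[nu]_x (quant J (s2 j k x) - s2 j k x) ^+ 2) +
      t * \int[nu]_x s2 j k x ^+ 2.
    rewrite /c (RintegralD measurableT (L1Z _ (L1Z _ Lc1)) (L1Z _ Lc2)).
    rewrite (RintegralZl _ measurableT (L1Z _ Lc1)) (RintegralZl _ measurableT Lc1).
    by rewrite (RintegralZl _ measurableT Lc2).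
  have := stage_diff (L1_s hd1 i k) (Lsq1 k) (L1_s hd2 j k) (Lsq2 k) La Lc.
  move=> h; apply: le_trans (h _) _ => [x y|]; last first.
    by rewrite Ia Ic /sigma_err le_eqVlt; apply/orP; left; apply/eqP; ring.
  exact: (quant_prod_le _ _ t0 J0).
have e6 : `|I b1q b2q| <= J%:R ^+ 2.
  have mb : measurable_fun setT (fun z : T1 * T2 => b1q z.1 * b2q z.2).
    by apply: measurable_tensor; [exact: L1_measurable Lq1|exact: L1_measurable Lq2].
  have [|_] := cdensity_le stage_coupling mb (L1_cst mu (J%:R ^+ 2)) (L1_cst0 nu).
    move=> z; rewrite addr0 normrM expr2; apply: ler_pM => //; exact: quant_le.
  by rewrite !Rint_cst addr0.
have tri : \int[P]_z (stage_form i j z * w z) = stage_drift i j +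
    (I (b1 i) p2 - I b1q p2) + (I p1 (b2 j) - I p1 b2q) +
    (I b1q p2 - \sum_y \sum_y' kap y y' * (mean mu phi1 b1q y * (m' y' * pos y' j))) +
    (I p1 b2q - \sum_y \sum_y' kap y y' * (m y * pos y i * mean nu phi2 b2q y')) +
    2 * \sum_k (I (s1 i k) (s2 j k) - I (s1q k) (s2q k)) - E%:R ^- 2 * I b1q b2q.
  by rewrite IE YE sumrB; ring.
have e4' := le_trans e4 (ler_wpM2l _ (Rint_quant_b_le hd2 J0 j)).
have e3' := le_trans e3 (ler_wpM2l _ (Rint_quant_b_le hd1 J0 i)).
have Hi : 0 <= H%:R^-1 :> R by rewrite invr_ge0.
have e7 : `|E%:R ^- 2 * I b1q b2q| <= J%:R ^+ 2 / E%:R ^+ 2.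
  rewrite normrM (ger0_norm (_ : 0 <= E%:R ^- 2)) ?invr_ge0 ?exprn_ge0// mulrC.
  by rewrite ler_wpM2r ?invr_ge0 ?exprn_ge0.
have e8 : `|2 * \sum_k (I (s1 i k) (s2 j k) - I (s1q k) (s2q k))| <= 2 * \sum_k sigma_err t i j k.
  rewrite normrM ger0_norm// ler_wpM2l//; apply: le_trans (ler_norm_sum _ _ _) _.
  by apply: ler_sum => k _; exact: e5.
rewrite tri; apply: le_trans (ler_normB _ _) _.
rewrite lerD//.
have n5 (x0 x1 x2 x3 x4 x5 : R) : `|x0 + x1 + x2 + x3 + x4 + x5| <=
    `|x0| + `|x1| + `|x2| + `|x3| + `|x4| + `|x5|.
  by do 5 (apply: le_trans (ler_normD _ _) _; rewrite lerD2r).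
apply: le_trans (n5 _ _ _ _ _ _) _.
apply: le_trans (lerD (lerD (lerD (lerD (lerD (lexx _) e1) e2) (e3' Hi)) (e4' Hi)) e8) _.
by rewrite le_eqVlt; apply/orP; left; apply/eqP; ring.
Qed.

End fixed_scale.
End stage.

Lemma arch_le (R : realType) (c e : R) (N0 : nat) : 0 < e ->
  exists2 N : nat, (0 < N)%N & (N0 <= N)%N /\ c / N%:R <= e.
Proof.
move=> e0; have [N hN] : exists N : nat, `|c| / e < N%:R.
  by have := archi_boundP (divr_ge0 (normr_ge0 c) (ltW e0)); exists (Num.bound (`|c| / e)).
exists (maxn N.+1 N0); first by rewrite leq_max.
split; first by rewrite leq_maxr.
have NM : (N <= maxn N.+1 N0)%N by rewrite leq_max leqnSn.
rewrite ler_pdivrMr ?ltr0n ?leq_max//; apply: le_trans (ler_norm c) _.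
rewrite mulrC -ler_pdivrMr//; apply: le_trans (ltW hN) _; by rewrite ler_nat.
Qed.

Lemma cvg0_near_le (R : realType) (u : nat -> R) e : u J @[J --> \oo] --> (0 : R) -> 0 < e ->
  \forall J \near \oo, u J <= e.
Proof.
move=> u0 e0; apply: filterS ((cvgrPdist_le _ _).1 u0 e e0) => J.
by rewrite sub0r normrN => /(le_trans (ler_norm _)).
Qed.

Lemma cvg_sum0 (R : realType) (I : Type) (l : seq I) (u : I -> nat -> R) :
  (forall i, u i J @[J --> \oo] --> (0 : R)) ->
  \sum_(i <- l) u i J @[J --> \oo] --> (0 : R).
Proof.
move=> h; elim: l => [|i l IH].
  by under eq_fun do rewrite big_nil; exact: cvg_cst.
under eq_fun do rewrite big_cons.
have h2 := cvgD (h i) IH; rewrite addr0 in h2. exact: h2.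
Qed.

Section quant_limits.
Context d (T : measurableType d) (R : realType) (mu : probability T R).
Variables (n r : nat) (phi : T -> 'rV[R]_n) (b : 'I_n -> T -> R) (s : 'I_n -> 'I_r -> T -> R).
Variables (Bn : nat).
Hypothesis hd : martingale_data mu phi b s Bn.

Definition quant_err_b J := \sum_i \int[mu]_x `|quant J (b i x) - b i x|.
Definition quant_err_s J := \sum_i \sum_k \int[mu]_x (quant J (s i k x) - s i k x) ^+ 2.

Lemma quant_err_b_cvg : quant_err_b J @[J --> \oo] --> (0 : R).
Proof. by apply: cvg_sum0 => i; apply: quant_L1_cvg; exact: (mdata_b hd). Qed.

Lemma quant_err_s_cvg : quant_err_s J @[J --> \oo] --> (0 : R).
Proof.
apply: cvg_sum0 => i; apply: cvg_sum0 => k.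
by apply: quant_L2_cvg; [exact: (mdata_s hd)|exact: (mdata_s2 hd)].
Qed.

Lemma defect_cvg : \int[mu]_x defect b s J x @[J --> \oo] --> (0 : R).
Proof.
have ms := mdata_s hd; have s2 := mdata_s2 hd; have bL := mdata_b hd.
have mb i := L1_measurable (bL i).
rewrite -cvg_shiftS/=.
pose h x := \sum_i \sum_j \sum_k (2 * (s i k x ^+ 2 + s j k x ^+ 2) + 2) + \sum_i (`|b i x| + 1).
apply: (dominated_cvg0 (h := h)).
- apply: L1D; last by apply: L1_sum => i; apply: L1D; [exact: L1_norm|exact: L1_cst].
  apply: L1_sum => i; apply: L1_sum => j; apply: L1_sum => k.
  by apply: L1D; [apply: L1Z; exact: L1D|exact: L1_cst].
- move=> J; exact: L1_measurable (L1_defect bL ms s2 (ltn0Sn J)).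
- move=> J x; rewrite ger0_norm; last first.
    by rewrite /defect addr_ge0 ?sumr_ge0// => i _; rewrite sumr_ge0.
  rewrite /defect /h; apply: lerD; last by apply: ler_sum => i _; exact: quant_err.
  apply: ler_sum => i _; apply: ler_sum => j _; apply: le_trans (ler_norm_sum _ _ _) _.
  apply: ler_sum => k _; apply: le_trans (ler_normB _ _) _.
  rewrite (normrM (quant _ _)) (normrM (s i k x)).
  have h1 := @quant_dom R J.+1 (s i k x) isT; have h2 := @quant_dom R J.+1 (s j k x) isT.
  have h3 : `|quant J.+1 (s i k x)| * `|quant J.+1 (s j k x)| <= (`|s i k x| + 1) * (`|s j k x| + 1).
    exact: ler_pM.
  apply: le_trans (lerD h3 (lexx _)) _.
  move: (s i k x) (s j k x) => u v; rewrite -[u ^+ 2]real_normK ?num_real// -[v ^+ 2]real_normK ?num_real//.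
  have := sqr_ge0 (`|u| - `|v|); have := sqr_ge0 (`|u| - 1); have := sqr_ge0 (`|v| - 1).
  have := sqr_ge0 `|u|; have := sqr_ge0 `|v|.
  by rewrite !sqrrB; move: `|u| `|v| => a c; lra.
- move=> x; rewrite (cvg_shiftS (fun J => defect b s J x)).
  have hb : \sum_i `|quant J (b i x) - b i x| @[J --> \oo] --> (0 : R).
    apply: cvg_sum0 => i; apply/norm_cvg0P; rewrite -(subrr (b i x)).
    by apply: cvgB; [exact: quant_cvg|exact: cvg_cst].
  have hs : \sum_i \sum_j `|\sum_k (quant J (s i k x) * quant J (s j k x) - s i k x * s j k x)|
      @[J --> \oo] --> (0 : R).
    apply: cvg_sum0 => i; apply: cvg_sum0 => j; apply/norm_cvg0P; apply: cvg_sum0 => k.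
    rewrite -(subrr (s i k x * s j k x)); apply: cvgB; last exact: cvg_cst.
    by apply: cvgM; exact: quant_cvg.
  have h2 := cvgD hs hb; rewrite addr0 in h2; exact: h2.
Qed.

Lemma quant_errs_small e : 0 < e -> \forall J \near \oo,
  [/\ quant_err_b J <= e, quant_err_s J <= e & \int[mu]_x defect b s J x <= e].
Proof.
move=> e0; near=> J; split; near: J.
- exact: cvg0_near_le quant_err_b_cvg e0.
- exact: cvg0_near_le quant_err_s_cvg e0.
- exact: cvg0_near_le defect_cvg e0.
Unshelve. all: by end_near. Qed.

End quant_limits.

Lemma le_sum_term (R : realType) (I : finType) (f : I -> R) i :
  (forall i, 0 <= f i) -> f i <= \sum_i f i.
Proof. by move=> f0; rewrite (bigD1 i)//= lerDl sumr_ge0. Qed.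

(** * Choice of the scales *)

Section stage_existence.
Context d1 d2 (T1 : measurableType d1) (T2 : measurableType d2) (R : realType).
Variables (mu : probability T1 R) (nu : probability T2 R) (n r Bn : nat).
Variables (phi1 : T1 -> 'rV[R]_n) (b1 : 'I_n -> T1 -> R) (s1 : 'I_n -> 'I_r -> T1 -> R).
Variables (phi2 : T2 -> 'rV[R]_n) (b2 : 'I_n -> T2 -> R) (s2 : 'I_n -> 'I_r -> T2 -> R).
Hypothesis hd1 : martingale_data mu phi1 b1 s1 Bn.
Hypothesis hd2 : martingale_data nu phi2 b2 s2 Bn.

(** The order of choice is [H], [J], [E], [N]: the mollifier constant depends on [H], the jump
    remainder on [J], and the averaging error on [E]. Each of five error terms receives a portion
    [delta / 6]. *)
Lemma stage_existence delta : 0 < delta -> exists2 w, coupling_density mu nu (mu \x nu)%E w &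
  forall i j, `|\int[(mu \x nu)%E]_z (stage_form phi1 b1 s1 phi2 b2 s2 i j z * w z)| <= delta.
Proof.
move=> delta0; have e0 : 0 < delta / 6 by rewrite divr_gt0.
pose beta := \sum_i (\int[mu]_x `|b1 i x|) + \sum_i (\int[nu]_x `|b2 i x|) + 2.
pose sig := \sum_i \sum_k (\int[mu]_x s1 i k x ^+ 2) + \sum_i \sum_k (\int[nu]_x s2 i k x ^+ 2) + 1.
have ib1 i : 0 <= \int[mu]_x `|b1 i x| by apply: Rintegral_ge0.
have ib2 i : 0 <= \int[nu]_x `|b2 i x| by apply: Rintegral_ge0.
have is1 i k : 0 <= \int[mu]_x s1 i k x ^+ 2 by apply: Rintegral_ge0 => x _; exact: sqr_ge0.
have is2 i k : 0 <= \int[nu]_x s2 i k x ^+ 2 by apply: Rintegral_ge0 => x _; exact: sqr_ge0.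
have sig0 : 0 < sig by rewrite ltr_wpDl// addr_ge0// !sumr_ge0// => i _; rewrite sumr_ge0.
have [H H0 [_ hH]] := arch_le beta 0 e0.
have [C C0 hC] := mol_bounds R n Bn H0.
pose K := lattice_const R n Bn H * C; pose G : R := (Bn%:R + 2) ^+ 2.
have K0 : 0 <= K.
  by rewrite mulr_ge0 ?(ltW C0)// exprn_ge0// addr_ge0// !mulr_ge0// addr_ge0.
have G0 : 0 <= G by rewrite exprn_ge0// addr_ge0.
(* Keeps [2 * r * t * sig] below [delta / 6]; [r + 1] instead of [r] covers [r = 0]. *)
pose t := delta / 6 / (2 * (r%:R + 1) * sig).
have r1 : 0 < r%:R + 1 :> R by rewrite ltr_wpDl.
have t0 : 0 < t by rewrite divr_gt0// !mulr_gt0.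
(* Collects the coefficients of [eps] in the final sum; the additional 1 makes it positive. *)
pose D := Bn%:R * 2 + 2 * r%:R / t + 4 * G * K + 1.
have D0 : 0 < D.
  have x1 : 0 <= 2 * r%:R / t by apply: divr_ge0 (ltW t0); rewrite mulr_ge0.
  have x2 : 0 <= 4 * G * K by apply: mulr_ge0 K0; apply: mulr_ge0 G0.
  by rewrite /D ltr_wpDl// (addr_ge0 (addr_ge0 _ x1) x2)// mulr_ge0.
pose eps := delta / 6 / D.
have eps0 : 0 < eps by rewrite /eps (divr_gt0 e0 D0).
have [J [J0 [q1 q2 q3] [q1' q2' q3']]] : exists J : nat, [/\ (0 < J)%N,
    [/\ quant_err_b mu b1 J <= eps, quant_err_s mu s1 J <= eps & \int[mu]_x defect b1 s1 J x <= eps] &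
    [/\ quant_err_b nu b2 J <= eps, quant_err_s nu s2 J <= eps & \int[nu]_x defect b2 s2 J x <= eps]].
  have h1 := quant_errs_small hd1 eps0; have h2 := quant_errs_small hd2 eps0.
  have [J _ hJ] := filterI h1 h2.
  by exists J.+1; have [? ?] := hJ J.+1 (leqnSn J).
have [E E0 [JE hE]] := arch_le (J%:R ^+ 2 + 4 * G * K * jump_rem R n r J) J e0.
pose W : R := #|{: jump r}|%:R.
(* [N] comes last, as the averaging error carries the factor [W * E^2]. *)
have [N N0 [_ hN]] := arch_le (2 * G * W * E%:R ^+ 2) 0 e0.
have M0 : (0 < J * E ^ 2)%N by rewrite muln_gt0 J0 expn_gt0 E0.
have [p hp hY] := discrete_stage hd1 hd2 H0 J0 E0 JE N0 (ltW C0) (hC _ M0).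
exists (stage_density mu nu phi1 phi2 p); first exact: (stage_coupling hd1 hd2).
move=> i j; apply: le_trans (stage_err hd1 hd2 H0 J0 E0 hp i j t0) _.
have E0' : 0 < E%:R :> R by rewrite ltr0n.
have a1 : `|stage_drift mu nu phi1 b1 s1 phi2 b2 s2 p i j| <= G * (2 * (K * (eps + eps + 2 * (jump_rem R n r J / E%:R))) +
    2 * (W * E%:R ^+ 2) / N%:R).
  apply: le_trans (hY i j) _; rewrite /stage_bound -/G -/W -/K.
  apply: (ler_wpM2l G0); rewrite lerD2r; apply: ler_wpM2l => //.
  by apply: (ler_wpM2l K0); rewrite lerD2r; exact: lerD.
have a2 : Bn%:R * (\int[mu]_x `|quant J (b1 i x) - b1 i x| + \int[nu]_x `|quant J (b2 j x) - b2 j x|) <=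
    Bn%:R * (eps + eps).
  rewrite ler_wpM2l//; apply: lerD; [apply: le_trans q1|apply: le_trans q1'].
    by apply: (le_sum_term (f := fun i => \int[mu]_x `|quant J (b1 i x) - b1 i x|)) => k; exact: Rintegral_ge0.
  by apply: (le_sum_term (f := fun i => \int[nu]_x `|quant J (b2 i x) - b2 i x|)) => k; exact: Rintegral_ge0.
have a3 : H%:R^-1 * (\int[mu]_x `|b1 i x| + \int[nu]_x `|b2 j x| + 2) <= delta / 6.
  apply: le_trans hH; rewrite mulrC ler_wpM2r ?invr_ge0// lerD2r lerD//.
    exact: (le_sum_term (f := fun i => \int[mu]_x `|b1 i x|)).
  exact: (le_sum_term (f := fun i => \int[nu]_x `|b2 i x|)).
have a4 k : sigma_err mu nu s1 s2 J t i j k <= t^-1 * eps + t * sig.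
  rewrite /sigma_err; apply: lerD.
    rewrite mulrCA ler_pM2l ?invr_gt0// ler_pdivrMl// mulr_natl mulr2n lerD//.
      apply: le_trans q2; apply: le_trans _ (le_sum_term (f := fun i => \sum_k \int[mu]_x (quant J (s1 i k x) - s1 i k x) ^+ 2) i _).
        apply: (le_sum_term (f := fun k => \int[mu]_x (quant J (s1 i k x) - s1 i k x) ^+ 2)) => l.
        by apply: Rintegral_ge0 => x _; exact: sqr_ge0.
      by move=> l; apply: sumr_ge0 => l' _; apply: Rintegral_ge0 => x _; exact: sqr_ge0.
    apply: le_trans q2'; apply: le_trans _ (le_sum_term (f := fun i => \sum_k \int[nu]_x (quant J (s2 i k x) - s2 i k x) ^+ 2) j _).
      apply: (le_sum_term (f := fun k => \int[nu]_x (quant J (s2 j k x) - s2 j k x) ^+ 2)) => l.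
      by apply: Rintegral_ge0 => x _; exact: sqr_ge0.
    by move=> l; apply: sumr_ge0 => l' _; apply: Rintegral_ge0 => x _; exact: sqr_ge0.
  rewrite ler_pM2l// lerD2r lerD//.
    apply: le_trans _ (le_sum_term (f := fun i => \sum_k \int[mu]_x s1 i k x ^+ 2) i _).
      exact: (le_sum_term (f := fun k => \int[mu]_x s1 i k x ^+ 2)).
    by move=> l; apply: sumr_ge0.
  apply: le_trans _ (le_sum_term (f := fun i => \sum_k \int[nu]_x s2 i k x ^+ 2) j _).
    exact: (le_sum_term (f := fun k => \int[nu]_x s2 j k x ^+ 2)).
  by move=> l; apply: sumr_ge0.
have a5 : 2 * \sum_k sigma_err mu nu s1 s2 J t i j k <= 2 * r%:R / t * eps + delta / 6.
  have h : \sum_k sigma_err mu nu s1 s2 J t i j k <= r%:R * (t^-1 * eps + t * sig).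
    rewrite -[X in X%:R](card_ord r) -sum1_card natr_sum mulr_suml; apply: ler_sum => k _.
    by rewrite mul1r.
  apply: le_trans (ler_wpM2l _ h) _ => //.
  have -> : 2 * (r%:R * (t^-1 * eps + t * sig)) = 2 * r%:R / t * eps + 2 * r%:R * t * sig by ring.
  rewrite lerD2l /t.
  have -> : 2 * r%:R * (delta / 6 / (2 * (r%:R + 1) * sig)) * sig = delta / 6 * (r%:R / (r%:R + 1)).
    by field; rewrite !gt_eqF.
  by apply: ler_piMr; [exact: ltW|rewrite ler_pdivrMr// mul1r lerDl].
have a6 : J%:R ^+ 2 / E%:R ^+ 2 <= J%:R ^+ 2 / E%:R :> R.
  rewrite ler_wpM2l ?exprn_ge0// lef_pV2 ?posrE ?exprn_gt0// expr2 ler_peMl ?(ltW E0')//.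
  by rewrite ler1n.
have a7 : D * eps = delta / 6 by rewrite /eps; field; rewrite gt_eqF.
rewrite mulrDl in hE.
apply: le_trans (lerD (lerD (lerD (lerD a1 a2) a3) a5) a6) _.
have -> : G * (2 * (K * (eps + eps + 2 * (jump_rem R n r J / E%:R))) + 2 * (W * E%:R ^+ 2) / N%:R) +
   Bn%:R * (eps + eps) + delta / 6 + (2 * r%:R / t * eps + delta / 6) + J%:R ^+ 2 / E%:R =
   D * eps - eps + (J%:R ^+ 2 / E%:R + 4 * G * K * jump_rem R n r J / E%:R) + (2 * G * W * E%:R ^+ 2) / N%:R +
   (delta / 6 + delta / 6).
  by rewrite /D; ring.
rewrite a7.
apply: le_trans (lerD (lerD (lerD (_ : _ <= delta / 6) hE) hN) (lexx _)) _.
  by rewrite gerBl ltW.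
have h6 : delta / 6 + delta / 6 + delta / 6 + (delta / 6 + delta / 6) = delta - delta / 6 by field.
by rewrite h6 gerBl ltW.
Qed.

End stage_existence.

(** * Passage to the limit *)

(** The bounded factor is quantized uniformly to within [1 / J], so the majorant depends on [u]
    alone and mere integrability of [u] suffices. *)
Lemma quant_bounded_le (R : realType) (C : R) J (u v : R) : `|v| <= C -> C <= J%:R -> (0 < J)%N ->
  `|u * v - quant J u * quant J v| <= C * `|quant J u - u| + J%:R^-1 * (`|u| + 1).
Proof.
move=> vC CJ J0; rewrite distrC.
rewrite (_ : _ - _ = v * (quant J u - u) + (quant J v - v) * quant J u); last by ring.
apply: le_trans (ler_normD _ _) _; rewrite (normrM v) (normrM (_ - _)); apply: lerD.
  by rewrite ler_wpM2r.
apply: ler_pM => //; [exact: quant_close (le_trans vC CJ)|exact: quant_dom].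
Qed.

Lemma quant_bounded_small (R : realType) d (T : measurableType d) (m : probability T R) (C : R)
  (u : T -> R) e : L1 m u -> 0 < e -> exists2 J, (0 < J)%N & [/\ `|C| <= J%:R,
    L1 m (fun x => `|C| * `|quant J (u x) - u x| + J%:R^-1 * (`|u x| + 1)) &
    \int[m]_x (`|C| * `|quant J (u x) - u x| + J%:R^-1 * (`|u x| + 1)) <= e].
Proof.
move=> Lu e0; have C1 : 0 < `|C| + 1 by rewrite ltr_wpDl.
have e1 : 0 < e / 2 / (`|C| + 1) by rewrite !divr_gt0.
have h1 := cvg0_near_le (quant_L1_cvg Lu) e1.
have h2 : \forall J \near \oo, `|C| <= J%:R by exact: nbhs_infty_ger.
have h3 : \forall J \near \oo, (\int[m]_x `|u x| + 1) / (e / 2) <= J%:R by exact: nbhs_infty_ger.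
have [J _ hJ] := filterI h1 (filterI h2 h3); have {hJ} [q1 [q2 q3]] := hJ J.+1 (leqnSn J).
have J0' : 0 < J.+1%:R :> R by rewrite ltr0n.
have Lq : L1 m (fun x => `|quant J.+1 (u x) - u x|).
  by apply: L1_norm; apply: L1B => //; apply: L1_quant; exact: L1_measurable Lu.
have Lu1 := L1D (L1_norm Lu) (L1_cst m 1).
exists J.+1 => //; split => //; first by apply: L1D; exact: L1Z.
rewrite (RintegralD measurableT (L1Z _ Lq) (L1Z _ Lu1)).
rewrite (RintegralZl _ measurableT Lq) (RintegralZl _ measurableT Lu1).
rewrite (RintegralD measurableT (L1_norm Lu) (L1_cst m 1)).
have -> : \int[m]_x 1 = 1 :> R by exact: Rint_cst.
rewrite [e]splitr; apply: lerD.
  apply: (@le_trans _ _ ((`|C| + 1) * (e / 2 / (`|C| + 1)))).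
    by apply: ler_pM => //; [exact: Rintegral_ge0|rewrite lerDl].
  by rewrite mulrCA mulfV ?mulr1// gt_eqF.
by rewrite ler_pdivrMl// -ler_pdivrMr// divr_gt0.
Qed.

(** * Approximation by combinations of rectangles *)

Section tensor_approximation.
Context d1 d2 (T1 : measurableType d1) (T2 : measurableType d2) (R : realType).
Variables (mu : probability T1 R) (nu : probability T2 R).
Local Notation T12 := (T1 * T2)%type.

Definition rect_comb (Q : seq (R * (set T1 * set T2))) (z : T12) : R :=
  \sum_(q <- Q) q.1 * (\1_(q.2.1) z.1 * \1_(q.2.2) z.2).

Definition measurable_rects (Q : seq (R * (set T1 * set T2))) :=
  forall q, q \in Q -> measurable q.2.1 /\ measurable q.2.2.

(* The error [a x + c y] is integrated by the marginals only, hence uniformly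
   over all couplings of [mu] and [nu]. *)
Definition rect_approx (h : T12 -> R) := measurable_fun setT h /\
  forall e, 0 < e -> exists Q a c, [/\ measurable_rects Q, L1 mu a, L1 nu c,
    \int[mu]_x a x + \int[nu]_y c y <= e &
    forall z, `|h z - rect_comb Q z| <= a z.1 + c z.2].

Lemma rect_approxD h k : rect_approx h -> rect_approx k -> rect_approx (fun z => h z + k z).
Proof.
move=> [mh hh] [mk hk]; split; first exact: measurable_funD.
move=> e e0; have e2 : 0 < e / 2 by rewrite divr_gt0.
have [Q [a [c [mQ La Lc ac hQ]]]] := hh _ e2.
have [Q' [a' [c' [mQ' La' Lc' ac' hQ']]]] := hk _ e2.
exists (Q ++ Q'), (fun x => a x + a' x), (fun y => c y + c' y); split.
- by move=> q; rewrite mem_cat => /orP[/mQ|/mQ'].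
- exact: L1D.
- exact: L1D.
- by rewrite !RintegralD// addrACA [e]splitr lerD.
- move=> z; rewrite /rect_comb big_cat/= opprD addrACA.
  by apply: le_trans (ler_normD _ _) _; rewrite addrACA lerD.
Qed.

Lemma rect_approxZ r h : rect_approx h -> rect_approx (fun z => r * h z).
Proof.
move=> [mh hh]; split; first exact: measurable_funM.
move=> e e0; have r0 : 0 < `|r| + 1 by rewrite ltr_wpDl.
have e2 : 0 < e / (`|r| + 1) by rewrite divr_gt0.
have [Q [a [c [mQ La Lc ac hQ]]]] := hh _ e2.
exists [seq (r * q.1, q.2) | q <- Q], (fun x => (`|r| + 1) * a x), (fun y => (`|r| + 1) * c y); split.
- by move=> q /mapP[q' /mQ ? ->].
- exact: L1Z.
- exact: L1Z.
- by rewrite !RintegralZl// -mulrDr mulrC -ler_pdivlMr.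
- move=> z; rewrite /rect_comb big_map/=.
  under eq_bigr do rewrite -mulrA.
  rewrite -mulr_sumr -mulrBr normrM -mulrDr; apply: ler_pM => //; by rewrite lerDl.
Qed.

Lemma rect_approx0 : rect_approx (fun=> 0).
Proof.
split=> // e e0; exists [::], (fun=> 0), (fun=> 0); split => //; try exact: L1_cst0.
  by rewrite !Rint_cst addr0 ltW.
by move=> z; rewrite /rect_comb big_nil subrr normr0 addr0.
Qed.

Lemma rect_approx_sum (I : Type) (l : seq I) (h : I -> T12 -> R) : (forall i, rect_approx (h i)) ->
  rect_approx (fun z => \sum_(i <- l) h i z).
Proof.
move=> hh; elim: l => [|i l IH].
  rewrite (_ : (fun z => _) = fun=> 0); first exact: rect_approx0.
  by apply/funext => z; rewrite big_nil.
rewrite (_ : (fun z => _) = fun z => h i z + \sum_(j <- l) h j z); first exact: rect_approxD.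
by apply/funext => z; rewrite big_cons.
Qed.

(** The numerators of quantized values are integers between [-J^2] and [J^2]; the shift by [J^2]
    makes them indices. The level sets become the sides of the rectangles in [quant_rect_comb]. *)
Lemma quant_sum d (T : measurableType d) J (u : T -> R) x : (0 < J)%N ->
  quant J (u x) = \sum_(k < (J ^ 2 + J ^ 2).+1)
    ((k : nat)%:R - (J ^ 2)%:R) / J%:R * \1_[set x | quant J (u x) = ((k : nat)%:R - (J ^ 2)%:R) / J%:R] x.
Proof.
move=> J0; have J0' : 0 < J%:R :> R by rewrite ltr0n.
have := @quant_le R J (u x) J0; rewrite {1}/quant normrM normfV (gtr0_norm J0') ler_pdivrMr//.
rewrite -expr2 ler_norml => /andP[z1 z2].
pose z := zquant J (u x) + (J ^ 2)%N%:Z.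
have zE : z%:~R = (zquant J (u x))%:~R + J%:R ^+ 2 :> R by rewrite /z intrD -pmulrn natrX.
have z0 : 0 <= z by rewrite -(ler_int R) zE; lra.
have zL : (`|z| < (J ^ 2 + J ^ 2).+1)%N.
  by rewrite ltnS -lez_nat gez0_abs// -(ler_int R) zE -pmulrn natrD natrX; lra.
have zE' : (`|z|%N)%:R = (zquant J (u x))%:~R + J%:R ^+ 2 :> R by rewrite -zE pmulrn gez0_abs.
rewrite (bigD1 (Ordinal zL))//= big1 ?addr0.
  rewrite indicE mem_set /= ?mulr1; first by rewrite zE' natrX addrK.
  by rewrite zE' natrX addrK.
move=> k /eqP kz; rewrite indicE memNset ?mulr0//= => h; apply: kz; apply/val_inj => /=.
move: h; rewrite /quant => /(mulIf (invr_neq0 (lt0r_neq0 J0'))) h.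
apply/eqP; rewrite -(eqr_nat R) zE' h natrX; apply/eqP; ring.
Qed.

Lemma quant_rect_comb J (u : T1 -> R) (v : T2 -> R) : measurable_fun setT u -> measurable_fun setT v ->
  (0 < J)%N -> exists2 Q, measurable_rects Q &
    forall z, quant J (u z.1) * quant J (v z.2) = rect_comb Q z.
Proof.
move=> mu_ mv J0; pose L := (J ^ 2 + J ^ 2).+1.
pose c (k : 'I_L) : R := ((k : nat)%:R - (J ^ 2)%:R) / J%:R.
pose A k := [set x | quant J (u x) = c k]; pose B k := [set x | quant J (v x) = c k].
exists [seq (c k * c l, (A k, B l)) | k <- index_enum 'I_L, l <- index_enum 'I_L].
  move=> _ /allpairsP[[k l] [_ _ ->]]/=; split.
    rewrite -[X in measurable X]setTI; exact: (measurable_quant_comp J mu_ measurableT (measurable_set1 (c k))).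
  rewrite -[X in measurable X]setTI; exact: (measurable_quant_comp J mv measurableT (measurable_set1 (c l))).
move=> z; rewrite /rect_comb big_allpairs_dep/= [quant J (u _)]quant_sum// [quant J (v _)]quant_sum//.
rewrite mulr_suml; apply: eq_bigr => k _; rewrite mulr_sumr; apply: eq_bigr => l _.
by rewrite /A /B /c; ring.
Qed.

Lemma rect_approx_L2 (u : T1 -> R) (v : T2 -> R) : measurable_fun setT u -> measurable_fun setT v ->
  L1 mu (fun x => u x ^+ 2) -> L1 nu (fun y => v y ^+ 2) -> rect_approx (fun z => u z.1 * v z.2).
Proof.
move=> mu_ mv Lu Lv; split; first exact: measurable_tensor.
move=> e e0.
pose U := \int[mu]_x u x ^+ 2 + 1 + \int[nu]_y v y ^+ 2.
have U0 : 0 < U.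
  by rewrite /U ltr_wpDr ?ltr_wpDl// Rintegral_ge0// => x _; exact: sqr_ge0.
(* [t * U = e / 2] takes care of the terms of [quant_prod_le] that do not decrease with [J]. The
   squared quantization errors are then taken below [t * (e / 2)], against the weight [1 / t]. *)
pose t := e / 2 / U; have t0 : 0 < t by rewrite /t !divr_gt0.
have et : 0 < t * (e / 2) by rewrite mulr_gt0// divr_gt0.
have h1 := cvg0_near_le (quant_L2_cvg mu_ Lu) et.
have h2 := cvg0_near_le (quant_L2_cvg mv Lv) et.
have [J _ hJ] := filterI h1 h2; have {hJ} [q1 q2] := hJ J.+1 (leqnSn J).
have [Q mQ hQ] := quant_rect_comb mu_ mv (ltn0Sn J).
have Lqu := L1_quant_err2 mu_ Lu (ltn0Sn J); have Lqv := L1_quant_err2 mv Lv (ltn0Sn J).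
have Lu1 := L1D Lu (L1_cst mu 1).
exists Q, (fun x => 2^-1 * (t^-1 * (quant J.+1 (u x) - u x) ^+ 2) + t * (u x ^+ 2 + 1)),
  (fun y => 2^-1 * (t^-1 * (quant J.+1 (v y) - v y) ^+ 2) + t * v y ^+ 2).
split => //.
- by apply: L1D; [do 2 apply: L1Z|apply: L1Z].
- by apply: L1D; [do 2 apply: L1Z|apply: L1Z].
- rewrite (RintegralD measurableT (L1Z _ (L1Z _ Lqu)) (L1Z _ Lu1)).
  rewrite (RintegralD measurableT (L1Z _ (L1Z _ Lqv)) (L1Z _ Lv)).
  rewrite (RintegralZl _ measurableT (L1Z _ Lqu)) (RintegralZl _ measurableT Lqu).
  rewrite (RintegralZl _ measurableT (L1Z _ Lqv)) (RintegralZl _ measurableT Lqv).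
  rewrite (RintegralZl _ measurableT Lu1) (RintegralZl _ measurableT Lv).
  rewrite (RintegralD measurableT Lu (L1_cst mu 1)).
  have -> : \int[mu]_x 1 = 1 :> R by exact: Rint_cst.
  have k1 : t^-1 * \int[mu]_x (quant J.+1 (u x) - u x) ^+ 2 <= e / 2 by rewrite ler_pdivrMl.
  have k2 : t^-1 * \int[nu]_x (quant J.+1 (v x) - v x) ^+ 2 <= e / 2 by rewrite ler_pdivrMl.
  have k3 : t * U = e / 2 by rewrite /t divfK// gt_eqF.
  rewrite /U !mulrDr mulr1 in k3; rewrite mulrDr mulr1.
  move: k1 k2 k3; move: (t^-1 * _) (t^-1 * _) (t * _) (t * _) => ? ? ? ?; lra.
- by move=> z; rewrite -hQ; exact: quant_prod_le.
Qed.

Lemma rect_approx_L1l (u : T1 -> R) (v : T2 -> R) C : L1 mu u -> measurable_fun setT v ->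
  (forall y, `|v y| <= C) -> rect_approx (fun z => u z.1 * v z.2).
Proof.
move=> Lu mv vC; split; first exact: measurable_tensor (L1_measurable Lu) mv.
move=> e e0; have [J J0 [CJ La ae]] := quant_bounded_small C Lu e0.
have [Q mQ hQ] := quant_rect_comb (L1_measurable Lu) mv J0.
exists Q, (fun x => `|C| * `|quant J (u x) - u x| + J%:R^-1 * (`|u x| + 1)), (fun=> 0).
split => //; [exact: L1_cst0|by rewrite Rint_cst addr0|].
move=> z; rewrite addr0 -hQ; apply: quant_bounded_le => //.
by apply: le_trans (vC _) _; exact: ler_norm.
Qed.

Lemma rect_approx_L1r (u : T1 -> R) (v : T2 -> R) C : measurable_fun setT u -> L1 nu v ->
  (forall x, `|u x| <= C) -> rect_approx (fun z => u z.1 * v z.2).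
Proof.
move=> mu_ Lv uC; split; first exact: measurable_tensor mu_ (L1_measurable Lv).
move=> e e0; have [J J0 [CJ La ae]] := quant_bounded_small C Lv e0.
have [Q mQ hQ] := quant_rect_comb mu_ (L1_measurable Lv) J0.
exists Q, (fun=> 0), (fun x => `|C| * `|quant J (v x) - v x| + J%:R^-1 * (`|v x| + 1)).
split => //; [exact: L1_cst0|by rewrite Rint_cst add0r|].
move=> z; rewrite add0r -hQ [u _ * _]mulrC [quant J (u _) * _]mulrC; apply: quant_bounded_le => //.
by apply: le_trans (uC _) _; exact: ler_norm.
Qed.

End tensor_approximation.

Section image_measure.
Context d1 d2 (X : measurableType d1) (Y : measurableType d2) (R : realType).
Variables (m : probability X R) (q : probability Y R) (g : X -> Y).
Hypothesis mg : measurable_fun setT g.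
Hypothesis qm : forall A, measurable A -> q A = m (g @^-1` A).

Lemma ge0_integral_image (f : Y -> \bar R) : measurable_fun setT f -> (forall y, (0 <= f y)%E) ->
  (\int[q]_y f y = \int[m]_x f (g x))%E.
Proof.
move=> mf f0; rewrite -(preimage_setT g) -(ge0_integral_pushforward mg)//.
by apply: eq_measure_integral => A mA _; exact: qm.
Qed.

Lemma L1_image (f : Y -> R) : measurable_fun setT f -> L1 q f <-> L1 m (f \o g).
Proof.
move=> mf; have e : (\int[q]_y `|(f y)%:E| = \int[m]_x `|((f \o g) x)%:E|)%E.
  rewrite (ge0_integral_image (f := fun y => `|(f y)%:E|%E))//.
  by apply: measurableT_comp => //; exact/measurable_EFinP.
have mfg : measurable_fun setT (f \o g) by exact: measurableT_comp.
by split=> /integrableP[_ h]; apply/integrableP; split; try exact/measurable_EFinP;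
  move: h; rewrite /= e.
Qed.

Lemma Rint_image (f : Y -> R) : measurable_fun setT f -> L1 m (f \o g) ->
  \int[q]_y f y = \int[m]_x f (g x).
Proof.
move=> mf Lf; rewrite /Rintegral; congr fine; rewrite -(preimage_setT g).
rewrite -(@integral_pushforward _ _ _ _ _ _ mg _ setT (EFin \o f))//.
  by apply: eq_measure_integral => A mA _; exact: qm.
exact/measurable_EFinP.
Qed.

End image_measure.

(** * The limiting coupling *)

Section coupling_limit.
Variables (R : realType) (n m : nat).
Variables (mu : probability (Rd R n) R) (nu : probability (Rd R m) R).
Local Notation T12 := (Rd R n * Rd R m)%type.

(** A coupling has density 1 with respect to itself, so the estimates for densities apply to the
    limit as well as to the approximating couplings. *)
Lemma marginals_coupling_density (p : probability T12 R) :
  (forall A, measurable A -> p (A `*` setT) = mu A) ->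
  (forall B, measurable B -> p (setT `*` B) = nu B) ->
  coupling_density mu nu p (fun=> 1).
Proof.
move=> p1 p2; split => //.
- move=> f Lf; have mf := L1_measurable Lf.
  have i1 A : measurable A -> mu A = p (fst @^-1` A).
    by move=> mA; rewrite -p1//; congr (p _); apply/seteqP; split => z //= [].
  under eq_fun do rewrite mulr1.
  have L := (L1_image measurable_fst i1 mf).1 Lf.
  by split => //; rewrite (Rint_image measurable_fst i1 mf L).
- move=> f Lf; have mf := L1_measurable Lf.
  have i2 A : measurable A -> nu A = p (snd @^-1` A).
    by move=> mA; rewrite -p2//; congr (p _); apply/seteqP; split => z //= [].
  under eq_fun do rewrite mulr1.
  have L := (L1_image measurable_snd i2 mf).1 Lf.
  by split => //; rewrite (Rint_image measurable_snd i2 mf L).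
Qed.

(** The value 0 on non-measurable sets makes this a total function on sets with values in [[0, 1]],
    a point of the compact cube. *)
Definition density_content (P : probability T12 R) (w : T12 -> R) (E : set T12) : R :=
  if `[< measurable E >] then \int[P]_z (\1_E z * w z) else 0.

Lemma density_contentE P w E : measurable E -> density_content P w E = \int[P]_z (\1_E z * w z).
Proof. by move=> mE; rewrite /density_content; case: asboolP. Qed.

Section density_content.
Variables (P : probability T12 R) (w : T12 -> R).
Hypothesis cw : coupling_density mu nu P w.

Lemma L1_density : L1 P w /\ \int[P]_z w z = 1.
Proof.
have [L I] := cdensity1 cw (L1_cst mu 1).
have e : (fun z => 1 * w z) = w by apply/funext => z; rewrite mul1r.
by rewrite -[X in L1 _ X]e -[in X in _ /\ X]e; split => //; rewrite I Rint_cst.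
Qed.

Lemma L1_indic_density E : measurable E -> L1 P (fun z => \1_E z * w z).
Proof.
move=> mE; have [Lw _] := L1_density; under eq_fun do rewrite mulrC.
have mi : measurable_fun setT (\1_E : T12 -> R) by exact: measurable_indic.
apply: (L1M_bounded (C := 1) Lw mi).
by move=> z; rewrite indicE; case: (_ \in _); rewrite ?normr1 ?normr0.
Qed.

Lemma coupling_density_content : coupling_content mu nu (density_content P w).
Proof.
have w0 := cdensity_ge0 cw; have [Lw Iw] := L1_density.
split.
- move=> E; rewrite in_itv/= /density_content; case: asboolP => [mE|_]; last by rewrite lexx ler01.
  apply/andP; split; first by apply: Rintegral_ge0 => z _; rewrite mulr_ge0// indicE.
  rewrite -Iw; apply: le_Rintegral => //; first exact: L1_indic_density.
  by move=> z _; rewrite ler_piMl// indicE; case: (_ \in _).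
- move=> E F mE mF EF0; rewrite !density_contentE//; last exact: measurableU.
  rewrite -RintegralD//; try exact: L1_indic_density.
  apply: eq_Rintegral => z _; rewrite -mulrDl; congr (_ * _).
  rewrite !indicE in_setU; have [Ez|] := boolP (z \in E); have [Fz|] := boolP (z \in F);
    rewrite ?addr0 ?add0r//=.
  by exfalso; move: Ez Fz; rewrite !inE => Ez Fz; have : (E `&` F) z by []; rewrite EF0.
- move=> A mA; rewrite density_contentE; last by apply: measurableX.
  have L1A : L1 mu (\1_A : Rd R n -> R).
    apply: (@L1_bounded _ _ _ _ _ 1); first exact: measurable_indic.
    by move=> z; rewrite indicE; case: (_ \in _); rewrite ?normr1 ?normr0.
  have [_ I] := cdensity1 cw L1A.
  rewrite (_ : \int[P]_z _ = \int[mu]_x \1_A x).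
    rewrite /Rintegral fineK.
      by rewrite integral_indic// setIT.
    exact: integrable_fin_num L1A.
  rewrite -I; apply: eq_Rintegral => z _; congr (_ * _); rewrite !indicE; congr ((nat_of_bool _)%:R).
  by apply/idP/idP; rewrite !inE/= => // -[].
- move=> A mA; rewrite density_contentE; last by apply: measurableX.
  have L1A : L1 nu (\1_A : Rd R m -> R).
    apply: (@L1_bounded _ _ _ _ _ 1); first exact: measurable_indic.
    by move=> z; rewrite indicE; case: (_ \in _); rewrite ?normr1 ?normr0.
  have [_ I] := cdensity2 cw L1A.
  rewrite (_ : \int[P]_z _ = \int[nu]_x \1_A x).
    rewrite /Rintegral fineK.
      by rewrite integral_indic// setIT.
    exact: integrable_fin_num L1A.
  rewrite -I; apply: eq_Rintegral => z _; congr (_ * _); rewrite !indicE; congr ((nat_of_bool _)%:R).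
  by apply/idP/idP; rewrite !inE/= => // -[].
Qed.

Lemma density_rect_comb Q : measurable_rects Q -> L1 P (fun z => rect_comb Q z * w z) /\
  \int[P]_z (rect_comb Q z * w z) = \sum_(q <- Q) q.1 * density_content P w (q.2.1 `*` q.2.2).
Proof.
move=> mQ; have L q : q \in Q -> L1 P (fun z => q.1 * (\1_(q.2.1 `*` q.2.2) z * w z)).
  by move=> /mQ[? ?]; apply: L1Z; apply: L1_indic_density; exact: measurableX.
have E : (fun z => rect_comb Q z * w z) = fun z => \sum_(q <- Q) q.1 * (\1_(q.2.1 `*` q.2.2) z * w z).
  apply/funext => z; rewrite /rect_comb mulr_suml; apply: eq_bigr => q _.
  rewrite -mulrA; congr (_ * (_ * _)); rewrite !indicE -natrM mulnb; congr ((nat_of_bool _)%:R).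
  apply/andP/idP; first by move=> [/set_mem h1 /set_mem h2]; apply/mem_set.
  by move=> /set_mem [h1 h2]; split; apply/mem_set.
rewrite E; elim: Q mQ L {E} => [|q Q IH] mQ L.
  under eq_fun do rewrite big_nil.
  by rewrite big_nil; split; [exact: L1_cst0|rewrite Rint_cst].
have [L' I'] := IH (fun r rQ => mQ r (mem_behead (s := q :: Q) rQ))
  (fun r rQ => L r (mem_behead (s := q :: Q) rQ)).
have Lq := L q (mem_head _ _); have [m1 m2] := mQ q (mem_head _ _).
under eq_fun do rewrite big_cons.
split; first exact: L1D.
rewrite RintegralD// I' big_cons; congr (_ + _).
have mq : measurable (q.2.1 `*` q.2.2) by exact: measurableX.
by rewrite RintegralZl ?density_contentE//; exact: L1_indic_density.
Qed.

End density_content.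

Lemma measurable_rect_comb (Q : seq (R * (set (Rd R n) * set (Rd R m)))) :
  measurable_rects Q -> measurable_fun setT (rect_comb Q).
Proof.
elim: Q => [|q Q IH] mQ.
  rewrite (_ : rect_comb _ = fun=> 0); first exact: measurable_cst.
  by apply/funext => z; rewrite /rect_comb big_nil.
rewrite (_ : rect_comb _ = fun z => q.1 * (\1_(q.2.1) z.1 * \1_(q.2.2) z.2) + rect_comb Q z).
  apply: measurable_funD; last by apply: IH => r rQ; apply: mQ; rewrite inE rQ orbT.
  have [m1 m2] := mQ q (mem_head _ _).
  apply: measurable_funM => //; apply: measurable_tensor; exact: measurable_indic.
by apply/funext => z; rewrite /rect_comb big_cons.
Qed.

Lemma rect_approx_integral P w h e : coupling_density mu nu P w -> rect_approx mu nu h -> 0 < e ->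
  forall Q a c, measurable_rects Q -> L1 mu a -> L1 nu c -> \int[mu]_x a x + \int[nu]_y c y <= e ->
  (forall z, `|h z - rect_comb Q z| <= a z.1 + c z.2) -> L1 P (fun z => h z * w z) /\
  `|\int[P]_z (h z * w z) - \sum_(q <- Q) q.1 * density_content P w (q.2.1 `*` q.2.2)| <= e.
Proof.
move=> cw [mh _] e0 Q a c mQ La Lc ace hQ.
have mr := measurable_rect_comb mQ.
have [LQ IQ] := density_rect_comb cw mQ.
have mD : measurable_fun setT (fun z => h z - rect_comb Q z) by exact: measurable_funB.
have [LD ID] := cdensity_le cw mD La Lc hQ.
have E : (fun z => h z * w z) = fun z => (h z - rect_comb Q z) * w z + rect_comb Q z * w z.
  by apply/funext => z; rewrite mulrBl subrK.
rewrite E; split; first exact: L1D.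
by rewrite RintegralD// IQ addrK; exact: le_trans ace.
Qed.

Variables (Idx : Type) (h : Idx -> Idx -> T12 -> R).
Hypothesis h_approx : forall f g, rect_approx mu nu (h f g).
Hypothesis h_small : forall N (u : 'I_N -> Idx) e, 0 < e ->
  exists2 w, coupling_density mu nu (mu \x nu)%E w &
    forall i j, `|\int[(mu \x nu)%E]_z (h (u i) (u j) z * w z)| <= e.

(** Finite families of test functions with a tolerance, directed by concatenation of families and
    minimum of tolerances. *)
Let J := ({N : nat & 'I_N -> Idx} * {posnum R})%type.

Let contents (i : J) : set (set T12 -> R) := [set c | exists2 w,
  coupling_density mu nu (mu \x nu)%E w /\ c = density_content (mu \x nu)%E w &
  forall k l, `|\int[(mu \x nu)%E]_z (h (projT2 i.1 k) (projT2 i.1 l) z * w z)| <= i.2%:num].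

Lemma coupling_limit : exists p : probability T12 R,
  [/\ forall A, measurable A -> p (A `*` setT) = mu A,
      forall B, measurable B -> p (setT `*` B) = nu B &
      forall f g, L1 p (h f g) /\ \int[p]_z h f g z = 0].
Proof.
have c1 i c : contents i c -> coupling_content mu nu c.
  by move=> [w [cw ->] _]; exact: coupling_density_content.
have c2 i : contents i !=set0.
  have [w cw hw] := h_small (projT2 i.1) (gt0 i.2).
  by exists (density_content (mu \x nu)%E w); exists w.
have c3 i j : exists k, contents k `<=` contents i `&` contents j.
  case: i => -[N1 u1] e1; case: j => -[N2 u2] e2.
  pose u (k : 'I_(N1 + N2)) := match fintype.split k with inl i => u1 i | inr j => u2 j end.
  have ul k : u (lshift N2 k) = u1 k.
    rewrite /u; case: splitP => [k' /= kk|k' /= kk]; first by congr u1; apply/val_inj.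
    by have := ltn_ord k; rewrite kk ltnNge leq_addr.
  have ur k : u (rshift N1 k) = u2 k.
    rewrite /u; case: splitP => [k' /= kk|k' /= kk].
      by have := ltn_ord k'; rewrite -kk ltnNge leq_addr.
    by congr u2; apply/val_inj/(@addnI N1).
  have em : 0 < Num.min e1%:num e2%:num by rewrite lt_min !gt0.
  exists (existT _ (N1 + N2)%N u, PosNum em) => c [w [cw cE] hw].
  split; exists w => // k l /=.
    by have := hw (lshift N2 k) (lshift N2 l); rewrite /= !ul le_min => /andP[].
  by have := hw (rshift N1 k) (rshift N1 l); rewrite /= !ur le_min => /andP[].
have i0 : J by split; [exists 0%N => -[]|exact: (PosNum (@ltr01 R))].
have [p [p1 p2 p3]] := coupling_limitP c1 c2 c3 i0.
have cp := marginals_coupling_density p1 p2.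
have cpE E : measurable E -> density_content p (fun=> 1) E = fine (p E).
  move=> mE; rewrite density_contentE//; under eq_Rintegral do rewrite mulr1.
  by rewrite /Rintegral integral_indic// setIT.
exists p; split => // f g; have ha := h_approx f g.
have Lh : L1 p (h f g).
  have [Q [a [c [mQ La Lc ac hQ]]]] := ha.2 1 ltr01.
  have [] := rect_approx_integral cp ha ltr01 mQ La Lc ac hQ.
  by under eq_fun do rewrite mulr1.
split => //; apply/eqP; rewrite -normr_le0; apply/ler_addgt0Pr => e4 e40; rewrite add0r.
(* Four errors: the rectangle approximation under [p], the same under [w], the distance of the two
   contents on the rectangles used, and the smallness of the integral at this stage. *)
pose e := e4 / 4; have e0 : 0 < e by rewrite divr_gt0.
have [Q [a [c [mQ La Lc ac hQ]]]] := ha.2 e e0.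
pose u (k : 'I_2) := if k == 0 :> nat then f else g.
pose q1 := \sum_(q <- Q) `|q.1| + 1.
have q10 : 0 < q1 by rewrite ltr_wpDl// sumr_ge0.
have [|c' [w [cw ->] hw] hc] := p3 (existT _ 2%N u, PosNum e0) [seq q.2.1 `*` q.2.2 | q <- Q]
  (e / q1) (divr_gt0 e0 q10).
  by move=> E /mapP[q /mQ[m1 m2] ->]; exists q.2.1, q.2.2.
have {}hw := hw ord0 ord_max; rewrite /= /u/= in hw.
have [_ t1] := rect_approx_integral cp ha e0 mQ La Lc ac hQ.
have [_ t2] := rect_approx_integral cw ha e0 mQ La Lc ac hQ.
have t3 : `|\sum_(q <- Q) q.1 * density_content (mu \x nu)%E w (q.2.1 `*` q.2.2) -
    \sum_(q <- Q) q.1 * density_content p (fun=> 1) (q.2.1 `*` q.2.2)| <= e.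
  rewrite -sumrB; apply: le_trans (ler_norm_sum _ _ _) _.
  apply: (@le_trans _ _ (\sum_(q <- Q) `|q.1| * (e / q1))); last first.
    rewrite -mulr_suml mulrCA ler_piMr ?(ltW e0)// ler_pdivrMr// mul1r.
    by rewrite /q1 lerDl.
  rewrite big_seq [leRHS]big_seq; apply: ler_sum => q qQ; have [m1 m2] := mQ q qQ.
  rewrite -mulrBr normrM ler_wpM2l// cpE; last exact: measurableX.
  by apply/ltW/hc/map_f.
rewrite (_ : \int[p]_z h f g z = \int[p]_z (h f g z * 1)); last first.
  by apply: eq_Rintegral => z _; rewrite mulr1.
move: t1 t2 t3 hw; rewrite !ler_norml.
set x1 := \int[p]_z _; set x2 := \int[_]_z _; set x3 := \sum_(q <- Q) _; set x4 := \sum_(q <- Q) _.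
have -> : e4 = 4 * e by rewrite /e; field.
clearbody x1 x2 x3 x4 e; clear.
move=> /andP[a1 a2] /andP[a3 a4] /andP[a5 a6] /andP[a7 a8]; apply/andP; split; lra.
Qed.

End coupling_limit.

(** * The doubled operator *)

Section Rd_functions.
Variables (R : realType) (n : nat).

Lemma measurable_continuous_Rd (F : 'rV[R]_n -> R) : continuous F ->
  measurable_fun [set: Rd R n] (F : Rd R n -> R).
Proof.
move=> cF; apply: (measurability _ (RGenOInfty.measurableE R)) => /= _ [_ [a ->] <-].
rewrite setTI; apply: open_measurable_Rd.
rewrite (_ : _ @^-1` _ = F @^-1` [set y | a < y]).
  by apply: open_comp; [move=> x _; exact: cF|exact: open_gt].
by apply/seteqP; split => x /=; rewrite in_itv/= andbT.
Qed.

Lemma L1_local (mu : probability (Rd R n) R) (h f : Rd R n -> R) (B C : R) :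
  measurable_fun setT h ->
  (forall K : set 'rV[R]_n, compact K -> mu.-integrable (K : set (Rd R n)) (fun x => (h x)%:E)) ->
  measurable_fun setT f -> outside B f -> (forall x, `|f x| <= C) ->
  L1 mu (fun x => h x * f x).
Proof.
move=> mh ih mf fB fC; pose K : set (Rd R n) := [set x : 'rV[R]_n | `|x| <= B].
have mK : measurable K by apply: closed_measurable_Rd; exact: closed_normle.
have iK : L1 mu (h \_ K).
  have := ih _ (@compact_normle R n B); rewrite (integrable_mkcond _ mK) /L1.
  by congr (_.-integrable _ _); apply/funext => x; rewrite /= !patchE; case: ifP.
apply: (L1_dom (g := fun x => C * `|(h \_ K) x|)).
- exact: measurable_funM.
- move=> x; have C0 : 0 <= C by exact: le_trans (fC x).
  rewrite patchE; case: ifPn => [_|/negP xK].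
    by rewrite normrM mulrC ler_wpM2r.
  rewrite (fB x) ?mulr0 ?normr0 ?mulr0//.
  by rewrite ltNge; apply/negP => xB; apply: xK; rewrite inE.
- by apply: L1Z; exact: L1_norm.
Qed.

Lemma LopE (A : 'rV[R]_n -> 'M[R]_n) (b : 'rV[R]_n -> 'rV[R]_n) f x :
  Lop A b f x = \sum_i \sum_j A x i j * partial j (partial i f) x + \sum_i b x 0 i * partial i f x.
Proof.
rewrite /Lop /mxtrace; congr (_ + _); last by apply: eq_bigr => i _; rewrite mxE.
by apply: eq_bigr => i _; rewrite mxE; apply: eq_bigr => j _; rewrite mxE.
Qed.

Lemma Lop_ext (A : 'rV[R]_n -> 'M[R]_n) (b : 'rV[R]_n -> 'rV[R]_n) f g x :
  (forall i, partial i f = partial i g) -> Lop A b f x = Lop A b g x.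
Proof.
move=> /funext e; pose H (p : 'I_n -> 'rV[R]_n -> R) :=
  \sum_i \sum_j A x i j * partial j (p i) x + \sum_i b x 0 i * p i x.
exact: etrans (LopE A b f x) (etrans (congr1 H e) (esym (LopE A b g x))).
Qed.

Definition testfun (f : 'rV[R]_n -> R) := smooth f /\ exists B, outside B f.

Lemma testfun_partial f i : testfun f -> testfun (partial i f).
Proof. by move=> [sf [B fB]]; split; [exact: smooth_partial|exists B; exact: outside_partial]. Qed.

Lemma L1_local_testfun (mu : probability (Rd R n) R) (h : Rd R n -> R) f :
  measurable_fun setT h ->
  (forall K : set 'rV[R]_n, compact K -> mu.-integrable (K : set (Rd R n)) (fun x => (h x)%:E)) ->
  testfun f -> L1 mu (fun x => h x * f x).
Proof.
move=> mh ih [sf [B fB]]; have [C _ fC] := smooth_bounded sf fB.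
apply: (L1_local mh ih _ fB fC).
by apply: measurable_continuous_Rd; exact: smooth_continuous.
Qed.

Lemma measurable_testfun f : testfun f -> measurable_fun setT (f : Rd R n -> R).
Proof. by move=> [sf _]; apply: measurable_continuous_Rd; exact: smooth_continuous. Qed.

Lemma L1_Lop (mu : probability (Rd R n) R) (A : 'rV[R]_n -> 'M[R]_n) (b : 'rV[R]_n -> 'rV[R]_n) f :
  (forall i j, measurable_fun [set: Rd R n] (fun x => A x i j)) ->
  (forall i, measurable_fun [set: Rd R n] (fun x => b x 0 i)) ->
  (forall K : set 'rV[R]_n, compact K ->
        (forall i j, mu.-integrable (K : set (Rd R n)) (fun x => (A x i j)%:E)) /\
        (forall i, mu.-integrable (K : set (Rd R n)) (fun x => (b x 0 i)%:E))) ->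
  testfun f -> L1 mu (Lop A b f).
Proof.
move=> mA mb iAb tf; rewrite (funext (LopE A b f)).
apply: L1D.
  apply: L1_sum => i; apply: L1_sum => j; apply: (@L1_local_testfun mu (fun x => A x i j)) => //.
    by move=> K /iAb[].
  by do 2 apply: testfun_partial.
apply: L1_sum => i; apply: (@L1_local_testfun mu (fun x => b x 0 i)) => //; last exact: testfun_partial.
by move=> K /iAb[].
Qed.

End Rd_functions.

(** * Solutions of the stationary equation as martingale data *)

Section diffusion_data.
Variables (R : realType) (d d1 : nat).
Variables (Sigma : 'rV[R]_d -> 'M[R]_(d, d1)) (b : 'rV[R]_d -> 'rV[R]_d).
Hypothesis mSigma : forall i j, measurable_fun [set: Rd R d] (fun x => Sigma x i j).
Hypothesis mb : forall i, measurable_fun [set: Rd R d] (fun x => b x 0 i).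
Local Notation A := (Amat Sigma).
Local Notation L := (Lop A b).

Definition sigma_grad (f : 'rV[R]_d -> R) (k : 'I_d1) (x : 'rV[R]_d) : R :=
  \sum_i Sigma x i k * partial i f x.

Lemma AmatE x i j : A x i j = \sum_k Sigma x i k * Sigma x j k.
Proof. by rewrite /Amat mxE; apply: eq_bigr => k _; rewrite mxE. Qed.

Lemma measurable_Amat i j : measurable_fun [set: Rd R d] (fun x => A x i j).
Proof.
under eq_fun do rewrite AmatE.
by apply: measurable_sum => k; exact: measurable_funM.
Qed.

(** The carre du champ [<A grad f, grad g>], expanded along the columns of [Sigma]. *)
Lemma sigma_gradM f g x : \sum_k sigma_grad f k x * sigma_grad g k x =
  \sum_i \sum_j A x i j * (partial i f x * partial j g x).
Proof.
rewrite /sigma_grad; under eq_bigr do rewrite mulr_suml.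
rewrite exchange_big/=; apply: eq_bigr => i _.
under eq_bigr do rewrite mulr_sumr.
rewrite exchange_big/=; apply: eq_bigr => j _.
by rewrite AmatE mulr_suml; apply: eq_bigr => k _; ring.
Qed.

(** The chain rule of a second order operator without zero order term: the mixed second derivatives
    of [F] are weighted by the carre du champ of the observables, its first derivatives by their
    drifts. *)
Lemma Lop_comp N (u : 'I_N -> 'rV[R]_d -> R) (F : 'rV[R]_N -> R) x : (forall i, smooth (u i)) ->
  smooth F -> L (F \o (fun y => \row_i u i y)) x =
  genop (fun i k => sigma_grad (u i) k x) (fun i => L (u i) x) F (\row_i u i x).
Proof.
move=> su sF; pose Phi (y : 'rV[R]_d) := \row_i u i y : 'rV[R]_N.
have PhiE j : (fun y => Phi y 0 j) = u j by apply/funext => y; rewrite mxE.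
have dP j y : differentiable (fun z => Phi z 0 j) y by rewrite PhiE; exact: smooth_diff.
have pc G i : smooth G -> partial i (G \o Phi) =
    fun y => \sum_j (partial j G \o Phi) y * partial i (u j) y.
  move=> sG; apply/funext => y; have [_ ->] := partial_comp i (dP ^~ y) (smooth_diff (Phi y) sG).
  by apply: eq_bigr => j _; rewrite PhiE.
have sC G : smooth G -> smooth (G \o Phi).
  by move=> sG; apply: smooth_comp => // j; rewrite PhiE.
have pcc i j : partial j (partial i (F \o Phi)) x =
    \sum_p (\sum_q partial q (partial p F) (Phi x) * partial j (u q) x * partial i (u p) x +
            partial p F (Phi x) * partial j (partial i (u p)) x).
  rewrite pc//.
  have sM p : smooth (fun y => (partial p F \o Phi) y * partial i (u p) y).
    by apply: smoothM; [apply: sC; exact: smooth_partial|exact: smooth_partial].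
  have [_ ->] := partial_sum j (index_enum 'I_N) (fun p => smooth_diff x (sM p)).
  apply: eq_bigr => p _; rewrite partialM; last 2 first.
  - by apply: smooth_diff; apply: sC; exact: smooth_partial.
  - by apply: smooth_diff; exact: smooth_partial.
  by rewrite pc; [rewrite mulr_suml|exact: smooth_partial].
rewrite LopE /genop.
under eq_bigr do under eq_bigr do rewrite pcc mulr_sumr.
under [X in _ + X]eq_bigr do rewrite pc// mulr_sumr.
under [X in _ = X + _]eq_bigr do under eq_bigr do rewrite sigma_gradM.
under [X in _ = _ + X]eq_bigr do rewrite LopE.
transitivity (\sum_p (\sum_q \sum_i \sum_j A x i j * (partial i (u p) x * partial j (u q) x) *
    partial q (partial p F) (Phi x)) +
  \sum_p ((\sum_i \sum_j A x i j * partial j (partial i (u p)) x) * partial p F (Phi x) +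
    (\sum_i b x 0 i * partial i (u p) x) * partial p F (Phi x))); last first.
  congr (_ + _); last by apply: eq_bigr => p _; rewrite mulrDl.
  apply: eq_bigr => p _; apply: eq_bigr => q _; rewrite mulr_suml; apply: eq_bigr => i _.
  by rewrite mulr_suml.
rewrite [in RHS]big_split/= addrA; congr (_ + _); last first.
  rewrite exchange_big/=; apply: eq_bigr => p _; rewrite mulr_suml; apply: eq_bigr => i _.
  by rewrite /Phi/=; ring.
rewrite -big_split/=.
under eq_bigr do rewrite exchange_big/=.
rewrite exchange_big/=; apply: eq_bigr => p _.
rewrite [X in _ = X + _]exchange_big/= mulr_suml -big_split/=; apply: eq_bigr => i _.
rewrite exchange_big/= mulr_suml -big_split/=; apply: eq_bigr => j _.
rewrite mulrDr mulr_sumr; congr (_ + _); last by rewrite /Phi; ring.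
by apply: eq_bigr => q _; rewrite /Phi; ring.
Qed.

Variable mu : probability (Rd R d) R.
Hypothesis Hmu : prob_solution A b mu.

Lemma Lop_shift f c x : smooth f -> L (fun y => f y + c) x = L f x.
Proof.
move=> sf; have e i : partial i (fun y => f y + c) = partial i f.
  apply/funext => y; rewrite partialD; first by rewrite partial_cst addr0.
    exact: smooth_diff.
  exact: differentiable_cst.
exact: Lop_ext.
Qed.

(** Far away all observables vanish and the composition equals the constant [F 0]; subtracting it
    restores compact support without changing the action of [L] ([Lop_shift]). *)
Lemma testfun_comp N (u : 'I_N -> 'rV[R]_d -> R) (F : 'rV[R]_N -> R) : (forall i, testfun (u i)) ->
  smooth F -> testfun (fun x => (F \o (fun y => \row_i u i y)) x + (- F 0)).
Proof.
move=> tu sF; split.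
  apply: smoothD; last exact: smooth_cst.
  apply: smooth_comp => // j; rewrite (_ : (fun y => _) = u j); first by have [] := tu j.
  by apply/funext => y; rewrite mxE.
have /choice[B hB] : forall i, exists B, outside B (u i) by move=> i; have [] := tu i.
exists (\sum_i `|B i|) => x Bx /=; rewrite (_ : \row_i u i x = 0) ?subrr//.
apply/rowP => i; rewrite !mxE; apply: hB; apply: le_lt_trans Bx.
by apply: le_trans (ler_norm _) _; exact: (le_sum_term (f := fun i => `|B i|)).
Qed.

(** Local integrability is given for [A] and not for [Sigma]. The square of one component is bounded
    by the sum over all [k], which is [<A grad f, grad f>]. *)
Lemma L1_sigma_grad2 f k : testfun f -> L1 mu (fun x => sigma_grad f k x ^+ 2).
Proof.
move=> tf; have [iAb _] := Hmu.
have mg : measurable_fun setT (sigma_grad f k : Rd R d -> R).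
  apply: measurable_sum => i; apply: measurable_funM => //.
  by apply: measurable_testfun; exact: testfun_partial.
have bd i : exists C, forall x, `|partial i f x| <= C.
  by have [sf [B fB]] := testfun_partial i tf; have [C _ ?] := smooth_bounded sf fB; exists C.
apply: (L1_dom (g := fun x : Rd R d => \sum_i \sum_j A x i j * (partial i f x * partial j f x))).
- exact: measurable_funX.
- move=> x; rewrite ger0_norm ?sqr_ge0// -sigma_gradM expr2.
  by apply: (le_sum_term (f := fun k => sigma_grad f k x * sigma_grad f k x)) => l; rewrite -expr2 sqr_ge0.
- apply: L1_sum => i; apply: L1_sum => j.
  apply: (@L1_local_testfun _ _ mu (fun x => A x i j) (fun x => partial i f x * partial j f x)).
  + exact: measurable_Amat.
  + by move=> K /iAb[].
  + have [si [B iB]] := testfun_partial i tf; have [sj _] := testfun_partial j tf.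
    by split; [exact: smoothM|exists B => x /iB ->; rewrite mul0r].
Qed.

Lemma diffusion_martingale_data N (u : 'I_N -> 'rV[R]_d -> R) : (forall i, testfun (u i)) ->
  exists Bn, martingale_data (T := Rd R d) mu (fun x => \row_i u i x) (fun i => L (u i))
    (fun i k => sigma_grad (u i) k) Bn.
Proof.
move=> tu; have [iAb inv] := Hmu.
have [C C0 hC] : exists2 C, 0 < C & forall i x, `|u i x| <= C.
  apply: uniform_bound => i; have [su [B uB]] := tu i; exact: smooth_bounded uB.
exists (Num.bound C); split.
- move=> i; under eq_fun do rewrite mxE; exact: measurable_testfun.
- move=> x i; rewrite mxE; apply: le_trans (hC i x) (ltW _).
  by have := archi_boundP (ltW C0).
- by move=> i; apply: L1_Lop => //; exact: measurable_Amat.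
- move=> i k; apply: measurable_sum => j; apply: measurable_funM => //.
  by apply: measurable_testfun; exact: testfun_partial.
- by move=> i k; exact: L1_sigma_grad2.
- move=> F sF; have tF := testfun_comp tu sF.
  have := inv _ ((smooth_compactP _).2 tF); rewrite /Rintegral => h.
  rewrite -[RHS]/(fine 0) -h; congr fine; apply: eq_integral => x _; congr EFin.
  rewrite Lop_shift; last first.
    apply: smooth_comp => // j; rewrite (_ : (fun y => _) = u j); first by have [] := tu j.
    by apply/funext => y; rewrite mxE.
  by rewrite Lop_comp// => j; have [] := tu j.
Qed.

End diffusion_data.

Lemma martingale_dataW d (T : measurableType d) (R : realType) (mu : probability T R)
    n r (phi : T -> 'rV[R]_n) (b : 'I_n -> T -> R) (s : 'I_n -> 'I_r -> T -> R) (B B' : nat) :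
  (B <= B')%N -> martingale_data mu phi b s B -> martingale_data mu phi b s B'.
Proof.
by move=> BB' [h1 h2 *]; split => // x i; rewrite (le_trans (h2 x i))// ler_nat.
Qed.

Section diffusion_coupling.
Variables (R : realType) (d d1 : nat).
Variables (Sigma : 'rV[R]_d -> 'M[R]_(d, d1)) (b : 'rV[R]_d -> 'rV[R]_d).
Hypothesis mSigma : forall i j, measurable_fun [set: Rd R d] (fun x => Sigma x i j).
Hypothesis mb : forall i, measurable_fun [set: Rd R d] (fun x => b x 0 i).
Local Notation A := (Amat Sigma).
Local Notation L := (Lop A b).
Variables (mu nu : probability (Rd R d) R).
Hypothesis Hmu : prob_solution A b mu.
Hypothesis Hnu : prob_solution A b nu.

(** The doubled operator applied to [f(x) g(y)], as [Lop_doubled] shows; the 2 stands for the two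
    off-diagonal blocks, which contribute equally. *)
Definition Lop_tensor (f g : 'rV[R]_d -> R) (z : Rd R d * Rd R d) : R :=
  L f z.1 * g z.2 + f z.1 * L g z.2 + 2 * \sum_k sigma_grad Sigma f k z.1 * sigma_grad Sigma g k z.2.

(** In the first two terms an integrable drift meets a bounded function; in the cross term both
    factors are merely square integrable. This is the reason for three approximation lemmas. *)
Lemma Lop_tensor_approx f g : testfun f -> testfun g -> rect_approx mu nu (Lop_tensor f g).
Proof.
move=> tf tg.
have bd (h : 'rV[R]_d -> R) : testfun h -> exists C, forall x, `|h x| <= C.
  by move=> [sf [B fB]]; have [C _ ?] := smooth_bounded sf fB; exists C.
have [Cf hCf] := bd f tf; have [Cg hCg] := bd g tg.
have LL (m : probability (Rd R d) R) h : prob_solution A b m -> testfun h -> L1 m (L h).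
  by move=> [iAb _] th; apply: L1_Lop => //; exact: measurable_Amat.
have ms h k : testfun h -> measurable_fun setT (sigma_grad Sigma h k : Rd R d -> R).
  move=> th; apply: measurable_sum => i; apply: measurable_funM => //.
  by apply: measurable_testfun; exact: testfun_partial.
apply: rect_approxD; first apply: rect_approxD.
- exact: rect_approx_L1l (LL _ _ Hmu tf) (measurable_testfun tg) hCg.
- exact: rect_approx_L1r (measurable_testfun tf) (LL _ _ Hnu tg) hCf.
apply: rect_approxZ; apply: rect_approx_sum => k; apply: rect_approx_L2; try exact: ms.
  exact: (L1_sigma_grad2 mSigma Hmu).
exact: (L1_sigma_grad2 mSigma Hnu).
Qed.

Lemma diffusion_coupling : exists p : probability (Rd R d * Rd R d)%type R,
  [/\ forall E, measurable E -> p (E `*` setT) = mu E,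
      forall E, measurable E -> p (setT `*` E) = nu E &
      forall f g, testfun f -> testfun g ->
        L1 p (Lop_tensor f g) /\ \int[p]_z Lop_tensor f g z = 0].
Proof.
pose Idx := {f : 'rV[R]_d -> R | testfun f}.
have h1 (f g : Idx) : rect_approx mu nu (Lop_tensor (sval f) (sval g)).
  by apply: Lop_tensor_approx; exact: svalP.
have [N u e e0|p [p1 p2 p3]] := coupling_limit h1; last first.
  by exists p; split => // f g tf tg; exact: p3 (exist _ f tf) (exist _ g tg).
have tu i : testfun (sval (u i)) by exact: svalP.
have [B1 hd1] := diffusion_martingale_data mSigma mb Hmu tu.
have [B2 hd2] := diffusion_martingale_data mSigma mb Hnu tu.
have [w cw hw] := stage_existence (martingale_dataW (leq_maxl B1 B2) hd1)
  (martingale_dataW (leq_maxr B1 B2) hd2) e0.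
exists w => // i j; have := hw i j; rewrite (_ : stage_form _ _ _ _ _ _ i j = Lop_tensor (sval (u i)) (sval (u j)))//.
by apply/funext => z; rewrite /stage_form /Lop_tensor !mxE.
Qed.

End diffusion_coupling.

(** * Derivatives of tensor products *)

Section tensor_functions.
Variables (R : realType) (n m : nat).
Local Notation l := (@lsubmx R 1 n m).
Local Notation r := (@rsubmx R 1 n m).

Definition tensor (f : 'rV[R]_n -> R) (g : 'rV[R]_m -> R) (z : 'rV[R]_(n + m)) : R :=
  f (l z) * g (r z).

Let lE j : (fun z : 'rV[R]_(n + m) => (l z) 0 j) = fun z => z 0 (lshift m j).
Proof. by apply/funext => z; rewrite mxE. Qed.

Let rE j : (fun z : 'rV[R]_(n + m) => (r z) 0 j) = fun z => z 0 (rshift n j).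
Proof. by apply/funext => z; rewrite mxE. Qed.

Lemma smooth_lsubmx f : smooth f -> smooth (f \o l).
Proof. by move=> sf; apply: smooth_comp => // j; rewrite lE => k; exact: ksmooth_coord. Qed.

Lemma smooth_rsubmx f : smooth f -> smooth (f \o r).
Proof. by move=> sf; apply: smooth_comp => // j; rewrite rE => k; exact: ksmooth_coord. Qed.

Lemma partial_lsubmx f i z : smooth f -> partial i (f \o l) z =
  \sum_j partial j f (l z) * (lshift m j == i)%:R.
Proof.
move=> sf; have dl j : differentiable (fun z => (l z) 0 j) z.
  by rewrite lE; exact: differentiable_coord.
have [_ ->] := partial_comp i dl (smooth_diff (l z) sf).
by apply: eq_bigr => j _; rewrite lE partial_coord.
Qed.

Lemma partial_rsubmx f i z : smooth f -> partial i (f \o r) z =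
  \sum_j partial j f (r z) * (rshift n j == i)%:R.
Proof.
move=> sf; have dl j : differentiable (fun z => (r z) 0 j) z.
  by rewrite rE; exact: differentiable_coord.
have [_ ->] := partial_comp i dl (smooth_diff (r z) sf).
by apply: eq_bigr => j _; rewrite rE partial_coord.
Qed.

Lemma partial_tensorl f g i : smooth f -> smooth g ->
  partial (lshift m i) (tensor f g) = tensor (partial i f) g.
Proof.
move=> sf sg; apply/funext => z.
have dl := smooth_diff z (smooth_lsubmx sf); have dr := smooth_diff z (smooth_rsubmx sg).
rewrite (partialM (lshift m i) dl dr) partial_lsubmx// partial_rsubmx//.
rewrite (bigD1 i)//= eqxx mulr1 big1 => [|j /negbTE ji]; last first.
  by rewrite (inj_eq (@lshift_inj _ _)) ji mulr0.
rewrite addr0 big1 => [|j _]; last by rewrite eq_rlshift mulr0.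
by rewrite mulr0 addr0.
Qed.

Lemma partial_tensorr f g i : smooth f -> smooth g ->
  partial (rshift n i) (tensor f g) = tensor f (partial i g).
Proof.
move=> sf sg; apply/funext => z.
have dl := smooth_diff z (smooth_lsubmx sf); have dr := smooth_diff z (smooth_rsubmx sg).
rewrite (partialM (rshift n i) dl dr) partial_lsubmx// partial_rsubmx//.
rewrite big1 => [|j _]; last by rewrite eq_lrshift mulr0.
rewrite mul0r add0r (bigD1 i)//= eqxx mulr1 big1 => [|j /negbTE ji]; last first.
  by rewrite (inj_eq (@rshift_inj _ _)) ji mulr0.
by rewrite addr0.
Qed.

End tensor_functions.

Section doubled_operator.
Variables (R : realType) (d d1 : nat).
Variables (Sigma : 'rV[R]_d -> 'M[R]_(d, d1)) (b : 'rV[R]_d -> 'rV[R]_d).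
Local Notation A := (Amat Sigma).

Lemma sum_block (a : 'I_(d + d) -> 'I_(d + d) -> R) : \sum_i \sum_j a i j =
  \sum_i \sum_j a (lshift d i) (lshift d j) + \sum_i \sum_j a (lshift d i) (rshift d j) +
  (\sum_i \sum_j a (rshift d i) (lshift d j) + \sum_i \sum_j a (rshift d i) (rshift d j)).
Proof.
rewrite big_split_ord/=; congr (_ + _); rewrite -big_split/=; apply: eq_bigr => i _;
  exact: big_split_ord.
Qed.

Lemma Lop_doubled f g z : smooth f -> smooth g ->
  Lop (AA Sigma) (BB b) (tensor f g) z = Lop_tensor Sigma b f g (lsubmx z, rsubmx z).
Proof.
move=> sf sg; pose x : 'rV[R]_d := lsubmx z; pose y : 'rV[R]_d := rsubmx z.
have sp h i : smooth h -> smooth (@partial R d i h) by exact: smooth_partial.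
pose a i j := AA Sigma z i j * partial j (partial i (tensor f g)) z.
pose c i := BB b z 0 i * partial i (tensor f g) z.
apply: etrans (LopE _ _ _ _) _.
have e1 i j : a (lshift d i) (lshift d j) = A x i j * partial j (partial i f) x * g y.
  by rewrite /a !partial_tensorl//; [rewrite /AA block_mxEul /tensor mulrA|exact: sp].
have e2 i j : a (lshift d i) (rshift d j) =
    \sum_k (Sigma x i k * partial i f x) * (Sigma y j k * partial j g y).
  rewrite /a partial_tensorl// partial_tensorr//; last exact: sp.
  rewrite /AA block_mxEur mxE mulr_suml; apply: eq_bigr => k _.
  by rewrite mxE /tensor -/x -/y; ring.
have e3 i j : a (rshift d i) (lshift d j) =
    \sum_k (Sigma y i k * partial i g y) * (Sigma x j k * partial j f x).
  rewrite /a partial_tensorr// partial_tensorl//; last exact: sp.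
  rewrite /AA block_mxEdl mxE mulr_suml; apply: eq_bigr => k _.
  by rewrite mxE /tensor -/x -/y; ring.
have e4 i j : a (rshift d i) (rshift d j) = f x * (A y i j * partial j (partial i g) y).
  by rewrite /a !partial_tensorr//; [rewrite /AA block_mxEdr /tensor mulrCA|exact: sp].
have e5 i : c (lshift d i) = b x 0 i * partial i f x * g y.
  by rewrite /c partial_tensorl// /BB row_mxEl /tensor mulrA.
have e6 i : c (rshift d i) = f x * (b y 0 i * partial i g y).
  by rewrite /c partial_tensorr// /BB row_mxEr /tensor mulrCA.
rewrite -/(a _ _) -/(c _).
rewrite (_ : \sum_i \sum_j _ = \sum_i \sum_j a i j)// (_ : \sum_i BB b z 0 i * _ = \sum_i c i)//.
clearbody a c.
rewrite /Lop_tensor/= -/x -/y.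
have cross : \sum_k sigma_grad Sigma f k x * sigma_grad Sigma g k y =
    \sum_i \sum_j \sum_k (Sigma x i k * partial i f x) * (Sigma y j k * partial j g y).
  under eq_bigr do rewrite mulr_suml.
  rewrite exchange_big/=; apply: eq_bigr => i _; rewrite exchange_big/=; apply: eq_bigr => k _.
  by rewrite mulr_sumr.
have cross' : \sum_k sigma_grad Sigma f k x * sigma_grad Sigma g k y =
    \sum_i \sum_j \sum_k (Sigma y i k * partial i g y) * (Sigma x j k * partial j f x).
  rewrite cross exchange_big/=; do 2 (apply: eq_bigr => ? _); apply: eq_bigr => k _; exact: mulrC.
have Lf : Lop A b f x * g y = \sum_i \sum_j a (lshift d i) (lshift d j) + \sum_i c (lshift d i).
  rewrite LopE mulrDl !mulr_suml; congr (_ + _); last by apply: eq_bigr => i _; rewrite e5.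
  by apply: eq_bigr => i _; rewrite mulr_suml; apply: eq_bigr => j _; rewrite e1.
have Lg : f x * Lop A b g y = \sum_i \sum_j a (rshift d i) (rshift d j) + \sum_i c (rshift d i).
  rewrite LopE mulrDr !mulr_sumr; congr (_ + _); last by apply: eq_bigr => i _; rewrite e6.
  by apply: eq_bigr => i _; rewrite mulr_sumr; apply: eq_bigr => j _; rewrite e4.
have x1 : \sum_k sigma_grad Sigma f k x * sigma_grad Sigma g k y =
    \sum_i \sum_j a (lshift d i) (rshift d j).
  by rewrite cross; do 2 (apply: eq_bigr => ? _); rewrite e2.
have x2 : \sum_k sigma_grad Sigma f k x * sigma_grad Sigma g k y =
    \sum_i \sum_j a (rshift d i) (lshift d j).
  by rewrite cross'; do 2 (apply: eq_bigr => ? _); rewrite e3.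
rewrite Lf Lg mulr_natl mulr2n {1}x1 x2 (sum_block a) big_split_ord/=.
by ring.
Qed.

End doubled_operator.

(** * From products of one-variable functions to all test functions *)

Section box_density.
Variables (R : realType) (n : nat).
Variables (A : 'rV[R]_n -> 'M[R]_n) (b : 'rV[R]_n -> 'rV[R]_n).
Hypothesis mA : forall i j, measurable_fun [set: Rd R n] (fun x => A x i j).
Hypothesis mb : forall i, measurable_fun [set: Rd R n] (fun x => b x 0 i).
Variable pi : probability (Rd R n) R.
Hypothesis iAb : forall K : set 'rV[R]_n, compact K ->
  (forall i j, pi.-integrable (K : set (Rd R n)) (fun x => (A x i j)%:E)) /\
  (forall i, pi.-integrable (K : set (Rd R n)) (fun x => (b x 0 i)%:E)).

Definition coef_bound (C : R) (x : Rd R n) : R :=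
  \sum_i \sum_j `|A x i j * \1_[set y : 'rV[R]_n | `|y| <= C] x| +
  \sum_i `|b x 0 i * \1_[set y : 'rV[R]_n | `|y| <= C] x|.

Lemma L1_coef_bound C : L1 pi (coef_bound C).
Proof.
pose K : set (Rd R n) := [set x : 'rV[R]_n | `|x| <= C].
have mK : measurable K by apply: closed_measurable_Rd; exact: closed_normle.
have LK h : measurable_fun setT h ->
   (forall K : set 'rV[R]_n, compact K -> pi.-integrable (K : set (Rd R n)) (fun x => (h x)%:E)) ->
   L1 pi (fun x => `|h x * \1_K x|).
  move=> mh ih; apply: L1_norm; apply: (@L1_local _ _ pi h (\1_K) C 1) => //.
  - by move=> x Cx; rewrite indicE memNset//= => xK; move: Cx; rewrite ltNge xK.
  - by move=> x; rewrite indicE; case: (_ \in _); rewrite ?normr1 ?normr0.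
apply: L1D.
  apply: L1_sum => i; apply: L1_sum => j; apply: (LK (fun x => A x i j)) => // K' cK'.
  by have [] := iAb cK'.
by apply: L1_sum => i; apply: (LK (fun x => b x 0 i)) => // K' cK'; have [] := iAb cK'.
Qed.

Lemma Lop_linear c (f g : 'rV[R]_n -> R) x : smooth f -> smooth g ->
  Lop A b (fun z => c * f z + g z) x = c * Lop A b f x + Lop A b g x.
Proof.
move=> sf sg.
have p1 h k i : smooth h -> smooth k -> partial i (fun z => c * h z + k z) =
    fun z => c * @partial R n i h z + partial i k z.
  move=> sh sk; apply/funext => z.
  apply: etrans (partialD i (smooth_diff z (smoothZ c sh)) (smooth_diff z sk)) _.
  by congr (_ + _); exact: partialZ (smooth_diff z sh).
have p2 i j : partial j (partial i (fun z => c * f z + g z)) =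
    fun z => c * partial j (partial i f) z + partial j (partial i g) z.
  by rewrite (p1 f g i sf sg) (p1 _ _ j (smooth_partial i sf) (smooth_partial i sg)).
apply: etrans (LopE _ _ _ _) _.
have Ef := LopE A b f x; have Eg := LopE A b g x.
apply: esym; rewrite {}Ef {}Eg mulrDr !mulr_sumr addrACA; congr (_ + _).
  rewrite -big_split/=; apply: eq_bigr => i _; rewrite mulr_sumr -big_split/=.
  by apply: eq_bigr => j _; rewrite (p2 i j) mulrDr mulrCA.
by rewrite -big_split/=; apply: eq_bigr => i _; rewrite (p1 f g i sf sg) mulrDr mulrCA.
Qed.

Hypothesis box0 : forall B (g : 'I_n -> R -> R), 0 <= B -> (forall j, smooth1 (g j)) ->
  (forall j t, t \notin `[- B, B] -> g j t = 0) -> \int[pi]_x Lop A b (boxf g) x = 0.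

Lemma testfun_boxf B (g : 'I_n -> R -> R) : 0 <= B -> (forall j, smooth1 (g j)) ->
  (forall j t, t \notin `[- B, B] -> g j t = 0) -> testfun (boxf g).
Proof. by move=> B0 sg gB; split; [exact: smooth_boxf|exists B; exact: boxf_out]. Qed.

Lemma testfun_boxspan (B : R) (P : 'rV[R]_n -> R) : 0 <= B -> boxspan B P -> smooth P /\ outside B P.
Proof.
move=> B0 hP; split; first exact: smooth_boxspan hP.
elim: hP => [//|c g Q sg gB _ IH] x Bx.
by rewrite IH// (boxf_out B0 gB Bx) mulr0 addr0.
Qed.

Lemma Rint_Lop_boxspan (B : R) (P : 'rV[R]_n -> R) : 0 <= B -> boxspan B P -> \int[pi]_x Lop A b P x = 0.
Proof.
move=> B0; elim=> [|c g Q sg gB hQ IH].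
  rewrite -[RHS](Rint_cst pi 0); apply: eq_Rintegral => x _; rewrite LopE big1 => [|i _]; last first.
    rewrite big1// => j _; rewrite (_ : partial i _ = fun=> 0) ?partial_cst ?mulr0//.
    by apply/funext => y; rewrite partial_cst.
  by rewrite add0r big1// => i _; rewrite partial_cst mulr0.
have [sQ oQ] := testfun_boxspan B0 hQ.
have tQ : testfun Q by split => //; exists B.
have tg := testfun_boxf B0 sg gB.
have Lg := L1_Lop mA mb iAb tg; have LQ := L1_Lop mA mb iAb tQ.
transitivity (\int[pi]_x (c * Lop A b (boxf g) x + Lop A b Q x)).
  by apply: eq_Rintegral => x _; apply: Lop_linear => //; case: tg.
rewrite (RintegralD measurableT (L1Z c Lg) LQ) (RintegralZl c measurableT Lg).
by rewrite IH (box0 B0 sg gB) mulr0 addr0.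
Qed.

(** [psi] and all its approximants vanish outside one ball of radius [C], on which the coefficients
    are integrable. An error in C^2 is thus multiplied by one fixed integral. *)
Lemma Rint_Lop_testfun psi : testfun psi -> \int[pi]_x Lop A b psi x = 0.
Proof.
move=> tpsi; have [spsi [B psiB]] := tpsi.
have [B' [B'0 hP]] := box_approx spsi psiB.
pose C := Num.max B B'; pose K : set (Rd R n) := [set x : 'rV[R]_n | `|x| <= C].
pose G := coef_bound C; have LG : L1 pi G by exact: L1_coef_bound.
have G0 : 0 <= \int[pi]_x G x.
  by apply: Rintegral_ge0 => x _; rewrite addr_ge0 ?sumr_ge0// => i _; rewrite sumr_ge0.
have Lpsi := L1_Lop mA mb iAb tpsi.
apply/eqP; rewrite -normr_le0; apply/ler_addgt0Pr => e e0; rewrite add0r.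
have e1 : 0 < e / (\int[pi]_x G x + 1) by rewrite divr_gt0// ltr_wpDl.
have [P [bP [h0 h1 h2]]] := hP _ e1.
have [sP oP] := testfun_boxspan B'0 bP.
have tP : testfun P by split => //; exists B'.
have LP := L1_Lop mA mb iAb tP.
have -> : \int[pi]_x Lop A b psi x = \int[pi]_x (Lop A b psi x - Lop A b P x).
  by rewrite (RintegralB measurableT Lpsi LP) (Rint_Lop_boxspan B'0 bP) subr0.
apply: (@le_trans _ _ (\int[pi]_x (e / (\int[pi]_x G x + 1) * G x))); last first.
  rewrite (RintegralZl _ measurableT LG) mulrAC ler_pdivrMr ?ltr_wpDl//.
  by rewrite ler_pM2l// lerDl.
apply: Rint_norm_le; [exact: L1B|exact: L1Z|] => x.
have oB (f : 'rV[R]_n -> R) D t : D <= C -> outside D f -> t * f x = t * f x * \1_K x.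
  move=> DC oD; have [xC|xC] := leP `|x : 'rV[R]_n| C.
    by rewrite indicE mem_set ?mulr1.
  by rewrite oD ?mulr0 ?mul0r// (le_lt_trans DC).
have BC : B <= C by rewrite /C le_max lexx.
have B'C : B' <= C by rewrite /C le_max lexx orbT.
have key (f g : 'rV[R]_n -> R) t eps : outside B f -> outside B' g -> `|f x - g x| <= eps ->
    `|t * f x - t * g x| <= eps * `|t * \1_K x|.
  move=> fB gB fg; rewrite (oB f B t BC fB) (oB g B' t B'C gB).
  by rewrite -mulrBl -mulrBr mulrAC normrM mulrC ler_wpM2r.
rewrite !LopE opprD addrACA -!sumrB /G /coef_bound mulrDr !mulr_sumr.
apply: le_trans (ler_normD _ _) _; apply: lerD.
  apply: le_trans (ler_norm_sum _ _ _) _; apply: ler_sum => i _.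
  rewrite -sumrB mulr_sumr; apply: le_trans (ler_norm_sum _ _ _) _; apply: ler_sum => j _.
  exact: (key _ _ (A x i j) _ (outside_partial j (outside_partial i psiB))
    (outside_partial j (outside_partial i oP)) (h2 _ _ _)).
apply: le_trans (ler_norm_sum _ _ _) _; apply: ler_sum => i _.
exact: (key _ _ (b x 0 i) _ (outside_partial i psiB) (outside_partial i oP) (h1 _ _)).
Qed.

End box_density.

Section image_probability.
Context d1 d2 (X : measurableType d1) (Y : measurableType d2) (R : realType).
Variables (m : probability X R) (g : X -> Y).
Hypothesis mg : measurable_fun setT g.

Let image := pushforward m g.
Let image0 : image set0 = 0%E. Proof. by rewrite /image /pushforward preimage_set0 measure0. Qed.
Let image_ge0 A : (0 <= image A)%E. Proof. exact: measure_ge0. Qed.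
Let image_sigma_additive : semi_sigma_additive image.
Proof. exact: (@measure_semi_sigma_additive _ _ _ (pushforward m g)). Qed.
HB.instance Definition _ := isMeasure.Build _ _ _ image image0 image_ge0 image_sigma_additive.
Let image_setT : image setT = 1%E.
Proof. by rewrite /image /pushforward preimage_setT probability_setT. Qed.
HB.instance Definition _ := Measure_isProbability.Build _ _ _ image image_setT.

Lemma image_probability : exists q : probability Y R, forall A, q A = m (g @^-1` A).
Proof. by exists image. Qed.

End image_probability.

Section row_norm.
Variables (R : realType) (n : nat).

Lemma row_norm_ge (x : 'rV[R]_n) i : `|x 0 i| <= `|x|.
Proof.
by rewrite [leRHS]/Num.Def.normr/= mx_normrE; apply/bigmax_geP; right => /=; exists (0, i).
Qed.

Lemma row_norm_le (x : 'rV[R]_n) c : 0 <= c -> (forall i, `|x 0 i| <= c) -> `|x| <= c.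
Proof.
move=> c0 h; rewrite [leLHS]/Num.Def.normr/= mx_normrE; apply/bigmax_leP; split => // -[i j] _.
by rewrite /= (ord1 i).
Qed.

Lemma measurable_coord i : measurable_fun [set: Rd R n] (fun x : Rd R n => (x : 'rV[R]_n) 0 i).
Proof.
apply: measurable_continuous_Rd => x; apply: differentiable_continuous.
exact: differentiable_coord.
Qed.

End row_norm.

(** * Local integrability of the doubled coefficients *)

Section doubled_coefficients.
Variables (R : realType) (d d1 : nat).
Variables (Sigma : 'rV[R]_d -> 'M[R]_(d, d1)) (b : 'rV[R]_d -> 'rV[R]_d).
Hypothesis mSigma : forall i j, measurable_fun [set: Rd R d] (fun x => Sigma x i j).
Hypothesis mb : forall i, measurable_fun [set: Rd R d] (fun x => b x 0 i).
Local Notation A := (Amat Sigma).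
Local Notation Rdd := (Rd R (d + d)).

Lemma measurable_lsubmx : measurable_fun setT (@lsubmx R 1 d d : Rdd -> Rd R d).
Proof. by apply: measurable_Rd => i; under eq_fun do rewrite mxE; exact: measurable_coord. Qed.

Lemma measurable_rsubmx : measurable_fun setT (@rsubmx R 1 d d : Rdd -> Rd R d).
Proof. by apply: measurable_Rd => i; under eq_fun do rewrite mxE; exact: measurable_coord. Qed.

Lemma measurable_row_mx :
  measurable_fun setT ((fun z => row_mx z.1 z.2) : Rd R d * Rd R d -> Rdd).
Proof.
apply: measurable_Rd => i; case: (split_ordP i) => j ->.
  under eq_fun do rewrite row_mxEl.
  by apply: (measurableT_comp (measurable_coord j)); exact: measurable_fst.
under eq_fun do rewrite row_mxEr.
by apply: (measurableT_comp (measurable_coord j)); exact: measurable_snd.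
Qed.

Lemma measurable_AA i j : measurable_fun [set: Rdd] (fun z => AA Sigma z i j).
Proof.
have ml k l : measurable_fun [set: Rdd] (fun z => Sigma (lsubmx z) k l).
  exact: (measurableT_comp (mSigma k l) measurable_lsubmx).
have mr k l : measurable_fun [set: Rdd] (fun z => Sigma (rsubmx z) k l).
  exact: (measurableT_comp (mSigma k l) measurable_rsubmx).
rewrite /AA; case: (split_ordP i) => i' ->; case: (split_ordP j) => j' ->.
- under eq_fun do rewrite block_mxEul AmatE.
  by apply: measurable_sum => k; exact: measurable_funM.
- under eq_fun do rewrite block_mxEur mxE.
  by apply: measurable_sum => k; under eq_fun do rewrite [_^T _ _]mxE; exact: measurable_funM.
- under eq_fun do rewrite block_mxEdl mxE.
  by apply: measurable_sum => k; under eq_fun do rewrite [_^T _ _]mxE; exact: measurable_funM.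
- under eq_fun do rewrite block_mxEdr AmatE.
  by apply: measurable_sum => k; exact: measurable_funM.
Qed.

Lemma measurable_BB i : measurable_fun [set: Rdd] (fun z => BB b z 0 i).
Proof.
rewrite /BB; case: (split_ordP i) => i' ->.
  under eq_fun do rewrite row_mxEl.
  exact: (measurableT_comp (mb i') measurable_lsubmx).
under eq_fun do rewrite row_mxEr.
exact: (measurableT_comp (mb i') measurable_rsubmx).
Qed.

Lemma coef_boundA C x i j : `|x : 'rV[R]_d| <= C -> `|A x i j| <= coef_bound A b C x.
Proof.
move=> xC; rewrite /coef_bound indicE mem_set// mulr1n.
under eq_bigr do under eq_bigr do rewrite mulr1.
rewrite -[leLHS]addr0 lerD ?sumr_ge0//.
apply: le_trans _ (le_sum_term (f := fun i => \sum_j `|A x i j|) i _).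
  exact: (le_sum_term (f := fun j => `|A x i j|)).
by move=> k; rewrite sumr_ge0.
Qed.

Lemma coef_boundb C x i : `|x : 'rV[R]_d| <= C -> `|b x 0 i| <= coef_bound A b C x.
Proof.
move=> xC; rewrite /coef_bound indicE mem_set// mulr1n.
under [X in _ <= _ + X]eq_bigr do rewrite mulr1.
rewrite -[leLHS]add0r lerD ?sumr_ge0// => [k _|]; first by rewrite sumr_ge0.
exact: (le_sum_term (f := fun i => `|b x 0 i|)).
Qed.

Lemma coef_bound_ge0 C x : 0 <= coef_bound A b C x.
Proof. by rewrite /coef_bound addr_ge0 ?sumr_ge0// => i _; rewrite sumr_ge0. Qed.

Lemma lsubmx_le C (z : 'rV[R]_(d + d)) : `|z| <= C -> `|lsubmx z| <= C.
Proof.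
move=> zC; apply: row_norm_le => [|i]; first exact: le_trans zC.
by rewrite mxE (le_trans (row_norm_ge _ _)).
Qed.

Lemma rsubmx_le C (z : 'rV[R]_(d + d)) : `|z| <= C -> `|rsubmx z| <= C.
Proof.
move=> zC; apply: row_norm_le => [|i]; first exact: le_trans zC.
by rewrite mxE (le_trans (row_norm_ge _ _)).
Qed.

(** The inequality between arithmetic and geometric means bounds the off-diagonal blocks by diagonal
    entries of [A], each of a single variable; the marginals therefore control them for any
    coupling. *)
Lemma cross_le x y i j :
  `|\sum_k Sigma x i k * Sigma y j k| <= `|A x i i| + `|A y j j|.
Proof.
apply: le_trans (ler_norm_sum _ _ _) _.
apply: (@le_trans _ _ (A x i i + A y j j)); last by rewrite lerD// ler_norm.
rewrite !AmatE -big_split/=; apply: ler_sum => k _; rewrite normrM.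
have := sqr_ge0 (`|Sigma x i k| - `|Sigma y j k|).
rewrite sqrrB !real_normK ?num_real// -!expr2 => h.
have := mulr_ge0 (normr_ge0 (Sigma x i k)) (normr_ge0 (Sigma y j k)).
by move: (`|Sigma x i k| * _) h => u h h'; lra.
Qed.

Lemma AA_le C z i j : `|z| <= C ->
  `|AA Sigma z i j| <= coef_bound A b C (lsubmx z) + coef_bound A b C (rsubmx z).
Proof.
move=> zC; have xC := lsubmx_le zC; have yC := rsubmx_le zC.
rewrite /AA; case: (split_ordP i) => i' ->; case: (split_ordP j) => j' ->.
- by rewrite block_mxEul -[leLHS]addr0 lerD ?coef_bound_ge0// coef_boundA.
- rewrite block_mxEur mxE; under eq_bigr do rewrite [_^T _ _]mxE.
  by apply: le_trans (cross_le _ _ _ _) _; apply: lerD; exact: coef_boundA.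
- rewrite block_mxEdl mxE; under eq_bigr do rewrite [_^T _ _]mxE.
  by apply: le_trans (cross_le _ _ _ _) _; rewrite addrC; apply: lerD; exact: coef_boundA.
- by rewrite block_mxEdr -[leLHS]add0r lerD ?coef_bound_ge0// coef_boundA.
Qed.

Lemma BB_le C z i : `|z| <= C ->
  `|BB b z 0 i| <= coef_bound A b C (lsubmx z) + coef_bound A b C (rsubmx z).
Proof.
move=> zC; have xC := lsubmx_le zC; have yC := rsubmx_le zC.
rewrite /BB; case: (split_ordP i) => i' ->.
- by rewrite row_mxEl -[leLHS]addr0 lerD ?coef_bound_ge0// coef_boundb.
- by rewrite row_mxEr -[leLHS]add0r lerD ?coef_bound_ge0// coef_boundb.
Qed.

End doubled_coefficients.

Section doubled_solution.
Variables (R : realType) (d d1 : nat).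
Variables (Sigma : 'rV[R]_d -> 'M[R]_(d, d1)) (b : 'rV[R]_d -> 'rV[R]_d).
Hypothesis mSigma : forall i j, measurable_fun [set: Rd R d] (fun x => Sigma x i j).
Hypothesis mb : forall i, measurable_fun [set: Rd R d] (fun x => b x 0 i).
Local Notation A := (Amat Sigma).
Local Notation Rdd := (Rd R (d + d)).
Variables (mu nu : probability (Rd R d) R).
Hypothesis Hmu : prob_solution A b mu.
Hypothesis Hnu : prob_solution A b nu.
Variable p : probability (Rd R d * Rd R d)%type R.
Hypothesis p1 : forall E, measurable E -> p (E `*` setT) = mu E.
Hypothesis p2 : forall E, measurable E -> p (setT `*` E) = nu E.
Hypothesis p0 : forall f g, testfun f -> testfun g ->
  L1 p (Lop_tensor Sigma b f g) /\ \int[p]_z Lop_tensor Sigma b f g z = 0.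
Variable q : probability Rdd R.
Local Notation pair := ((fun z => row_mx z.1 z.2) : Rd R d * Rd R d -> Rdd).
Hypothesis qp : forall E, q E = p (pair @^-1` E).

Let mA := measurable_Amat mSigma.

Let L1_bound C :
  L1 q (fun z => coef_bound A b C (lsubmx z) + coef_bound A b C (rsubmx z)).
Proof.
have [iAb _] := Hmu; have [iAb' _] := Hnu.
have Lm := L1_coef_bound mA mb iAb C; have Ln := L1_coef_bound mA mb iAb' C.
have cp := marginals_coupling_density p1 p2.
have mf : measurable_fun [set: Rdd] (fun z => coef_bound A b C (lsubmx z) + coef_bound A b C (rsubmx z)).
  apply: measurable_funD.
    by have := measurableT_comp (L1_measurable Lm) (@measurable_lsubmx R d).
  by have := measurableT_comp (L1_measurable Ln) (@measurable_rsubmx R d).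
have qp' E : measurable E -> q E = p (pair @^-1` E) by move=> _; exact: qp.
apply: (L1_image (@measurable_row_mx R d) qp' mf).2.
have [L _] := cdensity1 cp Lm; have [L' _] := cdensity2 cp Ln.
rewrite (_ : _ \o _ = fun z => coef_bound A b C z.1 * 1 + coef_bound A b C z.2 * 1); first exact: L1D.
by apply/funext => z; rewrite /= row_mxKl row_mxKr !mulr1.
Qed.

Let locally_integrable (h : Rdd -> R) : measurable_fun setT h ->
  (forall C z, `|z : 'rV[R]_(d + d)| <= C ->
     `|h z| <= coef_bound A b C (lsubmx z) + coef_bound A b C (rsubmx z)) ->
  forall K : set 'rV[R]_(d + d), compact K -> q.-integrable (K : set Rdd) (fun z => (h z)%:E).
Proof.
move=> mh hb K cK.
have mK : measurable (K : set Rdd).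
  by apply: closed_measurable_Rd; apply: compact_closed cK; exact: norm_hausdorff.
have [M [_ hM]] := compact_bounded cK.
have KM z : K z -> `|z| <= M + 1 by move=> Kz; apply: hM => //; rewrite ltrDl.
apply: (le_integrable mK _ _ (integrableS measurableT mK (@subsetT _ _) (L1_bound (M + 1)))).
  by apply: measurable_funTS; exact/measurable_EFinP.
move=> z Kz /=; rewrite lee_fin; apply: le_trans (hb _ _ (KM _ Kz)) _.
exact: ler_norm.
Qed.

Let iAA K : compact K ->
  (forall i j, q.-integrable (K : set Rdd) (fun z => (AA Sigma z i j)%:E)) /\
  (forall i, q.-integrable (K : set Rdd) (fun z => (BB b z 0 i)%:E)).
Proof.
move=> cK; split=> [i j|i]; apply: locally_integrable cK.
- exact: measurable_AA.
- by move=> C z; exact: AA_le.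
- exact: measurable_BB.
- by move=> C z; exact: BB_le.
Qed.

Lemma doubled_solution : prob_solution (AA Sigma) (BB b) q.
Proof.
have mAA := measurable_AA mSigma; have mBB := measurable_BB mb.
split=> // psi /smooth_compactP tpsi.
have Lpsi := L1_Lop mAA mBB iAA tpsi.
have h : \int[q]_z Lop (AA Sigma) (BB b) psi z = 0.
  apply: (Rint_Lop_testfun mAA mBB iAA) tpsi => B g B0 sg gB.
  pose g1 (i : 'I_d) := g (lshift d i); pose g2 (i : 'I_d) := g (rshift d i).
  have t1 : testfun (boxf g1) by apply: (testfun_boxf B0) => [i|i]; [exact: sg|exact: gB].
  have t2 : testfun (boxf g2) by apply: (testfun_boxf B0) => [i|i]; [exact: sg|exact: gB].
  (* Splitting the coordinates into halves turns a product of [d + d] one-variable functions into a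
     tensor product, the case that the coupling was built for. *)
  have bE : boxf g = tensor (boxf g1) (boxf g2).
    apply/funext => z; rewrite /tensor /boxf big_split_ord/=.
    by congr (_ * _); apply: eq_bigr => i _; rewrite mxE.
  have Lb := L1_Lop mAA mBB iAA (testfun_boxf B0 sg gB).
  have mL := L1_measurable Lb.
  have E z : Lop (AA Sigma) (BB b) (boxf g) (pair z) = Lop_tensor Sigma b (boxf g1) (boxf g2) z.
    rewrite bE Lop_doubled; [|by case: t1|by case: t2].
    by rewrite row_mxKl row_mxKr; case: z.
  have [L0 I0] := p0 t1 t2.
  have qp' F : measurable F -> q F = p (pair @^-1` F) by move=> _; exact: qp.
  rewrite (Rint_image (@measurable_row_mx R d) qp' mL).
    by rewrite -[RHS]I0; apply: eq_Rintegral => z _; exact: E.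
  by rewrite /comp (funext E).
(* The real integral is [fine] of the extended one, and [fine] also sends infinities to 0;
   integrability excludes them. *)
by move: h; rewrite /Rintegral => h; rewrite -[LHS]fineK ?h//; exact: integrable_fin_num Lpsi.
Qed.

End doubled_solution.

Theorem theorem3 (R : realType) (d d1 : nat)
  (Sigma : 'rV[R]_d -> 'M[R]_(d, d1)) (b : 'rV[R]_d -> 'rV[R]_d)
  (mSigma : forall i j, measurable_fun [set: Rd R d] (fun x => Sigma x i j))
  (mb : forall i, measurable_fun [set: Rd R d] (fun x => b x 0 i))
  (mu nu : probability (Rd R d) R)
  (Hmu : prob_solution (Amat Sigma) b mu)
  (Hnu : prob_solution (Amat Sigma) b nu)
  (Hint : (\int[mu]_(x in setT)
             ((hsnorm (Sigma x) ^+ 2 / (1 + euclid x ^+ 2)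
               + euclid (b x) / (1 + euclid x))%:E)
         + \int[nu]_(x in setT)
             ((hsnorm (Sigma x) ^+ 2 / (1 + euclid x ^+ 2)
               + euclid (b x) / (1 + euclid x))%:E) < +oo)%E) :
  exists pi : probability (Rd R (d + d)) R,
    prob_solution (AA Sigma) (BB b) pi /\
    (forall A : set (Rd R d), measurable A ->
       pi ((@lsubmx R 1 d d) @^-1` A) = mu A) /\
    (forall A : set (Rd R d), measurable A ->
       pi ((@rsubmx R 1 d d) @^-1` A) = nu A).
Proof.
have [p [p1 p2 p0]] := diffusion_coupling mSigma mb Hmu Hnu.
(* The coupling lives on pairs; its image under concatenation of rows is the measure on [R^(2d)]. *)
have [q qp] := image_probability p (@measurable_row_mx R d).
exists q; split; first exact: (doubled_solution mSigma mb Hmu Hnu p1 p2 p0 qp).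
split=> A mA; rewrite qp.
  by rewrite -p1//; congr (p _); apply/seteqP; split=> z /=; rewrite row_mxKl => // -[].
by rewrite -p2//; congr (p _); apply/seteqP; split=> z /=; rewrite row_mxKr => // -[].
Qed.
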